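(* Let $\check G$ be the Langlands dual group of a simple complex algebraic group of adjoint type, with Lie algebra $\check{\mathfrak g}$. For every $\sigma\in\mathrm{Loc}_{\check G}(\mathcal D^\times)$, the slope $s(\sigma)$ is a rational number whose denominator (in lowest terms) divides a fundamental degree of $\check{\mathfrak g}$.
   Context: $\mathcal D^\times=\mathrm{Spec}\,\mathbb C((t))$. A $\check G$-local system on $\mathcal D^\times$ is a gauge equivalence class of operators $\nabla=\partial_t+A$, $A\in\check{\mathfrak g}((t))$, under $g\cdot\nabla=\partial_t+gAg^{-1}-(\partial_tg)g^{-1}$, $g\in\check G((t))$; $\mathrm{Loc}_{\check G}(\mathcal D^\times)$ is the set of these classes. If $A=A_{-n}t^{-n}+A_{-n+1}t^{-n+1}+\cdots$ with $A_i\in\check{\mathfrak g}$, $A_{-n}\ne0$, then $n$ is the order of singularity and $A_{-n}$ the polar part; the operator is reduced if $A_{-n}$ is not nilpotent. $\sigma$ is regular (singular) if some operator in its class has order of singularity at most $1$, and irregular otherwise. Slope: $s(\sigma)=0$ if $\sigma$ is regular or regular singular. If $\sigma$ is irregular, $s(\sigma)=a/b$ if, after pulling back along $u^b=t$ and writing the connection as $\partial_u+A'(u)$, $A'\in\check{\mathfrak g}((u))$, it is $\check G((t^{1/b}))$-gauge equivalent to a reduced operator (in the variable $u=t^{1/b}$) with order of singularity $a+1$. Such $b$ always exists, and $a/b$ is independent of choices. The fundamental degrees of $\check{\mathfrak g}$ are the integers $d_i+1$, where $d_1,\dots,d_\ell$ are the exponents of $\check{\mathfrak g}$ (the degrees of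 homogeneous generators of the invariant polynomials on $\check{\mathfrak g}$). *)

(* Defs.v *)
From HB Require Import structures.
From mathcomp Require Import all_boot all_order all_algebra.
From mathcomp Require Import boolp classical_sets functions fsbigop reals.
From mathcomp Require Import complex mpoly.
From mathcomp Require Import zify.

Set Implicit Arguments.
Unset Strict Implicit.
Unset Printing Implicit Defensive.

Import Order.TTheory GRing.Theory Num.Theory.

Local Open Scope classical_set_scope.
Local Open Scope ring_scope.

Section LaurentField.
Variable F : fieldType.

Definition laurent_bounded : {pred int -> F} :=
  fun f => `[< exists m : int, forall i : int, i < m -> f i = 0 >].

(* The series sum_i f_i t^i is encoded by its coefficient function. *)
Record laurent := Laurent {
  lcoef :> int -> F;
  lcoef_bounded : lcoef \in laurent_bounded }.

HB.instance Definition _ := [isSub for lcoef].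
HB.instance Definition _ := [Choice of laurent by <:].

Fact laurent_bounded_zmod_closed : zmod_closed laurent_bounded.
Proof.
split; first by apply/asboolP; exists 0.
move=> f g /asboolP[m Hm] /asboolP[k Hk]; apply/asboolP.
exists (Num.min m k) => i; rewrite lt_min => /andP[im ik].
have -> : (f - g) i = f i - g i by [].
by rewrite Hm // Hk // subr0.
Qed.
HB.instance Definition _ :=
  GRing.isZmodClosed.Build (int -> F) laurent_bounded
    laurent_bounded_zmod_closed.
HB.instance Definition _ := [SubChoice_isSubZmodule of laurent by <:].

Implicit Types f g h : laurent.

Lemma laurentP f g : (forall i, f i = g i) -> f = g.
Proof. by move=> fg; apply: val_inj; apply: funext. Qed.

Lemma lcoefD f g i : (f + g) i = f i + g i. Proof. by []. Qed.
Lemma lcoef0 i : (0 : laurent) i = 0. Proof. by []. Qed.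

Lemma lboundP f : exists m : int, forall i : int, i < m -> f i = 0.
Proof. by apply/asboolP; exact: lcoef_bounded f. Qed.

Definition lmul_fun f g : int -> F :=
  fun n => \sum_(i \in [set: int]) f i * g (n - i).

Definition ltrunc (m : int) (K : nat) (f : int -> F) : {poly F} :=
  \poly_(j < K) f (m + j%:Z).

Lemma lmul_funE f g (m k : int) (N K : nat) :
  (forall i : int, i < m -> f i = 0) -> (forall i : int, i < k -> g i = 0) ->
  (N < K)%N ->
  lmul_fun f g (m + k + N%:Z) = (ltrunc m K f * ltrunc k K g)`_N.
Proof.
move=> Hm Hk NK; rewrite coefM /lmul_fun.
rewrite (fsbigE [seq m + (nat_of_ord j)%:Z | j <- enum 'I_N.+1]) //=.
- rewrite big_map big_enum_cond /=.
  apply: eq_big => [j|j _]; first by rewrite in_setT.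
  rewrite !coef_poly (leq_trans (ltn_ord j)) // ifT; last by lia.
  by congr (_ * g _); have := ltn_ord j; lia.
- rewrite map_inj_uniq ?enum_uniq // => i j /addrI [] /val_inj //.
- move=> i _ /negP iN.
  case: (ltP i m) => im; first by rewrite Hm // mul0r.
  rewrite [g _]Hk ?mulr0 //.
  case: (ltP (m + N%:Z) i) => iN'; first by lia.
  case: iN; apply/mapP.
  have H : (absz (i - m)%R < N.+1)%N by lia.
  by exists (Ordinal H); rewrite ?mem_enum //=; lia.
Qed.

Lemma lmul_fun0 f g (m k n : int) :
  (forall i : int, i < m -> f i = 0) -> (forall i : int, i < k -> g i = 0) ->
  n < m + k -> lmul_fun f g n = 0.
Proof.
move=> Hm Hk nmk; rewrite /lmul_fun fsbig1 // => i _.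
case: (ltP i m) => im; first by rewrite Hm // mul0r.
by rewrite [g _]Hk ?mulr0 //; lia.
Qed.

Fact lmul_subproof f g : lmul_fun f g \in laurent_bounded.
Proof.
have [m Hm] := lboundP f; have [k Hk] := lboundP g.
by apply/asboolP; exists (m + k) => i; exact: lmul_fun0.
Qed.
Definition lmul f g := Laurent (lmul_subproof f g).

Fact lmonom_subproof (c : F) (n : int) :
  (fun i : int => if i == n then c else 0) \in laurent_bounded.
Proof. by apply/asboolP; exists n => i; case: eqP => // ->; rewrite ltxx. Qed.
Definition lmonom c n := Laurent (lmonom_subproof c n).

Lemma lmulC : commutative lmul.
Proof.
move=> f g; have [m Hm] := lboundP f; have [k Hk] := lboundP g.
apply: laurentP => n; rewrite /=.
case: (ltP n (m + k)) => nmk.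
  by rewrite (lmul_fun0 Hm Hk) // (lmul_fun0 Hk Hm) // addrC.
have -> : n = m + k + (absz (n - (m + k))%R)%:Z by lia.
set N := absz _.
rewrite (lmul_funE Hm Hk (ltnSn N)) (addrC m k) (lmul_funE Hk Hm (ltnSn N)).
by rewrite mulrC.
Qed.

Lemma lmulDl : left_distributive lmul +%R.
Proof.
move=> f1 f2 g; have [m1 H1] := lboundP f1; have [m2 H2] := lboundP f2.
have [k Hk] := lboundP g; pose m := Num.min m1 m2.
have {}H1 i : i < m -> f1 i = 0 by rewrite lt_min => /andP[/H1].
have {}H2 i : i < m -> f2 i = 0 by rewrite lt_min => /andP[_ /H2].
have H i : i < m -> (f1 + f2) i = 0.
  by move=> im; rewrite lcoefD H1 // H2 // addr0.
apply: laurentP => n; rewrite lcoefD /=.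
case: (ltP n (m + k)) => nmk.
  by rewrite (lmul_fun0 H Hk) // (lmul_fun0 H1 Hk) // (lmul_fun0 H2 Hk) // addr0.
have -> : n = m + k + (absz (n - (m + k))%R)%:Z by lia.
set N := absz _.
rewrite !(lmul_funE _ Hk (ltnSn N)) // -coefD -mulrDl.
suff -> : ltrunc m N.+1 (f1 + f2) = ltrunc m N.+1 f1 + ltrunc m N.+1 f2 by [].
by apply/polyP => i; rewrite coefD !coef_poly; case: ifP => // _; rewrite addr0.
Qed.

Lemma lmulA : associative lmul.
Proof.
move=> f g h; have [m Hm] := lboundP f; have [k Hk] := lboundP g.
have [l Hl] := lboundP h.
have Hfg i : i < m + k -> lmul f g i = 0 by exact: lmul_fun0.
have Hgh i : i < k + l -> lmul g h i = 0 by exact: lmul_fun0.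
apply: laurentP => n.
case: (ltP n (m + (k + l))) => nmk.
  rewrite [LHS](lmul_fun0 Hm Hgh) // [RHS](lmul_fun0 Hfg Hl) //.
  by rewrite -addrA.
have -> : n = m + (k + l) + (absz (n - (m + (k + l)))%R)%:Z by lia.
set N := absz _.
rewrite [LHS](lmul_funE Hm Hgh (ltnSn N)) addrA.
rewrite [RHS](lmul_funE Hfg Hl (ltnSn N)).
transitivity ((ltrunc m N.+1 f * (ltrunc k N.+1 g * ltrunc l N.+1 h))`_N).
  rewrite coefM [RHS]coefM; apply: eq_bigr => i _; congr (_ * _).
  rewrite [LHS]coef_poly ifT; last by lia.
  by apply: lmul_funE => //; lia.
rewrite mulrA coefM [RHS]coefM; apply: eq_bigr => i _; congr (_ * _).
rewrite [RHS]coef_poly ltn_ord.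
by symmetry; apply: lmul_funE => //; lia.
Qed.

Lemma lmul1 : left_id (lmonom 1 0) lmul.
Proof.
move=> g; have [k Hk] := lboundP g.
have H i : i < 0 -> lmonom 1 0 i = 0 by rewrite /= ; case: eqP => // ->.
apply: laurentP => n.
case: (ltP n k) => nk.
  by rewrite [LHS](lmul_fun0 H Hk) ?add0r // Hk.
have -> : n = 0 + k + (absz (n - k)%R)%:Z by lia.
set N := absz _.
rewrite [LHS](lmul_funE H Hk (ltnSn N)).
have -> : ltrunc 0 N.+1 (lmonom 1 0) = 1.
  by apply/polyP => -[|i]; rewrite coef_poly coef1 //=; case: ifP.
by rewrite mul1r coef_poly ltnSn add0r.
Qed.

Lemma lmonom1_neq0 : lmonom 1 0 != 0.
Proof.
apply/eqP => /(congr1 (fun f : laurent => f 0)) /=.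
by move/eqP; rewrite oner_eq0.
Qed.

HB.instance Definition _ :=
  GRing.Zmodule_isComNzRing.Build laurent lmulA lmulC lmul1 lmulDl lmonom1_neq0.

Fixpoint linv_seq (c : nat -> F) (n : nat) : seq F :=
  if n is n'.+1 then
    let s := linv_seq c n' in
    rcons s ((c 0%N)^-1 *
             ((n' == 0%N)%:R - \sum_(i < n') nth 0 s i * c (n' - i)%N))
  else [::].

Lemma size_linv_seq (c : nat -> F) n : size (linv_seq c n) = n.
Proof. by elim: n => //= n IH; rewrite size_rcons IH. Qed.

Lemma nth_linv_seq (c : nat -> F) n m i : (i < n)%N -> (n <= m)%N ->
  nth 0 (linv_seq c m) i = nth 0 (linv_seq c n) i.
Proof.
move=> i_n; elim: m => [|m IH]; first by case: n i_n.
rewrite leq_eqVlt => /orP[/eqP <- //|nm]; rewrite /= nth_rcons size_linv_seq.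
by rewrite (leq_trans i_n) //; exact: IH.
Qed.

Lemma linv_ex f : f != 0 -> exists g, g * f = 1.
Proof.
move=> f0; have [m Hm] := lboundP f.
have [j fj] : exists j : nat, f (m + j%:Z) != 0.
  apply/not_existsP => H; case/eqP: f0; apply: laurentP => i.
  case: (ltP i m) => im; first by rewrite Hm.
  by have /negP/negPn/eqP := H (absz (i - m)%R); rewrite (_ : m + _ = i) //; lia.
have [v fv vmin] := ex_minnP (ex_intro (fun j : nat => f (m + j%:Z) != 0) j fj).
pose k := m + v%:Z.
have Hk i : i < k -> f i = 0.
  move=> ik; case: (ltP i m) => im; first by rewrite Hm.
  apply/eqP; apply: contraTT isT => fi.
  have := vmin (absz (i - m)%R); rewrite (_ : m + _ = i); last by lia.
  by move=> /(_ fi); lia.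
pose c (n : nat) : F := f (k + n%:Z).
have c0 : c 0%N != 0 by rewrite /c addr0.
pose d n := nth 0 (linv_seq c n.+1) n.
pose gf (i : int) := if i < - k then 0 else d (absz (i + k)%R).
have gP : gf \in laurent_bounded.
  by apply/asboolP; exists (- k) => i; rewrite /gf => ->.
exists (Laurent gP).
have Hg i : i < - k -> Laurent gP i = 0 by rewrite /= /gf => ->.
apply: laurentP => n.
case: (ltP n 0) => n0.
  rewrite [LHS](lmul_fun0 Hg Hk); last by lia.
  by rewrite /= ; case: eqP n0 => // ->.
have -> : n = - k + k + (absz n)%:Z by lia.
set N := absz _; rewrite [LHS](lmul_funE Hg Hk (ltnSn N)) coefM.
have -> : (1 : laurent) (- k + k + N%:Z) = (N == 0%N)%:R.
  by rewrite addNr add0r /=; case: (N).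
rewrite big_ord_recr /= subnn !coef_poly ltnSn /=.
rewrite (eq_bigr (fun i : 'I_N => nth 0 (linv_seq c N) i * c (N - i)%N)); last first.
  move=> i _; have iN := ltn_ord i; rewrite !coef_poly !ifT; try lia.
  congr (_ * _); rewrite /gf ifF; last by lia.
  rewrite (_ : absz _ = i); last by lia.
  by rewrite /d (@nth_linv_seq _ i.+1 N).
rewrite /gf ifF; last by lia.
rewrite (_ : absz _ = N); last by lia.
rewrite /d /= nth_rcons size_linv_seq ltnn eqxx.
by rewrite -/(c 0%N) mulrAC mulVf // mul1r addrC subrK.
Qed.

Definition linv f : laurent := xget 0 [set g | f != 0 /\ g * f = 1].

Lemma lmulVf f : f != 0 -> linv f * f = 1.
Proof.
move=> f0; have [g Hg] := linv_ex f0; rewrite /linv.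
by case: xgetP => [h _ [] //|/(_ g)[]].
Qed.

Lemma linv0 : linv 0 = 0.
Proof. by rewrite /linv; case: xgetP => // h _ []; rewrite eqxx. Qed.

HB.instance Definition _ := GRing.ComNzRing_isField.Build laurent lmulVf linv0.

Fact lderiv_subproof f :
  (fun i : int => (i + 1)%:~R * f (i + 1)) \in laurent_bounded.
Proof.
have [m Hm] := lboundP f; apply/asboolP; exists (m - 1) => i im.
by rewrite Hm ?mulr0 //; lia.
Qed.
Definition lderiv f := Laurent (lderiv_subproof f).

(* Substitution f(t) |-> f(u ^ b), meaningful for 0 < b. *)
Fact lsubst_subproof (b : nat) f :
  (fun i : int => if (b%:Z %| i)%Z then f (i %/ b%:Z)%Z else 0)
    \in laurent_bounded.
Proof.
have [m Hm] := lboundP f; apply/asboolP.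
case: b => [|b].
  exists 0 => i i0; case: ifP => //; rewrite dvd0z => /eqP i00.
  by rewrite i00 ltxx in i0.
exists (m * b.+1%:Z) => i im; case: ifP => // /divzK di.
apply: Hm; nia.
Qed.
Definition lsubst (b : nat) f := Laurent (lsubst_subproof b f).

Definition lconst (c : F) : laurent := lmonom c 0.
Definition lvar : laurent := lmonom 1 1.

End LaurentField.

(* Linear algebraic groups are given by their points over an algebraically     *)
(* closed field (reduced groups, hence all of them in characteristic 0), as    *)
(* Zariski closed subgroups of GL_n. Closed subsets of GL_n are cut out by     *)
(* polynomials in the entries alone; regular functions on them also involve    *)
(* negative powers of the determinant.                                         *)
Section AlgebraicGroups.
Variable K : closedFieldType.

Definition mx_meval n (p : {mpoly K[n * n]}) (A : 'M[K]_n) : K :=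
  p.@[fun k => mxvec A 0 k].

Definition zariski_closed n (Z : set 'M[K]_n) : Prop :=
  exists S : set {mpoly K[n * n]},
    Z = [set A | forall p, S p -> mx_meval p A = 0].

Definition vanishing_ideal n (G : set 'M[K]_n) : set {mpoly K[n * n]} :=
  [set p | forall g, G g -> mx_meval p g = 0].

Definition algebraic_group n (G : set 'M[K]_n) : Prop :=
  [/\ exists2 Z, zariski_closed Z & G = [set g | g \in unitmx] `&` Z,
      G 1%:M,
      forall g h, G g -> G h -> G (g *m h)
    & forall g, G g -> G (invmx g)].

Definition zariski_connected n (G : set 'M[K]_n) : Prop :=
  forall Z1 Z2, zariski_closed Z1 -> zariski_closed Z2 ->
    G `<=` Z1 `|` Z2 -> G `&` Z1 `&` Z2 = set0 -> G `<=` Z1 \/ G `<=` Z2.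

Definition normal_subgroup n (H G : set 'M[K]_n) : Prop :=
  H `<=` G /\ forall g h, G g -> H h -> H (g *m h *m invmx g).

Definition simple_group n (G : set 'M[K]_n) : Prop :=
  [/\ algebraic_group G,
      zariski_connected G,
      exists g h, [/\ G g, G h & g *m h <> h *m g]
    & forall H, algebraic_group H -> zariski_connected H ->
        normal_subgroup H G -> H = [set 1%:M] \/ H = G].

Definition adjoint_type n (G : set 'M[K]_n) : Prop :=
  forall z, G z -> (forall g, G g -> z *m g = g *m z) -> z = 1%:M.

Definition unipotent_group n (H : set 'M[K]_n) : Prop :=
  forall h, H h -> exists k, (h - 1%:M) ^+ k = 0.

Definition connected_reductive n (G : set 'M[K]_n) : Prop :=
  [/\ algebraic_group G, zariski_connected G
    & forall H, algebraic_group H -> zariski_connected H ->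
        normal_subgroup H G -> unipotent_group H -> H = [set 1%:M]].

Definition algebraic_morphism n m (G : set 'M[K]_n) (H : set 'M[K]_m)
    (f : 'M[K]_n -> 'M[K]_m) : Prop :=
  [/\ forall g, G g -> H (f g),
      forall g h, G g -> G h -> f (g *m h) = f g *m f h
    & exists (p : 'I_m -> 'I_m -> {mpoly K[n * n]}) (k : nat),
        forall g, G g -> forall i j, f g i j = mx_meval (p i j) g * \det g ^- k].

Definition algebraic_isomorphism n m (G : set 'M[K]_n) (H : set 'M[K]_m)
    (f : 'M[K]_n -> 'M[K]_m) : Prop :=
  algebraic_morphism G H f /\
  exists f', [/\ algebraic_morphism H G f',
                 forall g, G g -> f' (f g) = g & forall h, H h -> f (f' h) = h].

Definition diag_torus r : set 'M[K]_r :=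
  [set diag_mx z | z in [set z : 'rV[K]_r | forall i, z 0 i != 0]].
Arguments diag_torus : clear implicits.

Definition torus n (T : set 'M[K]_n) : Prop :=
  algebraic_group T /\
  exists r (f : 'M[K]_r -> 'M[K]_n), algebraic_isomorphism (diag_torus r) T f.

Definition maximal_torus n (G T : set 'M[K]_n) : Prop :=
  [/\ torus T, T `<=` G
    & forall T', torus T' -> T' `<=` G -> T `<=` T' -> T' = T].

Definition lie_algebra n (G : set 'M[K]_n) : set 'M[K]_n :=
  [set X | forall p, vanishing_ideal G p ->
     \sum_k mx_meval p^`M(k) 1%:M * mxvec X 0 k = 0].

(* A parametrization theta of a maximal torus T by the diagonal torus of rank  *)
(* r identifies X^*(T) and X_*(T) with Z^r, the pairing being the dot product: *)
(* a : 'rV[int]_r is the character theta (diag z) |-> prod_i z_i ^ a_i, and    *)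
(* c : 'rV[int]_r is the cocharacter y |-> theta (diag (y ^ c_i)).             *)
Definition tchar r (a : 'rV[int]_r) (z : 'rV[K]_r) : K :=
  \prod_(i < r) z 0 i ^ a 0 i.

Definition tcochar r (c : 'rV[int]_r) (y : K) : 'rV[K]_r :=
  \row_(i < r) (y ^ c 0 i).

Definition is_root n r (G : set 'M[K]_n) (theta : 'M[K]_r -> 'M[K]_n)
    (a : 'rV[int]_r) : Prop :=
  a <> 0 /\
  exists X, [/\ lie_algebra G X, X <> 0
    & forall z : 'rV[K]_r, (forall i, z 0 i != 0) ->
        theta (diag_mx z) *m X *m invmx (theta (diag_mx z)) = tchar a z *: X].

Definition SL2 : set 'M[K]_2 := [set g | \det g = 1].
Definition sl2_upper (x : K) : 'M[K]_2 := 1%:M + x *: delta_mx 0 1.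
Definition sl2_lower (x : K) : 'M[K]_2 := 1%:M + x *: delta_mx 1 0.
Definition sl2_diag (y : K) : 'M[K]_2 :=
  y *: delta_mx 0 0 + y^-1 *: delta_mx 1 1.

(* c is the coroot a^vee of the root a: it is y |-> phi (diag (y, 1/y)) for a  *)
(* nontrivial phi : SL_2 -> G carrying the two unipotent one-parameter         *)
(* subgroups to the root subgroups of a and - a.                               *)
Definition root_coroot n r (G : set 'M[K]_n) (theta : 'M[K]_r -> 'M[K]_n)
    (a c : 'rV[int]_r) : Prop :=
  is_root G theta a /\
  exists phi : 'M[K]_2 -> 'M[K]_n,
    [/\ algebraic_morphism SL2 G phi,
        phi (sl2_upper 1) <> 1%:M,
        forall (z : 'rV[K]_r) (x : K), (forall i, z 0 i != 0) ->
          theta (diag_mx z) *m phi (sl2_upper x) *m invmx (theta (diag_mx z)) =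
          phi (sl2_upper (tchar a z * x)),
        forall (z : 'rV[K]_r) (x : K), (forall i, z 0 i != 0) ->
          theta (diag_mx z) *m phi (sl2_lower x) *m invmx (theta (diag_mx z)) =
          phi (sl2_lower ((tchar a z)^-1 * x))
      & forall y : K, y != 0 ->
          phi (sl2_diag y) = theta (diag_mx (tcochar c y))].

(* The root data (X^*, R, X_*, R^vee) of (G, T) and (X_*, R^vee, X^*, R) of    *)
(* (Gd, Td) are isomorphic. The isomorphism of lattices is absorbed in the     *)
(* choice of the parametrizations.                                             *)
Definition langlands_dual n m (G : set 'M[K]_n) (Gd : set 'M[K]_m) : Prop :=
  connected_reductive G /\ connected_reductive Gd /\
  exists r T Td (theta : 'M[K]_r -> 'M[K]_n) (thetad : 'M[K]_r -> 'M[K]_m),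
    [/\ maximal_torus G T, algebraic_isomorphism (diag_torus r) T theta,
        maximal_torus Gd Td, algebraic_isomorphism (diag_torus r) Td thetad
      & forall a c : 'rV[int]_r,
          root_coroot G theta a c <-> root_coroot Gd thetad c a].

(* A polynomial function on the Lie algebra is the restriction of a polynomial *)
(* in the matrix entries.                                                      *)
Definition invariant_polynomial n (G : set 'M[K]_n) (p : {mpoly K[n * n]}) :
    Prop :=
  forall g X, G g -> lie_algebra G X ->
    mx_meval p (g *m X *m invmx g) = mx_meval p X.

(* ds lists the degrees of algebraically independent homogeneous generators of *)
(* the algebra of invariant polynomials on the Lie algebra of G.               *)
Definition fundamental_degrees n (G : set 'M[K]_n) (ds : seq nat) : Prop :=
  exists f : 'I_(size ds) -> {mpoly K[n * n]},
    [/\ forall i, invariant_polynomial G (f i),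
        forall i, f i \is (nth 0%N ds i).-homog,
        forall Q : {mpoly K[size ds]},
          (forall X, lie_algebra G X -> Q.@[fun i => mx_meval (f i) X] = 0) ->
          Q = 0
      & forall p, invariant_polynomial G p ->
          exists Q : {mpoly K[size ds]}, forall X, lie_algebra G X ->
            mx_meval p X = Q.@[fun i => mx_meval (f i) X]].

(* Nilpotency of X as an element of the Lie algebra of G, meant for semisimple *)
(* G.                                                                          *)
Definition ad_nilpotent n (G : set 'M[K]_n) (X : 'M[K]_n) : Prop :=
  exists k : nat, forall Y, lie_algebra G Y ->
    iter k (fun Z => X *m Z - Z *m X) Y = 0.

End AlgebraicGroups.

Section LocalSystems.
Variables (K : closedFieldType) (n : nat) (G : set 'M[K]_n).

Definition mxcoef (i : int) (A : 'M[laurent K]_n) : 'M[K]_n :=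
  map_mx (fun f : laurent K => f i) A.

Definition laurent_points : set 'M[laurent K]_n :=
  [set g | g \in unitmx /\ forall p, vanishing_ideal G p ->
     mmap (@lconst K) (fun k => mxvec g 0 k) p = 0].

(* Lie(G)((t)) = Lie(G) (x) K((t)), Lie(G) being finite dimensional. *)
Definition laurent_lie : set 'M[laurent K]_n :=
  [set A | forall i, lie_algebra G (mxcoef i A)].

(* The operator d/dt + A is represented by A. *)
Definition gauge (g A : 'M[laurent K]_n) : 'M[laurent K]_n :=
  g *m A *m invmx g - map_mx (@lderiv K) g *m invmx g.

Definition gauge_class (A : 'M[laurent K]_n) : set 'M[laurent K]_n :=
  [set gauge g A | g in laurent_points].

Definition Loc : set (set 'M[laurent K]_n) :=
  [set gauge_class A | A in laurent_lie].

Definition order_of_singularity (A : 'M[laurent K]_n) (N : int) : Prop :=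
  mxcoef (- N) A <> 0 /\ forall i : int, i < - N -> mxcoef i A = 0.

(* The operator with A = 0, which has no polar part, counts as regular. *)
Definition regular_singular (sigma : set 'M[laurent K]_n) : Prop :=
  exists2 A, sigma A &
    A = 0 \/ exists2 N : int, order_of_singularity A N & N <= 1.

Definition reduced_of_order (A : 'M[laurent K]_n) (N : int) : Prop :=
  order_of_singularity A N /\ ~ ad_nilpotent G (mxcoef (- N) A).

(* Along t = u ^ b, A(t) dt becomes b u ^ (b - 1) A(u ^ b) du. *)
Definition pullback (b : nat) (A : 'M[laurent K]_n) : 'M[laurent K]_n :=
  (b%:R * lvar K ^+ b.-1) *: map_mx (lsubst b) A.

(* s is the slope of sigma. This relation is functional and total on Loc G for *)
(* semisimple G (existence of reduced forms after ramification, independence of *)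
(* choices), so it is the graph of the slope function.                         *)
Definition slope (sigma : set 'M[laurent K]_n) (s : rat) : Prop :=
  (regular_singular sigma /\ s = 0) \/
  (~ regular_singular sigma /\
   exists A (a b : nat), [/\ sigma A, (0 < b)%N, s = a%:Q / b%:Q &
     exists2 B, gauge_class (pullback b A) B & reduced_of_order B a.+1]).

End LocalSystems.

(* Main.v *)
(* Let [B] be reduced of order [a + 1] in the variable [u], [u ^ b = t], and   *)
(* gauge equivalent by [g] to the pullback of a connection over [t]. For a     *)
(* primitive [b]-th root of unity [z], the connection [z B (z u)] is then      *)
(* equivalent to [B] by [h = g (z u) g (u)^-1], and its polar part is          *)
(* [z ^ -a X], [X] being that of [B]. After gauge transformations in           *)
(* [G (K[[u]])] that make enough coefficients of [B] commute with the          *)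
(* semisimple part [X_s], comparing leading coefficients shows that [h]        *)
(* intertwines [X_s] and [z ^ -a X_s]. So [P (X_s) = z ^ (-ad) P (X_s)] for    *)
(* every invariant polynomial [P] of degree [d]. As [X_s] is not nilpotent,    *)
(* some fundamental invariant is nonzero at [X_s], whence [b] divides [ad].    *)
(*                                                                             *)
(* For slope 0 one only needs a fundamental degree to exist, i.e., a           *)
(* non-nilpotent element in the Lie algebra of the dual group. A torus of      *)
(* positive rank provides one. In rank 0, an element of the simple group with  *)
(* an eigenvalue of infinite order would generate a nontrivial torus in its    *)
(* Zariski closure; so all eigenvalues are roots of unity, traces take         *)
(* countably many values, hence are constant by connectedness and the          *)
(* Nullstellensatz over an uncountable field, and the group is unipotent,      *)
(* thus trivial.                                                               *)
Require Import Defs.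
From HB Require Import structures.
From mathcomp Require Import all_boot all_order all_algebra.
From mathcomp Require Import boolp classical_sets functions fsbigop reals.
From mathcomp Require Import complex mpoly.
From mathcomp Require Import cyclic separable cyclotomic cardinality zify ring lra.

Set Implicit Arguments.
Unset Strict Implicit.
Unset Printing Implicit Defensive.

Import Order.TTheory GRing.Theory Num.Theory.
Local Open Scope ring_scope.

(** The theorem is Galois descent along [t = u ^ b]. A connection pulled back from [t] is invariant
    under [u |-> z u] when [z ^ b = 1] ([twist_pullback]), so its reduced form [B] is gauge
    equivalent to its own twist. Gauge equivalent connections of the same pole order, at least 2,
    have polar parts whose semisimple parts share all invariants ([polar_invariant]). The two polar
    parts here are [X] and [z ^ (-a) X], so a homogeneous invariant of degree [d] that is nonzero at
    [X_s] forces [b] to divide [a d] ([reduced_pullback_degree]), and the denominator of [a / b]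
    divides [d].

    Leading terms cannot be compared directly, because the gauge transformation may itself have
    poles. [normalise] therefore makes as many coefficients as desired commute with [X_s], and
    [intertwiner_order] deduces that the transformation intertwines the semisimple parts to an order
    exceeding the poles of the transformation and of its inverse.

    The group is known only through the polynomials vanishing on it, so its points over [K((u))] and
    over dual numbers are handled by evaluating these polynomials; [descent] passes from points over
    [K] to points over other rings. Membership of new elements comes from one principle,
    [exponential_closure]: if a polynomial vanishes on [\sum_i Lam_i ^ k M_i(k)] for all natural
    [k], with [M_i] polynomial, it still vanishes after [Lam] is replaced by any [z] with the same
    multiplicative relations and the argument of [M_i] by 0. This gives semisimple parts in the Lie
    algebra ([lie_semisimple]), derivatives of cocharacters ([diag_torus_lie]) and tori in the
    closure of a cyclic group ([torus_of_eigenvalue]).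

    For slope 0 some degree must exist, which follows from a non-nilpotent element of the dual Lie
    algebra ([dual_lie_not_nilpotent]). *)

Lemma sum_ord_vanish (V : nmodType) (f : nat -> V) r m :
  (forall j, (r <= j)%N -> f j = 0) -> (forall j, (m <= j)%N -> f j = 0) ->
  \sum_(j < r) f j = \sum_(j < m) f j.
Proof.
have W r' m' : (forall j, (r' <= j)%N -> f j = 0) ->
    \sum_(j < r') f j = \sum_(j < r' + m') f j.
  move=> f0; rewrite big_split_ord /= [X in _ = _ + X]big1 ?addr0 // => j _.
  by rewrite f0 ?leq_addr.
by move=> fr fm; rewrite (W r m fr) (W m r fm) addnC.
Qed.

(** * Jordan decompositions, iterated commutators and the Fitting decomposition *)

Section LinearAlgebra.
Variable F : fieldType.

Lemma prod_coprime_dvdp (I : eqType) (r : seq I) (P : I -> {poly F}) q :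
  uniq r -> {in r &, forall i j, i != j -> coprimep (P i) (P j)} ->
  {in r, forall i, P i %| q} -> \prod_(i <- r) P i %| q.
Proof.
elim: r => [|i r IHr] /=; first by rewrite big_nil dvd1p.
case/andP=> ir ur co dv; rewrite big_cons Gauss_dvdp.
  rewrite dv ?mem_head //= IHr // => [j k jr kr|j jr].
    by apply: co; rewrite inE ?jr ?kr orbT.
  by apply: dv; rewrite inE jr orbT.
rewrite big_seq; elim/big_rec: _ => [|j p jr cop]; first by rewrite coprimep1.
rewrite coprimepMr cop andbT; apply: co; rewrite ?mem_head // ?inE ?jr ?orbT //.
by apply: contraNneq ir => ->.
Qed.

(** The [E i] are the spectral projections and [N] is the nilpotent part. Distinctness of the
    [lam i] and nonvanishing of the [E i] are kept apart, in [jordan_exists]. *)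
Record jordan_decomposition n (X : 'M[F]_n) s (lam : 'I_s -> F)
    (E : 'I_s -> 'M[F]_n) (N : 'M[F]_n) : Prop := JordanDecomposition {
  jordanE : X = \sum_i lam i *: E i + N;
  jordan_orth : forall i j, E i *m E j = if i == j then E i else 0;
  jordan_sum : \sum_i E i = 1%:M;
  jordan_comm : forall i, N *m E i = E i *m N;
  jordan_nilp : exists k, N ^+ k = 0 }.

Lemma jordan_semisimple n (X : 'M[F]_n) s (lam : 'I_s -> F) E N :
  jordan_decomposition X lam E N ->
  jordan_decomposition (\sum_i lam i *: E i) lam E 0.
Proof.
case=> _ orth sumE _ _; split=> // [|i|]; first by rewrite addr0.
  by rewrite mul0mx mulmx0.
by exists 1%N; rewrite expr1.
Qed.

Section JordanTheory.
Variables (n : nat) (X : 'M[F]_n) (s : nat) (lam : 'I_s -> F).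
Variables (E : 'I_s -> 'M[F]_n) (N : 'M[F]_n).
Hypothesis jX : jordan_decomposition X lam E N.

Lemma jordan_comm_ss : N *m (\sum_i lam i *: E i) = (\sum_i lam i *: E i) *m N.
Proof.
rewrite mulmx_sumr mulmx_suml; apply: eq_bigr => i _.
by rewrite -scalemxAr -scalemxAl (jordan_comm jX).
Qed.

Lemma jordan_ssE i : (\sum_j lam j *: E j) *m E i = lam i *: E i.
Proof.
rewrite mulmx_suml (bigD1 i) //= -scalemxAl (jordan_orth jX) eqxx.
rewrite big1 ?addr0 // => j ji; rewrite -scalemxAl (jordan_orth jX) (negPf ji).
by rewrite scaler0.
Qed.

Lemma jordan_Ess i : E i *m (\sum_j lam j *: E j) = lam i *: E i.
Proof.
rewrite mulmx_sumr (bigD1 i) //= -scalemxAr (jordan_orth jX) eqxx.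
rewrite big1 ?addr0 // => j ji; rewrite -scalemxAr (jordan_orth jX) eq_sym.
by rewrite (negPf ji) scaler0.
Qed.

Lemma jordan_mulE i : X *m E i = lam i *: E i + N *m E i.
Proof. by rewrite (jordanE jX) mulmxDl jordan_ssE. Qed.

Lemma jordan_Emul i : E i *m X = lam i *: E i + N *m E i.
Proof. by rewrite (jordanE jX) mulmxDr jordan_Ess (jordan_comm jX). Qed.

End JordanTheory.

Section Intertwining.
Variables (n : nat) (X X' : 'M[F]_n) (s s' : nat).
Variables (lam : 'I_s -> F) (lam' : 'I_s' -> F).
Variables (E : 'I_s -> 'M[F]_n) (E' : 'I_s' -> 'M[F]_n) (N N' : 'M[F]_n).
Hypotheses (jX : jordan_decomposition X lam E N).
Hypotheses (jX' : jordan_decomposition X' lam' E' N').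

Let T (Z : 'M[F]_n) := X' *m Z - Z *m X.

(** On this block [T] is the nonzero scalar [lam' i - lam j] plus the nilpotent operator
    [W |-> N' W - W N], hence injective. The induction shows [N' ^ a W N ^ b = 0] downwards on
    [a + b]. *)
Let block_inj i j (W : 'M[F]_n) : lam' i != lam j ->
  E' i *m W = W -> W *m E j = W -> T W = 0 -> W = 0.
Proof.
move=> lij EW WE TW.
have [k Nk] := jordan_nilp jX; have [k' Nk'] := jordan_nilp jX'.
have eqW : (lam' i - lam j) *: W = W *m N - N' *m W.
  have XW : X' *m W = lam' i *: W + N' *m W.
    by rewrite -[in LHS]EW mulmxA (jordan_mulE jX') mulmxDl -scalemxAl -mulmxA EW.
  have WX : W *m X = lam j *: W + W *m N.
    rewrite -[in LHS]WE -mulmxA (jordan_Emul jX) (jordan_comm jX) mulmxDr.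
    by rewrite -scalemxAr mulmxA WE.
  move/eqP: TW; rewrite /T XW WX subr_eq0 => /eqP eqW.
  apply/eqP; rewrite scalerBl subr_eq addrAC eq_sym subr_eq addrC; apply/eqP.
  by rewrite eqW addrC.
suff H d : forall a b, (k + k' <= a + b + d)%N -> N' ^+ a *m W *m N ^+ b = 0.
  by have := H (k + k')%N 0%N 0%N (leqnn _); rewrite !expr0 mul1mx mulmx1.
elim: d => [|d IH] a b.
  rewrite addn0 => kab; have [ka|ka] := leqP k' a.
    by rewrite -(subnK ka) exprD Nk' mulr0 !mul0mx.
  have kb : (k <= b)%N by lia.
  by rewrite -(subnKC kb) exprD Nk mul0r mulmx0.
move=> kab; apply: (scalerI (a := lam' i - lam j)); first by rewrite subr_eq0.
rewrite scaler0 scalemxAl scalemxAr eqW mulmxBr mulmxBl.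
have -> : N' ^+ a *m (W *m N) *m N ^+ b = N' ^+ a *m W *m N ^+ b.+1.
  by rewrite exprS -mulmxE !mulmxA.
have -> : N' ^+ a *m (N' *m W) *m N ^+ b = N' ^+ a.+1 *m W *m N ^+ b.
  by rewrite exprSr -mulmxE !mulmxA.
by rewrite !IH ?subr0 //; lia.
Qed.

(** [T] preserves each block [E' i Z E j] and is injective on it when [lam' i] differs from [lam j].
    So only blocks with equal eigenvalues survive in [Z], and on these the two products agree. *)
Lemma iter_commutator_ss m (Z : 'M[F]_n) : iter m T Z = 0 ->
  (\sum_i lam' i *: E' i) *m Z = Z *m (\sum_j lam j *: E j).
Proof.
have TB i j W : T (E' i *m W *m E j) = E' i *m T W *m E j.
  rewrite /T mulmxBr mulmxBl !mulmxA (jordan_mulE jX') (jordan_comm jX').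
  by rewrite -(jordan_comm jX') -(jordan_Emul jX') -!mulmxA (jordan_Emul jX)
             -(jordan_mulE jX).
have EE i : E' i *m E' i = E' i by rewrite (jordan_orth jX') eqxx.
have EE2 i : E i *m E i = E i by rewrite (jordan_orth jX) eqxx.
move=> TZ; have blk i j : (lam' i - lam j) *: (E' i *m Z *m E j) = 0.
  have [->|lij] := eqVneq (lam' i) (lam j); first by rewrite subrr scale0r.
  suff -> : E' i *m Z *m E j = 0 by rewrite scaler0.
  have : iter m T (E' i *m Z *m E j) = 0.
    have -> : iter m T (E' i *m Z *m E j) = E' i *m iter m T Z *m E j.
      by elim: (m) => //= k ->; rewrite TB.
    by rewrite TZ mulmx0 mul0mx.
  elim: (m) => //= k IH TW; apply: IH.
  have HI : iter k T (E' i *m Z *m E j) = E' i *m iter k T Z *m E j.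
    by elim: (k) => //= l ->; rewrite TB.
  apply: (block_inj lij); last exact: TW.
    by rewrite HI !mulmxA EE.
  by rewrite HI -!mulmxA EE2.
rewrite -[LHS]mulmx1 -(jordan_sum jX) -[RHS]mul1mx -(jordan_sum jX').
have -> : (\sum_i lam' i *: E' i) *m Z *m (\sum_j E j) =
    \sum_i \sum_j lam' i *: (E' i *m Z *m E j).
  rewrite !mulmx_suml; apply: eq_bigr => i _; rewrite mulmx_sumr.
  by apply: eq_bigr => j _; rewrite -!scalemxAl.
have -> : (\sum_i E' i) *m (Z *m (\sum_j lam j *: E j)) =
    \sum_i \sum_j lam j *: (E' i *m Z *m E j).
  rewrite mulmx_suml; apply: eq_bigr => i _; rewrite mulmxA mulmx_sumr.
  by apply: eq_bigr => j _; rewrite -!scalemxAr.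
apply: eq_bigr => i _; apply: eq_bigr => j _; apply/eqP.
by rewrite -subr_eq0 -scalerBl blk.
Qed.

End Intertwining.

(** After [m] commutators every term is a multiple of some [X ^ a Y X ^ b] with [a + b = m]. It
    shows that a polar part which is not [ad_nilpotent] is not a nilpotent matrix. *)
Lemma nilpotent_iter_commutator n (X : 'M[F]_n) k : X ^+ k = 0 ->
  forall Y, iter (k + k) (fun Z => X *m Z - Z *m X) Y = 0.
Proof.
move=> Xk Y.
suff H m Z : (forall a b, (a + b = m)%N -> X ^+ a *m Z *m X ^+ b = 0) ->
    iter m (fun Z => X *m Z - Z *m X) Z = 0.
  apply: H => a b abk; have [ka|ka] := leqP k a.
    by rewrite -(subnK ka) exprD Xk mulr0 !mul0mx.
  have kb : (k <= b)%N by lia.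
  by rewrite -(subnKC kb) exprD Xk mul0r mulmx0.
elim: m Z => [|m IH] Z H; first by have := H 0%N 0%N; rewrite !expr0 mul1mx mulmx1; apply.
rewrite iterSr; apply: IH => a b abm.
rewrite mulmxBr mulmxBl.
have -> : X ^+ a *m (X *m Z) *m X ^+ b = X ^+ a.+1 *m Z *m X ^+ b.
  by rewrite exprSr -mulmxE !mulmxA.
have -> : X ^+ a *m (Z *m X) *m X ^+ b = X ^+ a *m Z *m X ^+ b.+1.
  by rewrite exprS -mulmxE !mulmxA.
by rewrite !H ?subrr //; lia.
Qed.

Lemma mxtrace_idempotent n (E : 'M[F]_n) : E *m E = E -> \tr E = (\rank E)%:R.
Proof.
move=> EE; rewrite -{1}(mulmx_base E) mxtrace_mulC.
suff -> : row_base E *m col_base E = 1%:M by rewrite mxtrace1.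
have rf := row_base_free E; have cf := col_base_full E.
apply: (row_free_inj rf); apply: (row_full_inj cf); rewrite /= mul1mx.
by rewrite mulmxA (mulmxA (col_base E) (row_base E)) -(mulmxA (_ *m _)) mulmx_base.
Qed.

(** The projection onto the part where [X] is invertible is a polynomial in [X] without constant
    term, so its trace is 0. That trace is its rank, and the characteristic is 0. *)
Lemma trace_pow_nilpotent n (X : 'M[F]_n) : [pchar F] =i pred0 ->
  (forall k, (0 < k)%N -> \tr (X ^+ k) = 0) -> exists k, X ^+ k = 0.
Proof.
case: n X => [|n] X charF trX; first by exists 0%N; apply: flatmx0.
have chi0 : char_poly X != 0 by rewrite monic_neq0 ?char_poly_monic.
have [m [q q0 chiE]] := multiplicity_XsubC (char_poly X) 0.
rewrite chi0 /= subr0 in q0 chiE.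
(* The exponent is [m.+1] rather than [m] so that [e] has no constant term even when [m = 0]. *)
have co : coprimep q ('X^(m.+1)) by rewrite coprimep_expr // -(subr0 'X) coprimep_XsubC.
have /Bezout_eq1_coprimepP[[a b] /= ab] := co.
pose e := b * 'X^(m.+1); pose E := horner_mx X e.
have dvd0 p : char_poly X %| p -> horner_mx X p = 0.
  by case/dvdpP => r ->; rewrite rmorphM /= Cayley_Hamilton mulr0.
have EE : E * E = E.
  rewrite /E -rmorphM /=; apply/eqP; rewrite -subr_eq0 -rmorphB /=; apply/eqP.
  apply: dvd0; have -> : e * e - e = e * (e - 1) by ring.
  have -> : e - 1 = - (a * q) by rewrite -ab opprD addrCA subrr addr0.
  rewrite mulrN dvdpNr chiE /e exprSr.
  have -> : b * ('X^m * 'X) * (a * q) = a * b * 'X * (q * 'X^m) by ring.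
  exact: dvdp_mull.
have trE : \tr E = 0.
  rewrite /E /e -[b]coefK poly_def mulr_suml rmorph_sum raddf_sum big1 //= => i _.
  rewrite -scalerAl -exprD -mul_polyC rmorphM /= horner_mx_C rmorphXn /= horner_mx_X.
  by rewrite -mulmxE mul_scalar_mx linearZ /= trX ?mulr0 // addnS.
have E0 : E = 0.
  apply/eqP; rewrite -mxrank_eq0; move: trE; rewrite mxtrace_idempotent //.
  by move/eqP; rewrite ((pcharf0P F).1 charF).
exists m; have <- : horner_mx X ('X^m * (a * q)) = 0.
  by apply: dvd0; rewrite chiE mulrCA dvdp_mull // mulrC.
have -> : a * q = 1 - e by rewrite -ab addrK.
by rewrite rmorphM rmorphB /= -/E E0 rmorph1 subr0 mulr1 rmorphXn /= horner_mx_X.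
Qed.

(** Fitting decomposition relative to a subspace [P] stable under [T]. The [n * n + 1] first
    iterates of [M] are linearly dependent, which yields [Y] and [Z] as polynomials in [T] applied
    to [M], hence inside [P]. *)
Lemma fitting n (T : {linear 'M[F]_n -> 'M[F]_n}) (P : 'M[F]_n -> Prop) M :
  (forall a A B, P A -> P B -> P (a *: A + B)) -> (forall A, P A -> P (T A)) ->
  P M -> exists Y Z m, [/\ P Y, P Z, M = T Y + Z & iter m T Z = 0].
Proof.
move=> Plin PT PM; pose d := (n * n)%N.
have P0 : P 0 by rewrite -(addNr M) -scaleN1r; apply: Plin.
have PTi i : P (iter i T M) by elim: i => //= i; exact: PT.
pose A : 'M[F]_(d.+1, d) := \matrix_i mxvec (iter i T M).
have : kermx A != 0.
  by rewrite kermx_eq0 /row_free neq_ltn (leq_ltn_trans (rank_leq_col A)).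
case/rowV0Pn=> u /sub_kermxP uA u0.
have rel : \sum_i u 0 i *: iter i T M = 0.
  apply: (can_inj mxvecK); rewrite linear0 -uA (mulmx_sum_row u A) linear_sum.
  by apply: eq_bigr => i _; rewrite linearZ rowK.
have [j uj0] : exists j, u 0 j != 0.
  apply/existsP; apply: contraNT u0; rewrite negb_exists => /forallP u0.
  by apply/eqP/rowP => j; have /negPn/eqP := u0 j; rewrite mxE.
have exj : exists j : nat, [exists i : 'I_d.+1, (i == j :> nat) && (u 0 i != 0)].
  by exists j; apply/existsP; exists j; rewrite eqxx.
have [m /existsP[k /andP[/eqP km uk]] minm] := ex_minnP exj.
(* As [u] vanishes below the index [m = k], the linear relation says that [T ^ m] kills the sum of
   the [u 0 i *: T ^ (i - k) M]. Divided by [u 0 k], this sum is [M - T Y]. *)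
pose Y := - (u 0 k)^-1 *: \sum_(i < d.+1 | (k < i)%N) u 0 i *: iter (i - k).-1 T M.
have PY : P Y.
  rewrite -[Y]addr0; apply: (Plin) => //; elim/big_rec: _ => // i B _ PB.
  exact: Plin.
exists Y, (M - T Y), m; split=> //.
- by rewrite addrC -scaleN1r; apply: Plin => //; exact: PT.
- by rewrite addrC subrK.
have lin_iter a (B C : 'M[F]_n) : iter m T (a *: B + C) = a *: iter m T B + iter m T C.
  by elim: (m) => //= l ->; rewrite linearP.
have iter0 : iter m T 0 = 0 by elim: (m) => //= l ->; rewrite linear0.
have iterS_sum (Q : pred 'I_d.+1) (G : 'I_d.+1 -> 'M[F]_n) :
    iter m T (\sum_(i | Q i) u 0 i *: G i) = \sum_(i | Q i) u 0 i *: iter m T (G i).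
  by elim/big_rec2: _ => // i B C _ <-; rewrite lin_iter.
have -> : M - T Y = (u 0 k)^-1 *: (\sum_(i < d.+1 | (k <= i)%N) u 0 i *: iter (i - k) T M) + 0.
  rewrite addr0 (bigD1 k) //= subnn /= scalerDr scalerA mulVf // scale1r.
  congr (_ + _); rewrite /Y linearZ /= scaleNr opprK; congr (_ *: _).
  rewrite linear_sum; apply: eq_big => [i|i ki].
    by rewrite ltn_neqAle andbC -val_eqE eq_sym.
  by rewrite linearZ /= -iterS prednK // subn_gt0.
rewrite lin_iter iter0 addr0 iterS_sum.
transitivity ((u 0 k)^-1 *: (\sum_i u 0 i *: iter i T M)); last by rewrite rel scaler0.
congr (_ *: _); rewrite [RHS](bigID (fun i : 'I_d.+1 => (k <= i)%N)) /=.
rewrite [X in _ + X]big1 => [|i ki].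
  by rewrite addr0; apply: eq_bigr => i ki; rewrite -iterD -km addnC subnK.
have [->|ui] := eqVneq (u 0 i) 0; first by rewrite scale0r.
case/negP: ki; rewrite km minm //; apply/existsP; exists i; by rewrite eqxx.
Qed.

End LinearAlgebra.

(** The projections are the Chinese remainder idempotents: [e i] is 1 modulo [P i] and 0 modulo the
    other [P j]. *)
Lemma jordan_exists (K : closedFieldType) n (X : 'M[K]_n) :
  exists s (lam : 'I_s -> K) E N, injective lam /\ jordan_decomposition X lam E N
    /\ forall i, E i <> 0.
Proof.
case: n X => [|n] X.
  exists 0%N, (fun=> 0), (fun=> 0), 0; split; first by case.
  split; last by case.
  split; rewrite ?big_ord0 //; try by case.
  - by rewrite addr0; exact: flatmx0.
  - by rewrite [RHS]flatmx0.
  by exists 1%N; rewrite expr1.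
have [r chiE] := closed_field_poly_normal (char_poly X).
rewrite (monicP (char_poly_monic X)) scale1r in chiE.
pose u := undup r; pose s := size u; pose lam (i : 'I_s) := u`_i.
have lam_inj : injective lam.
  by move=> i j /eqP; rewrite nth_uniq ?undup_uniq // => /eqP/val_inj.
(* The common exponent [size r] bounds every multiplicity, so the characteristic polynomial divides
   [W]. *)
pose P i := ('X - (lam i)%:P) ^+ (size r); pose Q i := \prod_(j | j != i) P j.
pose W := \prod_i P i.
have WE i : W = P i * Q i by rewrite /W (bigD1 i).
have dvdW p : W %| p -> horner_mx X p = 0.
  move=> Wp; suff /dvdpP[q ->] : char_poly X %| p.
    by rewrite rmorphM /= Cayley_Hamilton mulr0.
  apply: dvdp_trans Wp; rewrite chiE /W prodrXl.
  have: all (fun z => 'X - z%:P %| \prod_i ('X - (lam i)%:P)) r.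
    apply/allP => z; rewrite -mem_undup -/u => zu.
    have zi : (index z u < s)%N by rewrite index_mem.
    rewrite (bigD1 (Ordinal zi)) //= /lam /= nth_index //; exact: dvdp_mulr.
  elim: (r) => [|z r' IH] /=; first by rewrite big_nil dvd1p.
  by case/andP=> dz /IH; rewrite big_cons exprS; exact: dvdp_mul.
have coP i j : i != j -> coprimep (P i) (P j).
  move=> ij; rewrite coprimep_expl // coprimep_expr // coprimep_XsubC root_XsubC.
  by apply: contraNneq ij => /lam_inj ->.
have coPQ i : coprimep (P i) (Q i).
  rewrite /Q; elim/big_rec: _ => [|j p ji cop]; first by rewrite coprimep1.
  by rewrite coprimepMr cop coP // eq_sym.
have PQ i j : i != j -> P i %| Q j.
  by move=> ij; rewrite /Q (bigD1 i) //= dvdp_mulr.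
have ex_e i : exists e, Q i %| e /\ P i %| e - 1.
  have /Bezout_eq1_coprimepP[[a b] /= ab] := coPQ i.
  exists (b * Q i); split; first exact: dvdp_mulIr.
  by rewrite -ab opprD addrCA subrr addr0 dvdpNr dvdp_mulIr.
have [e eP] := choice ex_e.
pose E i := horner_mx X (e i).
have Qe i : Q i %| e i by have [] := eP i.
have Pe i : P i %| e i - 1 by have [] := eP i.
have Eorth i j : i != j -> E i *m E j = 0.
  move=> ij; rewrite /E; change (horner_mx X (e i) * horner_mx X (e j) = 0).
  rewrite -rmorphM; apply: dvdW; rewrite (WE i) mulrC; apply: dvdp_mul => //.
  exact: dvdp_trans (PQ _ _ ij) (Qe j).
have Esum : \sum_i E i = 1%:M.
  rewrite /E -(rmorph_sum (horner_mx X)); apply/eqP; rewrite -subr_eq0.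
  change (horner_mx X (\sum_i e i) - 1 == 0); rewrite -(rmorph1 (horner_mx X)) -rmorphB.
  apply/eqP/dvdW; apply: prod_coprime_dvdp; first exact: index_enum_uniq.
    by move=> i j _ _; exact: coP.
  move=> i _; rewrite (bigD1 i) //= addrAC dvdp_add //.
  elim/big_rec: _ => [|j p ji dp]; first by rewrite dvdp0.
  by rewrite dvdp_add // (dvdp_trans (PQ i j _) (Qe j)) // eq_sym.
have Eidem i : E i *m E i = E i.
  rewrite -[RHS]mulmx1 -Esum mulmx_sumr (bigD1 i) //= big1 ?addr0 // => j ji.
  by rewrite Eorth // eq_sym.
have EX i : X *m E i = E i *m X.
  by rewrite /E; exact: (comm_mx_sym (comm_horner_mx _ (comm_mx_refl X))).
pose N := X - \sum_i lam i *: E i.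
have NE i : N *m E i = (X - (lam i)%:M) *m E i.
  rewrite /N !mulmxBl mul_scalar_mx mulmx_suml (bigD1 i) //= -scalemxAl Eidem.
  by rewrite big1 ?addr0 // => j ji; rewrite -scalemxAl Eorth // scaler0.
have EN i : E i *m N = (X - (lam i)%:M) *m E i.
  rewrite /N !mulmxBl mul_scalar_mx mulmxBr mulmx_sumr (bigD1 i) //= -scalemxAr.
  rewrite Eidem big1 ?addr0 ?EX // => j ji.
  by rewrite -scalemxAr Eorth ?scaler0 // eq_sym.
exists s, lam, E, N; split=> //; split; last first.
  move=> i Ei0; have : root (char_poly X) (lam i).
    rewrite chiE root_prod_XsubC -mem_undup; exact: mem_nth.
  rewrite -eigenvalue_root_char => /eigenvalueP[v vX v0]; case/eqP: v0.
  (* On an eigenvector [E i] acts as the scalar [(e i).[lam i]], which is 1; hence [E i] is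
     nonzero. *)
  have vE : v *m E i = (e i).[lam i] *: v.
    rewrite /E -[e i]coefK poly_def rmorph_sum horner_sum mulmx_sumr scaler_suml.
    apply: eq_bigr => j _; rewrite -mul_polyC rmorphM /= horner_mx_C rmorphXn /=.
    rewrite horner_mx_X hornerM hornerC hornerXn -scalerA -mulmxE mul_scalar_mx -scalemxAr.
    congr (_ *: _); elim: (nat_of_ord j) => [|k IH]; first by rewrite !expr0 mulmx1 scale1r.
    by rewrite !exprSr -mulmxE mulmxA IH -scalemxAl vX scalerA.
  have e1 : (e i).[lam i] = 1.
    have : 'X - (lam i)%:P %| e i - 1.
      apply: dvdp_trans (Pe i); rewrite /P; have : (0 < size r)%N.
        apply: leq_trans (size_undup r); exact: leq_ltn_trans (ltn_ord i).
      by case: (size r) => // l _; rewrite exprS dvdp_mulIl.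
    by rewrite dvdp_XsubCl rootE !hornerE subr_eq0 => /eqP.
  by move: vE; rewrite Ei0 mulmx0 e1 scale1r.
split=> [|i j|//|i|]; first by rewrite addrC subrK.
- by have [<-|ij] := eqVneq i j; [exact: Eidem | exact: Eorth].
- by rewrite NE EN.
exists (size r); have NkE k i : N ^+ k *m E i = (X - (lam i)%:M) ^+ k *m E i.
  elim: k => [|k IH]; first by rewrite !expr0.
  by rewrite exprSr -mulmxE -mulmxA NE -EN mulmxA IH -mulmxA EN mulmxA exprSr.
rewrite -[LHS]mulmx1 -Esum mulmx_sumr big1 // => i _; rewrite NkE.
have -> : (X - (lam i)%:M) ^+ size r = horner_mx X (P i).
  by rewrite /P rmorphXn rmorphB /= horner_mx_X horner_mx_C.
rewrite /E; change (horner_mx X (P i) * horner_mx X (e i) = 0).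
by rewrite -rmorphM; apply: dvdW; rewrite (WE i) dvdp_mul.
Qed.

(** * Evaluation of polynomials in matrix entries over arbitrary commutative rings *)

Lemma mpoly_ring_ind (R : comNzRingType) n (P : {mpoly R[n]} -> Prop) :
  (forall c, P c%:MP) -> (forall i, P 'X_i) ->
  (forall p q, P p -> P q -> P (p + q)) -> (forall p q, P p -> P q -> P (p * q)) ->
  forall p, P p.
Proof.
move=> PC PX PD PM; elim/mpolyind => [|c m p _ _ Pp]; first by rewrite -mpolyC0.
apply: PD => //; rewrite -mul_mpolyC; apply: (PM) => //; rewrite mpolyXE_id.
elim/big_rec: _ => [|i q _ Pq]; first by rewrite -mpolyC1.
apply: (PM) => //; elim: (m i) => [|k IH]; first by rewrite expr0 -mpolyC1.
by rewrite exprS; exact: PM.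
Qed.

Section MatrixEvaluation.
Variables (K : comNzRingType) (n : nat).
Implicit Types p q : {mpoly K[n * n]}.

Definition mxev (S : comNzRingType) (phi : K -> S) p (A : 'M[S]_n) : S :=
  mmap phi (fun k => mxvec A 0 k) p.

Lemma eq_mxev (S : comNzRingType) (phi psi : K -> S) p A :
  phi =1 psi -> mxev phi p A = mxev psi p A.
Proof. by move=> eq_phi; apply: eq_bigr => m _; rewrite eq_phi. Qed.

Lemma mxev_morph (S S' : comNzRingType) (th : {rmorphism S -> S'}) (phi : K -> S) p A :
  th (mxev phi p A) = mxev (th \o phi) p (map_mx th A).
Proof.
rewrite /mxev /mmap rmorph_sum; apply: eq_bigr => m _; rewrite rmorphM /=.
congr (_ * _); rewrite /mmap1 rmorph_prod; apply: eq_bigr => i _.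
by rewrite rmorphXn -map_mxvec [in RHS]mxE.
Qed.

Definition generic_mx : 'M[{mpoly K[n * n]}]_n := vec_mx (\row_k 'X_k).

Lemma map_generic_mx (S : comNzRingType) (phi : {rmorphism K -> S}) (A : 'M[S]_n) :
  map_mx (mmap phi (fun k => mxvec A 0 k)) generic_mx = A.
Proof.
apply: (can_inj mxvecK); apply/rowP => k.
by rewrite -map_mxvec vec_mxK !mxE mmapX mmap1U.
Qed.

Lemma map_mpolyC_mx (S : comNzRingType) (phi : {rmorphism K -> S}) h (B : 'M[K]_n) :
  map_mx (mmap phi h) (map_mx (@mpolyC (n * n) K) B) = map_mx phi B.
Proof. by apply/matrixP => i j; rewrite !mxE mmapC. Qed.

Lemma mxevD (S : comNzRingType) (phi : {rmorphism K -> S}) p q A :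
  mxev phi (p + q) A = mxev phi p A + mxev phi q A.
Proof. exact: rmorphD. Qed.

Lemma mxevB (S : comNzRingType) (phi : {rmorphism K -> S}) p q A :
  mxev phi (p - q) A = mxev phi p A - mxev phi q A.
Proof. exact: rmorphB. Qed.

Lemma mxevM (S : comNzRingType) (phi : {rmorphism K -> S}) p q A :
  mxev phi (p * q) A = mxev phi p A * mxev phi q A.
Proof. exact: rmorphM. Qed.

Lemma mxevXn (S : comNzRingType) (phi : {rmorphism K -> S}) p k A :
  mxev phi (p ^+ k) A = mxev phi p A ^+ k.
Proof. exact: rmorphXn. Qed.

Lemma mxevC (S : comNzRingType) (phi : {rmorphism K -> S}) c A :
  mxev phi c%:MP A = phi c.
Proof. exact: mmapC. Qed.

Lemma mxevX (S : comNzRingType) (phi : {rmorphism K -> S}) k A :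
  mxev phi 'X_k A = mxvec A 0 k.
Proof. by rewrite /mxev mmapX mmap1U. Qed.

Lemma mxev_det (S : comNzRingType) (phi : {rmorphism K -> S}) A :
  mxev phi (\det generic_mx) A = \det A.
Proof. by rewrite /mxev -det_map_mx map_generic_mx. Qed.

Lemma mxev_adj (S : comNzRingType) (phi : {rmorphism K -> S}) A i j :
  mxev phi ((\adj generic_mx) i j) A = (\adj A) i j.
Proof.
by rewrite -[in RHS](map_generic_mx phi A) -map_mx_adj [in RHS]mxE.
Qed.

(** The denominators are cleared by one polynomial [q], uniformly in the ring [S]. An identity
    involving inverses can thus be checked on [G] and carried to points over other rings. *)
Lemma clear_det N (w : 'I_N -> {mpoly K[n * n]}) (p : {mpoly K[N]}) :
  exists D q, forall (S : comUnitRingType) (phi : {rmorphism K -> S}) A,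
    A \in unitmx ->
    mxev phi q A = \det A ^+ D * mmap phi (fun i => mxev phi (w i) A / \det A) p.
Proof.
elim/mpoly_ring_ind: p => [c|i|p1 p2 [D1 [q1 H1]] [D2 [q2 H2]]|p1 p2 [D1 [q1 H1]] [D2 [q2 H2]]].
- by exists 0%N, c%:MP => S phi A _; rewrite mxevC mmapC expr0 mul1r.
- exists 1%N, (w i) => S phi A; rewrite unitmxE => uA.
  by rewrite mmapX mmap1U expr1 mulrCA mulrV ?mulr1.
- exists (D1 + D2)%N, (q1 * \det generic_mx ^+ D2 + q2 * \det generic_mx ^+ D1) => S phi A uA.
  rewrite mxevD !mxevM !mxevXn !mxev_det H1 // H2 // rmorphD exprD /=; ring.
- exists (D1 + D2)%N, (q1 * q2) => S phi A uA.
  by rewrite mxevM H1 // H2 // rmorphM exprD /=; ring.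
Qed.

End MatrixEvaluation.

Arguments generic_mx {K n}.

Lemma mxev_subst (K L S : comNzRingType) n (phi : {rmorphism K -> L})
    (chi : {rmorphism L -> S}) (p : {mpoly K[n * n]}) (Phi : 'M[{mpoly L[n * n]}]_n) A :
  mxev chi (mxev (@mpolyC _ _ \o phi) p Phi) A =
  mxev (chi \o phi) p (map_mx (mmap chi (fun k => mxvec A 0 k)) Phi).
Proof.
rewrite {1}/mxev (mxev_morph (mmap chi (fun k => mxvec A 0 k))).
by apply: eq_mxev => c /=; rewrite mmapC.
Qed.

(** * Dual numbers *)

Section DualNumbers.
Variable S : comNzRingType.

(** The pair [(a, b)] stands for [a + b eps] with [eps ^ 2 = 0]. Derivations become ring morphisms
    into this ring, and tangent vectors become points over it. *)
Definition dual : Type := (S * S)%type.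
HB.instance Definition _ := GRing.Zmodule.on dual.
Implicit Types x y z : dual.

Definition dual_mul x y : dual := (x.1 * y.1, x.1 * y.2 + x.2 * y.1).
Definition dual_one : dual := (1, 0).

Fact dual_mulA : associative dual_mul.
Proof. by move=> [a b] [c d] [e f]; rewrite /dual_mul /=; congr (_, _); ring. Qed.
Fact dual_mulC : commutative dual_mul.
Proof. by move=> [a b] [c d]; rewrite /dual_mul /=; congr (_, _); ring. Qed.
Fact dual_mul1 : left_id dual_one dual_mul.
Proof. by move=> [a b]; rewrite /dual_mul /=; congr (_, _); ring. Qed.
Fact dual_mulDl : left_distributive dual_mul +%R.
Proof. by move=> [a b] [c d] [e f]; congr (_, _) => /=; ring. Qed.
Fact dual_one_neq0 : dual_one != 0.
Proof. by apply/eqP => -[/eqP]; rewrite oner_eq0. Qed.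
HB.instance Definition _ := GRing.Zmodule_isComNzRing.Build dual
  dual_mulA dual_mulC dual_mul1 dual_mulDl dual_one_neq0.

Definition dual_in (a : S) : dual := (a, 0).
Fact dual_in_additive : additive dual_in.
Proof. by move=> a b; congr (_, _); rewrite /= subr0. Qed.
Fact dual_in_multiplicative : multiplicative dual_in.
Proof. by split=> // a b; congr (_, _) => /=; rewrite mulr0 mul0r addr0. Qed.
HB.instance Definition _ := GRing.isAdditive.Build S dual dual_in dual_in_additive.
HB.instance Definition _ :=
  GRing.isMultiplicative.Build S dual dual_in dual_in_multiplicative.

Section Derivation.
Variable D : S -> S.
Hypotheses (Dadd : additive D) (Dmul : forall a b, D (a * b) = a * D b + D a * b).
Definition dual_der (a : S) : dual := (a, D a).
Fact dual_der_additive : additive dual_der.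
Proof. by move=> a b; congr (_, _); rewrite /= Dadd. Qed.
Fact dual_der_multiplicative : multiplicative dual_der.
Proof.
split=> [a b|]; first by congr (_, _) => /=; rewrite Dmul.
congr (_, _); have := Dmul 1 1; rewrite !mulr1 mul1r => /eqP.
by rewrite -subr_eq0 opprD addrA subrr sub0r oppr_eq0 => /eqP.
Qed.
End Derivation.

Definition dmx m n (A V : 'M[S]_(m, n)) : 'M[dual]_(m, n) :=
  \matrix_(i, j) ((A i j, V i j) : dual).

Lemma dual_sumE (I : Type) (r : seq I) (P : pred I) (f : I -> dual) :
  \sum_(i <- r | P i) f i =
  (\sum_(i <- r | P i) (f i).1, \sum_(i <- r | P i) (f i).2) :> dual.
Proof. by elim/big_rec3: _ => // i a b c _ ->. Qed.

Lemma mul_dmx m n k (A V : 'M[S]_(m, n)) (B W : 'M[S]_(n, k)) :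
  dmx A V *m dmx B W = dmx (A *m B) (A *m W + V *m B).
Proof.
apply/matrixP => i j; rewrite !mxE dual_sumE; congr (_, _).
  by apply: eq_bigr => l _; rewrite !mxE.
by rewrite -big_split; apply: eq_bigr => l _; rewrite !mxE.
Qed.

Lemma map_dual_in m n (A : 'M[S]_(m, n)) : map_mx dual_in A = dmx A 0.
Proof. by apply/matrixP => i j; rewrite !mxE. Qed.

(** First-order Taylor expansion of [p] at [A] in the direction [V]. *)
Lemma mxev_dual (K : comNzRingType) (phi : {rmorphism K -> S}) n
    (p : {mpoly K[n * n]}) (A V : 'M[S]_n) :
  mxev (dual_in \o phi) p (dmx A V) =
  (mxev phi p A, \sum_k mxev phi p^`M(k) A * mxvec V 0 k) :> dual.
Proof.
elim/mpoly_ring_ind: p => [c|i|p q IHp IHq|p q IHp IHq].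
- rewrite !mxevC; congr (_, _); rewrite big1 // => k _.
  by rewrite mderivC mxevC rmorph0 mul0r.
- rewrite !mxevX; have [a b] := (mxvec_indexP i); rewrite !mxvecE mxE; congr (_, _).
  rewrite (bigD1 (mxvec_index a b)) //= mxvecE mderivX mnmE eqxx scale1r.
  have -> : (U_(mxvec_index a b) - U_(mxvec_index a b))%MM = 0%MM :> 'X_{1..n * n}.
    by apply/mnmP => k; rewrite mnmBE mnm0E subnn.
  rewrite mpolyX0 -mpolyC1 mxevC rmorph1 mul1r big1 ?addr0 // => k ki.
  by rewrite mderivX mnmE eq_sym (negPf ki) scale0r -mpolyC0 mxevC rmorph0 mul0r.
- rewrite !mxevD IHp IHq; congr (_, _); rewrite /= -big_split /=.
  by apply: eq_bigr => k _; rewrite mderivD mxevD mulrDl.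
rewrite !mxevM IHp IHq; congr (_, _); rewrite /= mulr_sumr mulr_suml -big_split /=.
apply: eq_bigr => k _; rewrite mderivM mxevD !mxevM; ring.
Qed.
End DualNumbers.

(** * Points of a matrix group over rings, and its Lie algebra *)

Section Points.
Variables (K : fieldType) (n : nat) (G : set 'M[K]_n).

Definition vanishes (p : {mpoly K[n * n]}) := forall g, G g -> mxev idfun p g = 0.

(** Points over [S] of the scheme cut out by the ideal of [G]; invertibility is imposed separately
    where it matters. *)
Definition points (S : comNzRingType) (phi : K -> S) (A : 'M[S]_n) : Prop :=
  forall p, vanishes p -> mxev phi p A = 0.

Lemma points_map (S S' : comNzRingType) (th : {rmorphism S -> S'}) (phi : K -> S) A :
  points phi A -> points (th \o phi) (map_mx th A).
Proof. by move=> pA p /pA; rewrite -mxev_morph => ->; rewrite rmorph0. Qed.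

Lemma mxev_map (S : comNzRingType) (phi : {rmorphism K -> S}) p (A : 'M[K]_n) :
  mxev phi p (map_mx phi A) = phi (mxev idfun p A).
Proof. by rewrite mxev_morph; apply: eq_mxev. Qed.

Lemma points_const (S : comNzRingType) (phi : {rmorphism K -> S}) g :
  G g -> points phi (map_mx phi g).
Proof. by move=> Gg p vp; rewrite mxev_map vp // rmorph0. Qed.

(* A term [q j] with [q j] nonzero at some point of [G] lets one eliminate     *)
(* [rho j], leaving fewer terms.                                               *)
Lemma descent_sum (S : comNzRingType) (phi : {rmorphism K -> S}) r (rho : 'I_r -> S)
    (q : 'I_r -> {mpoly K[n * n]}) :
  (forall g, G g -> \sum_j rho j * phi (mxev idfun (q j) g) = 0) ->
  forall (S' : comNzRingType) (chi : {rmorphism S -> S'}) A, points (chi \o phi) A ->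
    \sum_j chi (rho j) * mxev (chi \o phi) (q j) A = 0.
Proof.
elim: r rho q => [|r IH] rho q H S' chi A pA; first by rewrite big_ord0.
have [vq|/existsNP[j0 /existsNP[g /not_implyP[Gg /eqP qg]]]] :=
    pselect (forall j, vanishes (q j)).
  by rewrite big1 // => j _; rewrite pA ?mulr0.
pose c j := mxev idfun (q (lift j0 j)) g / mxev idfun (q j0) g.
pose q' j := q (lift j0 j) - (c j)%:MP * q j0.
have rho0 : rho j0 = - \sum_j rho (lift j0 j) * phi (c j).
  have /eqP := H g Gg; rewrite (bigD1_ord j0) //= addrC addr_eq0 => /eqP rg.
  have : rho j0 = rho j0 * phi (mxev idfun (q j0) g) * phi (mxev idfun (q j0) g)^-1.
    by rewrite -mulrA -rmorphM mulfV // rmorph1 mulr1.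
  rewrite -[rho j0 * _]opprK -rg => ->; rewrite mulNr mulr_suml; congr (- _).
  by apply: eq_bigr => j _; rewrite rmorphM /= mulrA.
have comb (T : comNzRingType) (th : {rmorphism S -> T}) B :
    \sum_j th (rho j) * mxev (th \o phi) (q j) B =
    \sum_j th (rho (lift j0 j)) * mxev (th \o phi) (q' j) B.
  rewrite (bigD1_ord j0) //= rho0 rmorphN rmorph_sum mulNr mulr_suml -sumrN -big_split.
  apply: eq_bigr => j _; rewrite /= mxevB mxevM mxevC /= rmorphM; ring.
rewrite comb; apply: IH => // g' Gg'.
have := comb S idfun (map_mx phi g').
  have E p : mxev (idfun \o phi) p (map_mx phi g') = phi (mxev idfun p g').
  by rewrite -mxev_map; apply: eq_mxev.
rewrite (eq_bigr (fun j => rho j * phi (mxev idfun (q j) g'))); last by move=> j _; rewrite E.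
by rewrite H // => e; rewrite [RHS]e; apply: eq_bigr => j _; rewrite E.
Qed.

(** Since [S] is free over the field [K], the equations over [S] satisfied by [G] are combinations
    of those over [K]. The monomials of [F] serve as the [q j] of [descent_sum]. *)
Lemma descent (S : comNzRingType) (phi : {rmorphism K -> S}) (F : {mpoly S[n * n]}) :
  (forall g, G g -> mxev idfun F (map_mx phi g) = 0) ->
  forall (S' : comNzRingType) (chi : {rmorphism S -> S'}) A, points (chi \o phi) A ->
    mxev chi F A = 0.
Proof.
move=> H S' chi A pA; pose rho (j : 'I_(size (msupp F))) := F@_((nth 0%MM (msupp F) j)).
pose q (j : 'I_(size (msupp F))) : {mpoly K[n * n]} := 'X_[nth 0%MM (msupp F) j].
have FE (T : comNzRingType) (th : {rmorphism S -> T}) B :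
    mxev th F B = \sum_j th (rho j) * mxev (th \o phi) (q j) B.
  rewrite {1}/mxev /mmap (big_nth 0%MM) big_mkord; apply: eq_bigr => j _.
  by rewrite /q /mxev mmapX.
rewrite FE; apply: (descent_sum (phi := phi)) => // g Gg.
have /eqP := H g Gg; rewrite FE => /eqP Hg; rewrite -[RHS]Hg.
by apply: eq_bigr => j _; rewrite -mxev_map; congr (_ * _); apply: eq_mxev.
Qed.

Section Subgroup.
Hypotheses (G1 : G 1%:M) (GM : forall g h, G g -> G h -> G (g *m h)).
Hypothesis GV : forall g, G g -> G (invmx g).
Hypothesis Gunit : forall g, G g -> g \in unitmx.

Lemma points1 (S : comNzRingType) (phi : {rmorphism K -> S}) : points phi 1%:M.
Proof. by have := points_const phi G1; rewrite map_mx1. Qed.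

Lemma points_mull (S : comNzRingType) (phi : {rmorphism K -> S}) A g :
  points phi A -> G g -> points phi (A *m map_mx phi g).
Proof.
move=> pA Gg p vp.
pose P := mxev (@mpolyC _ _ \o idfun) p (generic_mx *m map_mx (@mpolyC _ _) g).
have E (T : comNzRingType) (th : {rmorphism K -> T}) B :
    mxev th P B = mxev th p (B *m map_mx th g).
  rewrite mxev_subst map_mxM map_generic_mx map_mpolyC_mx; exact: eq_mxev.
rewrite -E; apply: pA => h Gh; rewrite E map_mx_id //; exact/vp/GM.
Qed.

(** Closure under products is given only for [G] itself, so the factors are generalised one at a
    time: [points_mull] varies the left factor, and [descent] then varies the right one with [A]
    fixed. *)
Lemma pointsM (S : comNzRingType) (phi : {rmorphism K -> S}) A B :
  points phi A -> points phi B -> points phi (A *m B).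
Proof.
move=> pA pB p vp.
pose P := mxev (@mpolyC _ _ \o phi) p (map_mx (@mpolyC _ _) A *m generic_mx).
have E (T : comNzRingType) (th : {rmorphism S -> T}) C :
    mxev th P C = mxev (th \o phi) p (map_mx th A *m C).
  by rewrite mxev_subst map_mxM map_generic_mx map_mpolyC_mx.
have := E S idfun B; rewrite map_mx_id // => <-.
apply: descent; last exact: (pB : points (idfun \o phi) B).
move=> g Gg; rewrite E map_mx_id //; exact: points_mull.
Qed.

Lemma pointsV (S : comUnitRingType) (phi : {rmorphism K -> S}) A :
  A \in unitmx -> points phi A -> points phi (invmx A).
Proof.
move=> uA pA p vp.
pose w k : {mpoly K[n * n]} := mxvec (\adj generic_mx) 0 k.
have [D [q qE]] := clear_det w p.
have E (T : comUnitRingType) (th : {rmorphism K -> T}) B : B \in unitmx ->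
    mxev th q B = \det B ^+ D * mxev th p (invmx B).
  move=> uB; rewrite qE //; congr (_ * _); apply: eq_bigr => m _; congr (_ * _).
  apply: mmap1_eq => k; have [a b] := mxvec_indexP k.
  by rewrite /w !mxvecE mxev_adj /invmx uB [RHS]mxE mulrC.
have detA : \det A ^+ D \is a GRing.unit by rewrite unitrX.
apply: (mulrI detA); rewrite mulr0 -E // pA // => g Gg.
by rewrite E ?Gunit // vp ?mulr0 //; exact: GV.
Qed.

Definition lie_points (S : comNzRingType) (phi : K -> S) (X : 'M[S]_n) : Prop :=
  forall p, vanishes p -> \sum_k phi (mxev idfun p^`M(k) 1%:M) * mxvec X 0 k = 0.

(** Tangent vectors at 1 are the points [1 + eps X], so that conjugation and logarithmic derivatives
    reduce to products of points. *)
Lemma lie_dual (S : comNzRingType) (phi : {rmorphism K -> S}) X :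
  lie_points phi X <-> points (@dual_in S \o phi) (dmx 1%:M X).
Proof.
have E p : \sum_k phi (mxev idfun p^`M(k) 1%:M) * mxvec X 0 k =
           (mxev (@dual_in S \o phi) p (dmx 1%:M X)).2.
  rewrite mxev_dual /=; apply: eq_bigr => k _.
  by rewrite -mxev_map map_mx1.
split=> H p vp; last by rewrite E H.
rewrite [LHS]surjective_pairing -E H // mxev_dual /=.
by rewrite -[1%:M](map_mx1 phi) mxev_map vp // rmorph0.
Qed.

Lemma lie_conj (S : comNzRingType) (phi : {rmorphism K -> S}) A B X :
  points phi A -> points phi B -> A *m B = 1%:M ->
  lie_points phi X -> lie_points phi (A *m X *m B).
Proof.
move=> pA pB AB /lie_dual dX; apply/lie_dual.
have -> : dmx 1%:M (A *m X *m B) = map_mx (@dual_in S) A *m dmx 1%:M X *m map_mx (@dual_in S) B.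
  by rewrite !map_dual_in !mul_dmx mulmx1 mul0mx addr0 AB mulmx0 add0r.
by apply: pointsM; first apply: pointsM => //; apply: points_map.
Qed.

(** The morphism [a |-> a + eps D a] carries the point [A] to [A + eps D A]; its product with [B] is
    [1 + eps (D A) B]. *)
Lemma lie_logder (S : comNzRingType) (phi : {rmorphism K -> S}) (D : S -> S) A B :
  additive D -> (forall a b, D (a * b) = a * D b + D a * b) ->
  (forall c, D (phi c) = 0) ->
  points phi A -> points phi B -> A *m B = 1%:M ->
  lie_points phi (map_mx D A *m B).
Proof.
move=> Dadd Dmul Dphi pA pB AB; apply/lie_dual.
pose th := GRing.isAdditive.Build S (dual S) (dual_der D) (dual_der_additive Dadd).
pose th' := GRing.isMultiplicative.Build S (dual S) (dual_der D) (dual_der_multiplicative Dmul).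
pose thm : {rmorphism S -> dual S} := HB.pack (dual_der D) th th'.
have -> : dmx 1%:M (map_mx D A *m B) = map_mx thm A *m map_mx (@dual_in S) B.
  have -> : map_mx thm A = dmx A (map_mx D A) by apply/matrixP => i j; rewrite !mxE.
  by rewrite map_dual_in mul_dmx AB mulmx0 add0r.
apply: pointsM; last exact: points_map.
move=> p vp; have := points_map thm pA vp; apply: etrans; apply: eq_mxev => c /=.
by rewrite /dual_der Dphi.
Qed.

End Subgroup.
End Points.

(** * Laurent series and matrices over them: orders, derivation, rotation of the variable *)

Section LaurentSeries.
Variable F : fieldType.
Implicit Types f g : laurent F.

Definition lord (m : int) f := forall i : int, i < m -> f i = 0.

(** The range of summation can be shared by several products, which are then compared term by
    term. *)
Lemma lmul_sum f g (m k n : int) (N : nat) : lord m f -> lord k g ->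
  n < m + k + N%:Z ->
  (f * g) n = \sum_(j < N) f (m + j%:Z) * g (n - (m + j%:Z)).
Proof.
move=> fm gk nN; have [nmk|nmk] := ltP n (m + k).
  rewrite [LHS](lmul_fun0 fm gk) // big1 // => j _.
  by rewrite (gk (_ - _)) ?mulr0 //; lia.
have -> : n = m + k + (absz (n - (m + k))%R)%:Z by lia.
have jN : (absz (n - (m + k))%R <  N)%N by lia.
move: (absz _) jN => j jN; rewrite [LHS](lmul_funE fm gk jN) coefM.
rewrite (big_ord_widen N (fun i => (ltrunc m N f)`_i * (ltrunc k N g)`_(j - i))) // big_mkcond /=.
apply: eq_bigr => i _; rewrite !coef_poly ltn_ord; case: ltnP => ij.
  rewrite ifT; last by lia.
  by congr (_ * g _); lia.
by rewrite (gk (_ - _)) ?mulr0 //; lia.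
Qed.

Lemma lord_mul m k f g : lord m f -> lord k g -> lord (m + k) (f * g).
Proof. by move=> fm gk n; exact: lmul_fun0. Qed.

Lemma lcoef_mul m k f g : lord m f -> lord k g -> (f * g) (m + k) = f m * g k.
Proof.
move=> fm gk; rewrite (lmul_sum (N := 1) fm gk); last by lia.
by rewrite big_ord1 addr0; congr (_ * g _); lia.
Qed.

Lemma lmonom_mul c (j : int) f (n : int) : (lmonom c j * f) n = c * f (n - j).
Proof.
have [k fk] := lboundP f.
have oj : lord j (lmonom c j) by move=> i ij /=; case: eqP ij => // ->; rewrite ltxx.
have [nk|nk] := ltP n (j + k).
  by rewrite (lord_mul oj fk nk) fk ?mulr0 //; lia.
rewrite (lmul_sum (N := (absz (n - (j + k))%R).+1) oj fk); last by lia.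
rewrite big_ord_recl addr0 /= eqxx big1 ?addr0 // => i _.
by rewrite ifF ?mul0r //; apply/eqP; rewrite /bump /=; lia.
Qed.

Lemma lcoefB f g n : (f - g) n = f n - g n. Proof. by []. Qed.

Fact lconst_additive : additive (@lconst F).
Proof. by move=> a b; apply: laurentP => i; rewrite lcoefB /=; case: eqP; rewrite ?subr0. Qed.
Fact lconst_multiplicative : multiplicative (@lconst F).
Proof.
split=> [a b|]; last by [].
by apply: laurentP => i; rewrite lmonom_mul subr0 /=; case: eqP; rewrite ?mulr0.
Qed.
HB.instance Definition _ := GRing.isAdditive.Build F (laurent F) (@lconst F) lconst_additive.
HB.instance Definition _ :=
  GRing.isMultiplicative.Build F (laurent F) (@lconst F) lconst_multiplicative.

Lemma lconst_mul c f n : (lconst c * f) n = c * f n.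
Proof. by rewrite lmonom_mul subr0. Qed.

Lemma lcoef_sum (I : Type) (r : seq I) (P : pred I) (h : I -> laurent F) n :
  (\sum_(i <- r | P i) h i) n = \sum_(i <- r | P i) h i n.
Proof. by elim/big_rec2: _ => // i a b _ <-. Qed.

Lemma lderiv_additive : additive (@lderiv F).
Proof. by move=> f g; apply: laurentP => i; exact: mulrBr. Qed.

Lemma lderiv_mul f g : lderiv (f * g) = f * lderiv g + lderiv f * g.
Proof.
have [m fm] := lboundP f; have [k gk] := lboundP g.
have fm' : lord (m - 1) (lderiv f) by move=> i im /=; rewrite fm ?mulr0 //; lia.
have gk' : lord (k - 1) (lderiv g) by move=> i ik /=; rewrite gk ?mulr0 //; lia.
apply: laurentP => n; rewrite lcoefD.
have [N nN] : exists N : nat, n < m + k - 1 + N%:Z by exists (absz (n - (m + k))%R + 2)%N; lia.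
rewrite (lmul_sum (N := N) fm gk'); last by lia.
rewrite (lmul_sum (N := N) fm' gk); last by lia.
have -> : lderiv (f * g) n = (n + 1)%:~R * (f * g) (n + 1) by [].
rewrite (lmul_sum (N := N) fm gk); last by lia.
rewrite mulr_sumr -big_split; apply: eq_bigr => j _ /=.
have -> : m - 1 + j%:Z + 1 = m + j%:Z by lia.
have -> : n - (m + j%:Z) + 1 = n + 1 - (m + j%:Z) by lia.
have -> : n - (m - 1 + j%:Z) = n + 1 - (m + j%:Z) by lia.
have -> : (n + 1)%:~R = (n + 1 - (m + j%:Z))%:~R + (m + j%:Z)%:~R :> F.
  by rewrite -intrD; congr (_%:~R); lia.
by ring.
Qed.

Lemma lderiv_const c : lderiv (@lconst F c) = 0.
Proof.
apply: laurentP => i /=; case: eqP => [->|]; first by rewrite mul0r.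
by rewrite mulr0.
Qed.

Section Rotation.
Variable z : F.
Hypothesis z0 : z != 0.

Fact lrot_subproof f : (fun i : int => z ^ i * f i) \in @laurent_bounded F.
Proof.
by have [m fm] := lboundP f; apply/asboolP; exists m => i im; rewrite fm ?mulr0.
Qed.
(** The substitution [f (u) |-> f (z u)], a Galois automorphism when [z] is a root of unity. *)
Definition lrot f := Laurent (lrot_subproof f).

Lemma lrot_additive : additive lrot.
Proof. by move=> f g; apply: laurentP => i; exact: mulrBr. Qed.

Lemma lrot_multiplicative : multiplicative lrot.
Proof.
split=> [f g|]; apply: laurentP => n.
  have [m fm] := lboundP f; have [k gk] := lboundP g.
  have fm' : lord m (lrot f) by move=> i im /=; rewrite fm ?mulr0.
  have gk' : lord k (lrot g) by move=> i ik /=; rewrite gk ?mulr0.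
  have [N nN] : exists N : nat, n < m + k + N%:Z by exists (absz (n - (m + k))%R + 1)%N; lia.
  have -> : lrot (f * g) n = z ^ n * (f * g) n by [].
  rewrite (lmul_sum fm' gk' nN) (lmul_sum fm gk nN) mulr_sumr.
  apply: eq_bigr => j _; rewrite /= [z ^ n](_ : _ = z ^ (m + j%:Z) * z ^ (n - (m + j%:Z))).
    by rewrite mulrACA.
  by rewrite -expfzDr // addrC subrK.
by rewrite /=; case: eqP => [->|]; rewrite ?expr0z ?mulr1 ?mulr0.
Qed.

Lemma lrot_const c : lrot (lconst c) = lconst c.
Proof.
by apply: laurentP => i /=; case: eqP => [->|]; rewrite ?expr0z ?mul1r ?mulr0.
Qed.

Lemma lrot_deriv f : lconst z * lrot (lderiv f) = lderiv (lrot f).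
Proof. by apply: laurentP => i; rewrite lconst_mul /= expfzDr // expr1z; ring. Qed.

Lemma lrot_subst b f : z ^+ b = 1 -> lrot (lsubst b f) = lsubst b f.
Proof.
move=> zb; apply: laurentP => i /=; case: ifP => [/dvdzP[q ->]|_]; last by rewrite mulr0.
by rewrite [q * _]mulrC -exprz_exp -[z ^ b]/(z ^+ b) zb exp1rz mul1r.
Qed.

End Rotation.

End LaurentSeries.

Section LaurentMatrices.
Variables (F : closedFieldType) (n : nat).
Implicit Types A B : 'M[laurent F]_n.

Definition mxord (m : int) A := forall i : int, i < m -> mxcoef i A = 0.

Lemma mxcoefD i A B : mxcoef i (A + B) = mxcoef i A + mxcoef i B.
Proof. by apply/matrixP => a b; rewrite !mxE. Qed.
Lemma mxcoefN i A : mxcoef i (- A) = - mxcoef i A.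
Proof. by apply/matrixP => a b; rewrite !mxE. Qed.
Lemma mxcoefB i A B : mxcoef i (A - B) = mxcoef i A - mxcoef i B.
Proof. by rewrite mxcoefD mxcoefN. Qed.
Lemma mxcoef_const i (X : 'M[F]_n) :
  mxcoef i (map_mx (@lconst F) X) = if i == 0 then X else 0.
Proof. by apply/matrixP => a b; rewrite !mxE /=; case: eqP => _; rewrite ?mxE. Qed.
Lemma mxcoef_constM i (X : 'M[F]_n) A :
  mxcoef i (map_mx (@lconst F) X *m A) = X *m mxcoef i A.
Proof.
by apply/matrixP => a b; rewrite !mxE lcoef_sum; apply: eq_bigr => k _; rewrite !mxE lconst_mul.
Qed.
Lemma mxcoefM_const i (X : 'M[F]_n) A :
  mxcoef i (A *m map_mx (@lconst F) X) = mxcoef i A *m X.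
Proof.
apply/matrixP => a b; rewrite !mxE lcoef_sum; apply: eq_bigr => k _.
by rewrite !mxE mulrC lconst_mul mulrC.
Qed.
Lemma mxcoef_constZ i c A : mxcoef i (lconst c *: A) = c *: mxcoef i A.
Proof. by apply/matrixP => a b; rewrite !mxE lconst_mul. Qed.
Lemma mxcoef_deriv i A : mxcoef i (map_mx (@lderiv F) A) = (i + 1)%:~R *: mxcoef (i + 1) A.
Proof. by apply/matrixP => a b; rewrite !mxE. Qed.

Lemma mxcoefP A B : (forall i, mxcoef i A = mxcoef i B) -> A = B.
Proof.
move=> AB; apply/matrixP => a b; apply: laurentP => i.
by have /matrixP/(_ a b) := AB i; rewrite !mxE.
Qed.

Lemma mxord_ex A : exists m : int, mxord m A.
Proof.
suff [m Hm] : exists m : int, forall a b, lord m (A a b).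
  by exists m => i im; apply/matrixP => a b; rewrite !mxE Hm.
have [m mP] := choice (fun ab : 'I_n * 'I_n => lboundP (A ab.1 ab.2)).
exists (- (\sum_ab absz (m ab))%N%:Z) => a b i im; apply: (mP (a, b)) => /=.
have : (absz (m (a, b)) <= \sum_ab absz (m ab))%N by rewrite (bigD1 (a, b)) //= leq_addr.
by lia.
Qed.

Lemma mxordW m k A : k <= m -> mxord m A -> mxord k A.
Proof. by move=> km Am i ik; apply: Am; exact: lt_le_trans ik km. Qed.

Lemma mxord_lord m A a b : mxord m A -> lord m (A a b).
Proof. by move=> Am i /Am /matrixP/(_ a b); rewrite !mxE. Qed.

Lemma mxordS m A : mxord m A -> mxcoef m A = 0 -> mxord (m + 1) A.
Proof.
move=> Am A0 i im; have [->|im'] := eqVneq i m; first exact: A0.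
by apply: Am; lia.
Qed.

Lemma mxordD m A B : mxord m A -> mxord m B -> mxord m (A + B).
Proof. by move=> Am Bm i im; rewrite mxcoefD Am ?Bm ?addr0. Qed.
Lemma mxordN m A : mxord m A -> mxord m (- A).
Proof. by move=> Am i im; rewrite mxcoefN Am ?oppr0. Qed.
Lemma mxordB m A B : mxord m A -> mxord m B -> mxord m (A - B).
Proof. by move=> Am Bm; apply: mxordD => //; exact: mxordN. Qed.
Lemma mxord_const (X : 'M[F]_n) : mxord 0 (map_mx (@lconst F) X).
Proof. by move=> i i0; rewrite mxcoef_const; case: eqP i0 => // ->. Qed.
Lemma mxord_deriv m A : mxord m A -> mxord (m - 1) (map_mx (@lderiv F) A).
Proof. by move=> Am i im; rewrite mxcoef_deriv Am ?scaler0 //; lia. Qed.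

Lemma mxord_mul m k A B : mxord m A -> mxord k B -> mxord (m + k) (A *m B).
Proof.
move=> Am Bk i ik; apply/matrixP => a b; rewrite !mxE lcoef_sum big1 // => c _.
by apply: (lord_mul _ _ ik); apply: mxord_lord.
Qed.

Lemma mxcoef_mul m k A B : mxord m A -> mxord k B ->
  mxcoef (m + k) (A *m B) = mxcoef m A *m mxcoef k B.
Proof.
move=> Am Bk; apply/matrixP => a b; rewrite !mxE lcoef_sum; apply: eq_bigr => c _.
by rewrite !mxE; apply: lcoef_mul; apply: mxord_lord.
Qed.

(** Reduction modulo [u] is a ring morphism on power series. *)
Lemma mxev_ord0 (p : {mpoly F[n * n]}) A : mxord 0 A ->
  lord 0 (mxev (@lconst F) p A) /\ mxev (@lconst F) p A 0 = mxev idfun p (mxcoef 0 A).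
Proof.
move=> A0; elim/mpoly_ring_ind: p => [c|k|p q [op ep] [oq eq]|p q [op ep] [oq eq]].
- rewrite !mxevC; split=> //= i i0; by rewrite /lconst /= ifF //; apply/negbTE; lia.
- rewrite !mxevX; have [a b] := mxvec_indexP k; rewrite !mxvecE mxE; split=> //.
  exact: mxord_lord.
- rewrite !mxevD lcoefD ep eq; split=> // i i0; by rewrite lcoefD op ?oq ?addr0.
- rewrite !mxevM; split; first by rewrite -[0]addr0; apply: lord_mul.
  by rewrite -ep -eq -(lcoef_mul op oq) addr0.
Qed.

Lemma unit_mx_coef0 A : mxord 0 A -> mxcoef 0 A = 1%:M -> A \in unitmx.
Proof.
move=> A0 A1; have [_] := mxev_ord0 (\det generic_mx) A0.
rewrite !mxev_det A1 det1 unitmxE unitfE => dA; apply/eqP => d0.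
by have /eqP := dA; rewrite d0 eq_sym oner_eq0.
Qed.

(* [B A = 1] reads [B = 1 - B (A - 1)], so the order of [B] can be raised up to [0]. *)
Lemma mxord_inv A B : mxord 0 A -> mxcoef 0 A = 1%:M -> B *m A = 1%:M -> mxord 0 B.
Proof.
move=> A0 A1 BA; have [m Bm] := mxord_ex B.
have AW : mxord 1 (A - 1%:M).
  rewrite -[1 : int]add0r; apply: mxordS.
    by apply: mxordB => //; rewrite -(map_mx1 (@lconst F)); exact: mxord_const.
  by rewrite mxcoefB A1 -(map_mx1 (@lconst F)) mxcoef_const eqxx subrr.
have BE : B = 1%:M - B *m (A - 1%:M) by rewrite mulmxBr BA mulmx1 opprB addrC subrK.
suff H (k : nat) : mxord (Num.min 0 (m + k%:Z)) B.
  by apply: mxordW (H (absz m)); lia.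
elim: k => [|k IH]; first by apply: mxordW Bm; lia.
rewrite BE; apply: mxordB.
  by apply: (mxordW (m := 0)); [lia|rewrite -(map_mx1 (@lconst F)); exact: mxord_const].
by apply: mxordW (mxord_mul IH AW); lia.
Qed.

End LaurentMatrices.

(** * Independence of exponentials over polynomials *)

Section ExponentialPolynomials.
Variable F : fieldType.
Hypothesis charF : [pchar F] =i pred0.

Lemma natr_inj_pchar0 : injective (fun k : nat => k%:R : F).
Proof.
move=> i j; wlog ij : i j / (i <= j)%N => [W|] eij.
  by case/orP: (leq_total i j) => [/W|/W->] // ->.
have : (j - i)%:R == 0 :> F by rewrite natrB // eij subrr.
by rewrite ((pcharf0P F).1 charF) => /eqP; lia.
Qed.

Lemma poly_nat_eq0 (q : {poly F}) : (forall k : nat, q.[k%:R] = 0) -> q = 0.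
Proof.
move=> q0; apply/eqP; apply: contraT => qn0.
have /= := @max_poly_roots _ q [seq k%:R | k <- iota 0 (size q)] qn0.
rewrite size_map size_iota ltnn; apply.
  by apply/allP => x /mapP[k _ ->]; apply/rootP.
by rewrite map_inj_uniq ?iota_uniq //; exact: natr_inj_pchar0.
Qed.

Let shift (q : {poly F}) := q \Po ('X + 1).

Let shiftE q x : (shift q).[x] = q.[x + 1].
Proof. by rewrite horner_comp !hornerE. Qed.

Let size_X1 : size ('X + 1 : {poly F}) = 2.
Proof. by rewrite -[1]opprK -polyCN size_XsubC. Qed.

Let lead_shift q : lead_coef (shift q) = lead_coef q.
Proof.
rewrite lead_coef_comp ?size_X1 // -[1]opprK -polyCN lead_coefXsubC.
by rewrite expr1n mulr1.
Qed.

Let size_shift q : size (shift q) = size q.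
Proof. by rewrite size_comp_poly2. Qed.

(** Induction on the total size of the [q i]. The operator [f (k) |-> f (k + 1) - mu i0 * f (k)]
    lowers the degree of [q i0] and raises no other; once it kills everything, leading coefficients
    force [q i = 0] for [i] other than [i0]. *)
Let sep_inj (I : finType) (mu : I -> F) (q : I -> {poly F}) :
  injective mu -> (forall i, mu i != 0) ->
  (forall k : nat, \sum_i mu i ^+ k * (q i).[k%:R] = 0) -> forall i, q i = 0.
Proof.
move=> muI mu0; have [d] := ubnP (\sum_i size (q i)).
elim: d q => // d IH q sd H.
have [/existsP[i0 qi0]|/existsPn q0] := boolP [exists i, q i != 0]; last first.
  by move=> i; have /negPn/eqP := q0 i.
pose q' i := mu i *: shift (q i) - mu i0 *: q i.
have sq' i : (size (q' i) <= size (q i))%N.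
  apply: leq_trans (size_polyD _ _) _; rewrite size_polyN geq_max.
  by rewrite !(leq_trans (size_scale_leq _ _)) ?size_shift.
have q'0 : forall i, q' i = 0.
  apply: IH => [|k].
    move: sd; rewrite ltnS; apply: leq_trans; rewrite (bigD1 i0) //= [X in (_ < X)%N](bigD1 i0) //=.
    rewrite -addSn; apply: leq_add; last by apply: leq_sum => i _; exact: sq'.
    have s0 : (0 < size (q i0))%N by rewrite lt0n size_poly_eq0.
    rewrite -(prednK s0) ltnS; apply/leq_sizeP => j.
    rewrite leq_eqVlt => /orP[/eqP <-|ij]; last first.
      by rewrite nth_default // (leq_trans (sq' i0)) // -(prednK s0).
    rewrite /q' coefB !coefZ -[(q i0)`_ _]/(lead_coef (q i0)) -lead_shift.
    by rewrite /lead_coef size_shift subrr.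
  have := H k.+1; have := H k => Hk Hk1.
  transitivity (\sum_i mu i ^+ k.+1 * (q i).[k.+1%:R] -
                mu i0 * \sum_i mu i ^+ k * (q i).[k%:R]); last first.
    by rewrite Hk Hk1 mulr0 subrr.
  rewrite mulr_sumr -sumrB; apply: eq_bigr => i _.
  rewrite /q' hornerD hornerN !hornerZ shiftE -natr1 exprS; ring.
have qi i : i != i0 -> q i = 0.
  move=> ii0; apply/eqP; rewrite -lead_coef_eq0.
  have /eqP := q'0 i; rewrite subr_eq0 => /eqP/(congr1 lead_coef)/eqP.
  rewrite !lead_coefZ lead_shift -subr_eq0 -mulrBl mulf_eq0 subr_eq0 => /orP[|//].
  by move/eqP/muI/eqP; rewrite (negPf ii0).
have q00 : q i0 = 0.
  apply: poly_nat_eq0 => k; have := H k; rewrite (bigD1 i0) //= big1 => [|i ii0].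
    by move/eqP; rewrite addr0 mulf_eq0 expf_eq0 (negPf (mu0 i0)) andbF => /eqP.
  by rewrite qi // horner0 mulr0.
by move=> i; have [->//|/qi] := eqVneq i i0.
Qed.

(** Indices with equal [mu] are grouped. Each group has polynomial sum 0, and [w] is constant on
    it. *)
Lemma exponential_separation (I : finType) (mu w : I -> F) (q : I -> {poly F}) c :
  (forall i, mu i != 0) -> (forall i j, mu i = mu j -> w i = w j) ->
  (forall k : nat, \sum_i mu i ^+ k * (q i).[k%:R] = 0) ->
  \sum_i w i * (q i).[c] = 0.
Proof.
move=> mu0 muw H; pose r := undup (codom mu); pose nu (a : 'I_(size r)) := r`_a.
have nuI : injective nu.
  by move=> a b /eqP; rewrite nth_uniq ?undup_uniq // => /eqP/val_inj.
have nu_mu a : exists i, mu i = nu a.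
  have : nu a \in codom mu by rewrite -mem_undup mem_nth.
  by case/codomP => i ->; exists i.
have group (f : I -> F) : \sum_i f i = \sum_a \sum_(i | mu i == nu a) f i.
  rewrite (exchange_big_dep xpredT) //=; apply: eq_bigr => i _.
  have ri : (index (mu i) r < size r)%N.
    by rewrite index_mem mem_undup codom_f.
  rewrite (big_pred1 (Ordinal ri)) // => a.
  have e : nu (Ordinal ri) = mu i by rewrite /nu /= nth_index // -index_mem.
  by have := inj_eq nuI a (Ordinal ri); rewrite e eq_sym.
have [h hP] := choice nu_mu.
have Q0 : forall a, \sum_(i | mu i == nu a) q i = 0.
  apply: (sep_inj nuI) => [a|k]; first by rewrite -hP.
  rewrite -[RHS](H k) group; apply: eq_bigr => a _.
  rewrite horner_sum mulr_sumr; apply: eq_bigr => i /eqP ->; by [].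
rewrite group big1 // => a _.
rewrite (eq_bigr (fun i => w (h a) * (q i).[c])) => [|i /eqP ia].
  by rewrite -mulr_sumr -horner_sum Q0 horner0 mulr0.
by congr (_ * _); apply: muw; rewrite hP.
Qed.

End ExponentialPolynomials.

(* Expanding [p] and grouping the monomials [e] by the value of [Lam ^ e], the *)
(* polynomial coefficients of each group sum to 0, since exponentials with     *)
(* distinct bases are independent over polynomials.                            *)
Lemma exponential_closure (K F : fieldType) (phi : {rmorphism K -> F}) n
    (p : {mpoly K[n * n]}) s (Lam z : 'I_s -> F) (M : 'I_s -> 'M[{poly F}]_n) :
  [pchar F] =i pred0 -> (forall i, Lam i != 0) ->
  (forall e e' : 'X_{1..s}, mmap1 Lam e = mmap1 Lam e' -> mmap1 z e = mmap1 z e') ->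
  (forall k : nat, mxev phi p
     (\sum_i Lam i ^+ k *: map_mx (horner_eval k%:R) (M i)) = 0) ->
  mxev phi p (\sum_i z i *: map_mx (horner_eval 0) (M i)) = 0.
Proof.
move=> charF Lam0 Lamz H.
pose Phi : 'M[{mpoly {poly F}[s]}]_n := \sum_i 'X_i *: map_mx (@mpolyC s {poly F}) (M i).
pose W := mxev ((@mpolyC s {poly F}) \o (@polyC F \o phi)) p Phi.
have thW c (v : 'I_s -> F) : mmap (horner_eval c) v W =
    mxev phi p (\sum_i v i *: map_mx (horner_eval c) (M i)).
  rewrite mxev_morph map_mx_sum; have -> :
      \sum_i map_mx (mmap (horner_eval c) v) ('X_i *: map_mx (@mpolyC s {poly F}) (M i)) =
      \sum_i v i *: map_mx (horner_eval c) (M i).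
    apply: eq_bigr => i _; rewrite map_mxZ /= mmapX mmap1U; congr (_ *: _).
    by apply/matrixP => a b; rewrite !mxE mmapC.
  by apply: eq_mxev => x /=; rewrite mmapC; exact: hornerC.
rewrite -thW /mmap (big_nth 0%MM) big_mkord.
pose m (i : 'I_(size (msupp W))) := nth 0%MM (msupp W) i.
under eq_bigr do rewrite mulrC.
apply: (exponential_separation charF (mu := fun i => mmap1 Lam (m i))).
- by move=> i; apply/prodf_neq0 => j _; rewrite expf_neq0.
- by move=> i j; exact: Lamz.
move=> k; rewrite -[RHS](H k) -thW /mmap (big_nth 0%MM) big_mkord.
apply: eq_bigr => i _; rewrite mulrC; congr (_ * _).
rewrite /mmap1 -prodrXl; apply: eq_bigr => j _.
by rewrite -!exprM mulnC.
Qed.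

(** * Exponentials of Lie algebra elements as points over power series *)

Section MatrixGroup.
Variables (K : closedFieldType) (n : nat) (G : set 'M[K]_n).
Hypothesis charK : [pchar K] =i pred0.
Hypotheses (G1 : G 1%:M) (GM : forall g h, G g -> G h -> G (g *m h)).
Hypothesis GV : forall g, G g -> G (invmx g).
Hypothesis Gunit : forall g, G g -> g \in unitmx.

Local Notation C := (@lconst K).

Lemma pchar_laurent : [pchar (laurent K)] =i pred0.
Proof.
apply/pcharf0P => k; rewrite -(rmorph_nat C) -((pcharf0P K).1 charK k).
by rewrite fmorph_eq0.
Qed.

Lemma natK_neq0 k : (0 < k)%N -> k%:R != 0 :> K.
Proof. by rewrite ((pcharf0P K).1 charK) lt0n. Qed.

Lemma laurent_lieP A : lie_points G C A <-> laurent_lie G A.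
Proof.
split=> [H i p vp|H p vp].
  transitivity ((0 : laurent K) i) => //; rewrite -(H p vp) lcoef_sum.
  apply: eq_bigr => k _; rewrite lconst_mul; congr (_ * _).
  by have [a b] := mxvec_indexP k; rewrite !mxvecE mxE.
apply: laurentP => i; rewrite lcoef_sum -[RHS](H i p vp).
apply: eq_bigr => k _; rewrite lconst_mul; congr (_ * _).
by have [a b] := mxvec_indexP k; rewrite !mxvecE mxE.
Qed.

Lemma lie_linear a (X Y : 'M[K]_n) :
  lie_algebra G X -> lie_algebra G Y -> lie_algebra G (a *: X + Y).
Proof.
move=> LX LY p vp; rewrite linearP /=.
have E : \sum_k mx_meval p^`M(k) 1%:M * (a *: mxvec X + mxvec Y) 0 k =
  a * (\sum_k mx_meval p^`M(k) 1%:M * mxvec X 0 k) +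
       \sum_k mx_meval p^`M(k) 1%:M * mxvec Y 0 k.
  by rewrite mulr_sumr -big_split; apply: eq_bigr => k _; rewrite !mxE /=; ring.
by rewrite E LX // LY // mulr0 addr0.
Qed.

Lemma lie0 : lie_algebra G (0 : 'M[K]_n).
Proof. by move=> p vp; rewrite linear0 big1 // => k _; rewrite mxE mulr0. Qed.

Lemma lieZ a X : lie_algebra G X -> lie_algebra G (a *: X).
Proof. by move=> LX; rewrite -[_ *: _]addr0; apply: lie_linear => //; exact: lie0. Qed.

(** The derivative of [p] along the right-invariant vector field [A |-> Y A]. *)
Definition flow_derivative (Y : 'M[K]_n) (p : {mpoly K[n * n]}) : {mpoly K[n * n]} :=
  \sum_k p^`M(k) * mxvec (map_mx (@mpolyC _ K) Y *m generic_mx) 0 k.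

Lemma mxev_flow (S : comNzRingType) (phi : {rmorphism K -> S}) Y p A :
  mxev phi (flow_derivative Y p) A =
  \sum_k mxev phi p^`M(k) A * mxvec (map_mx phi Y *m A) 0 k.
Proof.
rewrite /mxev rmorph_sum /=; apply: eq_bigr => k _; rewrite rmorphM; congr (_ * _).
have [a b] := mxvec_indexP k; rewrite !mxvecE.
by rewrite -[in RHS](map_generic_mx phi A) -(map_mpolyC_mx phi (fun k => mxvec A 0 k))
  -map_mxM [in RHS]mxE.
Qed.

(** [(1 + eps Y) g] is a point of [G] over the dual numbers, and the [eps] part of [p] there is the
    flow derivative at [g]. *)
Lemma vanishes_flow Y p : lie_algebra G Y -> vanishes G p -> vanishes G (flow_derivative Y p).
Proof.
move=> LY vp g Gg; rewrite mxev_flow.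
have dY : points G (@dual_in K \o idfun) (dmx 1%:M Y) by apply/lie_dual.
have dg : points G (@dual_in K \o idfun) (dmx g 0).
  rewrite -map_dual_in; apply: points_map => q /(_ g Gg); exact.
have := pointsM GM dY dg vp; rewrite mul_dmx mul1mx mulmx0 add0r mxev_dual.
by case=> _; rewrite map_mx_id.
Qed.

Definition exp_coef (J : nat) (Y : 'M[K]_n) (i : int) : 'M[K]_n :=
  if i is Posz k then (if (J %| k)%N then (k %/ J)`!%:R^-1 *: Y ^+ (k %/ J) else 0) else 0.

Lemma mxlaurent (c : int -> 'M[K]_n) (m : int) : (forall i, i < m -> c i = 0) ->
  exists A, forall i, mxcoef i A = c i.
Proof.
move=> c0; have B a b : (fun i => c i a b) \in @laurent_bounded K.
  by apply/asboolP; exists m => i im; rewrite c0 // mxE.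
by exists (\matrix_(a, b) Laurent (B a b)) => i; apply/matrixP => a b; rewrite !mxE.
Qed.

(* [E] is [exp (u ^ J Y)]. For [p] vanishing on [G], so does its derivative    *)
(* along [Y]; hence the coefficients of [p (E)] vanish one after another.      *)
Lemma exp_points J Y : (0 < J)%N -> lie_algebra G Y ->
  exists2 E, points G C E & forall i, mxcoef i E = exp_coef J Y i.
Proof.
move=> J0 LY; have [|E EE] := @mxlaurent (exp_coef J Y) 0; first by case.
exists E => //.
have dE : map_mx (@lderiv K) E = lmonom J%:R (J%:Z - 1) *: (map_mx C Y *m E).
  apply: mxcoefP => i; rewrite mxcoef_deriv EE.
  have -> : mxcoef i (lmonom J%:R (J%:Z - 1) *: (map_mx C Y *m E)) =
            J%:R *: (Y *m mxcoef (i - (J%:Z - 1)) E).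
    rewrite -mxcoef_constM; apply/matrixP => a b.
    by rewrite mxE [in LHS]mxE lmonom_mul [in RHS]mxE [in RHS]mxE.
  rewrite EE; case: i => [k|[|k]]; last 2 first.
  - have -> : Negz 0 - (J%:Z - 1) = Negz J.-1 by lia.
    by rewrite (_ : Negz 0 + 1 = 0) // scale0r mulmx0 scaler0.
  - have -> : Negz k.+1 + 1 = Negz k by lia.
    have -> : Negz k.+1 - (J%:Z - 1) = Negz (k + J) by lia.
    by rewrite mulmx0 !scaler0.
  have -> : k%:Z + 1 = k.+1%:Z by lia.
  rewrite [exp_coef _ _ k.+1]/exp_coef; case: ifP => [/dvdnP[q kq]|ndv]; last first.
    rewrite scaler0; have [kJ|kJ] := ltnP k.+1 J.
      have -> : k%:Z - (J%:Z - 1) = Negz (J - k.+2) by lia.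
      by rewrite mulmx0 scaler0.
    have -> : k%:Z - (J%:Z - 1) = (k.+1 - J)%N%:Z by lia.
    rewrite /exp_coef ifF ?mulmx0 ?scaler0 //; apply: contraFF ndv => dv.
    by rewrite -(subnK kJ) dvdn_addl.
  case: q kq => [|q] kq; first by rewrite mul0n in kq.
  have -> : k%:Z - (J%:Z - 1) = (q * J)%N%:Z by lia.
  rewrite kq /exp_coef dvdn_mull // !mulnK // -scalemxAr !scalerA exprS.
  have q0 : q.+1%:R != 0 :> K by exact: natK_neq0.
  by congr (_ *: _); rewrite -pmulrn factS !natrM invfM mulrACA mulfV // mul1r.
have oE : mxord 0 E by case=> // k _; rewrite EE.
have E0 : mxcoef 0 E = 1%:M.
  by rewrite EE [exp_coef _ _ _]/= dvdn0 div0n fact0 invr1 scale1r expr0.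
have der p : lderiv (mxev C p E) = lmonom J%:R (J%:Z - 1) * mxev C (flow_derivative Y p) E.
  pose th := GRing.isAdditive.Build (laurent K) (dual (laurent K)) (dual_der (@lderiv K))
     (dual_der_additive (@lderiv_additive K)).
  pose th' := GRing.isMultiplicative.Build (laurent K) (dual (laurent K)) (dual_der (@lderiv K))
     (dual_der_multiplicative (@lderiv_mul K)).
  pose thm : {rmorphism laurent K -> dual (laurent K)} := HB.pack (dual_der (@lderiv K)) th th'.
  have /(congr1 snd) /= -> := mxev_morph thm C p E.
  have -> : map_mx thm E = dmx E (map_mx (@lderiv K) E).
    by apply/matrixP => i j; rewrite !mxE.
  rewrite (@eq_mxev _ _ _ _ (@dual_in (laurent K) \o C)) => [|c]; last first.
    by rewrite /= /dual_der lderiv_const.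
  rewrite mxev_dual /= mxev_flow mulr_sumr; apply: eq_bigr => k _.
  by rewrite dE linearZ /= mxE mulrCA.
suff H (i : nat) : forall p, vanishes G p -> forall j : int, j < i%:Z -> mxev C p E j = 0.
  by move=> p vp; apply: laurentP => j; rewrite (H (absz j).+1) //; lia.
elim: i => [|i IH] p vp j ji.
  by have [+ _] := mxev_ord0 p oE; apply.
have [ji'|ij] := ltP j i%:Z; first exact: IH.
have {ji ij} -> : j = i%:Z by lia.
case: i IH => [|i] IH.
  by have [_ ->] := mxev_ord0 p oE; rewrite E0; exact: vp.
have := congr1 (fun f : laurent K => f i%:Z) (der p).
rewrite lmonom_mul IH; [|exact: vanishes_flow|lia]; rewrite mulr0 => /eqP.
have -> : lderiv (mxev C p E) i%:Z = (i%:Z + 1)%:~R * mxev C p E (i%:Z + 1) by [].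
have -> : i%:Z + 1 = i.+1%:Z by lia.
by rewrite mulf_eq0 (negPf (natK_neq0 _)) //= => /eqP.
Qed.

End MatrixGroup.

(** * Gauge relations *)

Section LaurentMore.
Variables (K : closedFieldType) (n : nat).
Local Notation C := (@lconst K).
Implicit Types A B : 'M[laurent K]_n.

Lemma inv_coef0 A : mxord 0 A -> mxcoef 0 A = 1%:M ->
  [/\ A \in unitmx, mxord 0 (invmx A) & mxcoef 0 (invmx A) = 1%:M].
Proof.
move=> A0 A1; have uA := unit_mx_coef0 A0 A1; have VA := mulVmx uA.
have V0 := mxord_inv A0 A1 VA; split=> //.
have := mxcoef_mul V0 A0; rewrite VA A1 mulmx1 addr0 => <-.
by rewrite -(map_mx1 C) mxcoef_const.
Qed.

Lemma mxderiv_mul A B : map_mx (@lderiv K) (A *m B) =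
  A *m map_mx (@lderiv K) B + map_mx (@lderiv K) A *m B.
Proof.
apply/matrixP => i j; rewrite !mxE -big_split.
pose D := GRing.isAdditive.Build (laurent K) (laurent K) (@lderiv K) (@lderiv_additive K).
pose d : {additive laurent K -> laurent K} := HB.pack (@lderiv K) D.
rewrite -[lderiv _]/(d _) raddf_sum; apply: eq_bigr => k _.
by rewrite /= lderiv_mul !mxE.
Qed.

(* [gauge g A = B] without division. *)
Definition gauge_rel g A B := map_mx (@lderiv K) g = g *m A - B *m g.

Lemma gaugeP g A B : g \in unitmx -> gauge g A = B <-> gauge_rel g A B.
Proof.
move=> ug; rewrite /gauge /gauge_rel -mulmxBl; split=> [<-|->].
  by rewrite -mulmxA mulVmx // mulmx1 opprB addrC subrK.
by rewrite opprB addrC subrK mulmxK.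
Qed.

Lemma gauge_rel_comp g h A B D :
  gauge_rel g A B -> gauge_rel h B D -> gauge_rel (h *m g) A D.
Proof.
rewrite /gauge_rel mxderiv_mul => -> ->.
by rewrite mulmxBr mulmxBl !mulmxA addrA subrK.
Qed.

Lemma gauge_rel_inv g A B : g \in unitmx -> gauge_rel g A B -> gauge_rel (invmx g) B A.
Proof.
move=> ug; rewrite /gauge_rel => dg.
have /eqP := mxderiv_mul (invmx g) g; rewrite mulVmx // dg eq_sym.
have -> : map_mx (@lderiv K) (1%:M : 'M_n) = 0.
  by rewrite -(map_mx1 C); apply/matrixP => i j; rewrite !mxE lderiv_const.
rewrite addrC addr_eq0 => /eqP e; rewrite -[LHS](mulmxK ug) e.
by rewrite mulmxBr mulmxA mulVmx // mul1mx mulNmx mulmxBl mulmxA mulmxK // opprB.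
Qed.

End LaurentMore.

(** * Stability of the Lie algebra under gauge transformations, brackets and semisimple parts *)

Section MatrixGroup.
Variables (K : closedFieldType) (n : nat) (G : set 'M[K]_n).
Hypothesis charK : [pchar K] =i pred0.
Hypotheses (G1 : G 1%:M) (GM : forall g h, G g -> G h -> G (g *m h)).
Hypothesis GV : forall g, G g -> G (invmx g).
Hypothesis Gunit : forall g, G g -> g \in unitmx.

Local Notation C := (@lconst K).

Lemma gauge_rel_lie g A B : g \in unitmx -> points G C g -> gauge_rel g A B ->
  lie_points G C A -> lie_points G C B.
Proof.
move=> ug pg /(gaugeP _ _ ug) <- LA; have pV := pointsV GV Gunit ug pg.
have /laurent_lieP L1 := lie_conj G1 GM pg pV (mulmxV ug) LA.
have /laurent_lieP L2 := lie_logder G1 GM (@lderiv_additive K) (@lderiv_mul K)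
  (@lderiv_const K) pg pV (mulmxV ug).
apply/laurent_lieP => i; rewrite /gauge mxcoefB addrC -scaleN1r.
exact: lie_linear.
Qed.

(** This is the constant coefficient of the logarithmic derivative [W' W^-1]. *)
Lemma tangent_points W : points G C W -> mxord 0 W -> mxcoef 0 W = 1%:M ->
  lie_algebra G (mxcoef 1 W).
Proof.
move=> pW W0 W1; have [uW V0 V1] := inv_coef0 W0 W1.
have pV := pointsV GV Gunit uW pW.
have /laurent_lieP/(_ 0) := lie_logder G1 GM (@lderiv_additive K) (@lderiv_mul K)
  (@lderiv_const K) pW pV (mulmxV uW).
have dW0 : mxord 0 (map_mx (@lderiv K) W).
  move=> i i0; rewrite mxcoef_deriv; have [->|i1] := eqVneq i (-1).
    by rewrite addNr scale0r.
  by rewrite W0 ?scaler0 //; lia.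
have := mxcoef_mul dW0 V0; rewrite addr0 => ->.
by rewrite V1 mulmx1 mxcoef_deriv add0r scale1r.
Qed.

Lemma exp_points_order J Y : (0 < J)%N -> lie_algebra G Y ->
  exists E, [/\ points G C E, mxord 0 E, mxcoef 0 E = 1%:M,
    mxord J%:Z (E - 1%:M) & mxcoef J%:Z (E - 1%:M) = Y].
Proof.
move=> J0 LY; have [E pE EE] := exp_points charK G1 GM J0 LY.
exists E; have c1 i : mxcoef i (1%:M : 'M[laurent K]_n) = if i == 0 then 1%:M else 0.
  by rewrite -(map_mx1 C) mxcoef_const.
have E0 : mxcoef 0 E = 1%:M.
  by rewrite EE [exp_coef _ _ _]/= dvdn0 div0n fact0 invr1 scale1r expr0.
split=> //.
- by case=> // k _; rewrite EE.
- case=> [[|k]|k] iJ; rewrite mxcoefB c1 ?E0 ?subrr // EE ?subr0 //.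
  rewrite /exp_coef ifF //; apply: contraTF iJ => /dvdn_leq; lia.
- rewrite mxcoefB c1 ifF ?subr0; last by apply/negbTE; lia.
  by rewrite EE /exp_coef dvdnn divnn J0 (_ : (nat_of_bool true)`! = 1%N) // invr1 scale1r expr1.
Qed.

(** The bracket is the coefficient of [u] in the conjugate of [Y] by [exp (u X)]. *)
Lemma lie_bracket X Y : lie_algebra G X -> lie_algebra G Y ->
  lie_algebra G (X *m Y - Y *m X).
Proof.
move=> LX LY; have [E [pE E0 E1 EW EX]] := exp_points_order (ltn0Sn 0) LX.
have [uE V0 V1] := inv_coef0 E0 E1; have pV := pointsV GV Gunit uE pE.
have LCY : lie_points G C (map_mx C Y).
  by apply/laurent_lieP => i; rewrite mxcoef_const; case: eqP => // _; exact: lie0.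
have /laurent_lieP/(_ 1) := lie_conj G1 GM pE pV (mulmxV uE) LCY.
have -> : E *m map_mx C Y *m invmx E =
    map_mx C Y + ((E - 1%:M) *m map_mx C Y - map_mx C Y *m (E - 1%:M)) *m invmx E.
  have -> : (E - 1%:M) *m map_mx C Y - map_mx C Y *m (E - 1%:M) =
      E *m map_mx C Y - map_mx C Y *m E.
    by rewrite mulmxBl mulmxBr mul1mx mulmx1 opprB addrA subrK.
  by rewrite mulmxBl mulmxK // addrC subrK.
have W1 : mxord 1 ((E - 1%:M) *m map_mx C Y - map_mx C Y *m (E - 1%:M)).
  apply: mxordB; [rewrite -[1]addr0|rewrite -[1]add0r];
    by apply: mxord_mul => //; exact: mxord_const.
have := mxcoef_mul W1 V0; rewrite addr0 mxcoefD => ->.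
by rewrite V1 mulmx1 mxcoefB mxcoefM_const mxcoef_constM EX mxcoef_const add0r.
Qed.

Section ScalarExponential.

Definition sexp_coef (a : K) (i : int) : K := if i is Posz k then a ^+ k / k`!%:R else 0.
Fact sexp_bounded a : sexp_coef a \in @laurent_bounded K.
Proof. by apply/asboolP; exists 0; case. Qed.
Definition sexp a := Laurent (sexp_bounded a).

Lemma factK_neq0 k : k`!%:R != 0 :> K.
Proof. by rewrite ((pcharf0P K).1 charK) -lt0n fact_gt0. Qed.

Lemma sexpD a b : sexp (a + b) = sexp a * sexp b.
Proof.
have o c : lord 0 (sexp c) by case.
apply: laurentP => -[k|k]; last by rewrite (lord_mul (o a) (o b)).
rewrite (lmul_sum (N := k.+1) (o a) (o b)); last by lia.
rewrite [LHS]/= exprDn mulr_suml (reindex_inj rev_ord_inj) /=.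
apply: eq_bigr => i _; have ik : (i <= k)%N by rewrite -ltnS.
have -> : k%:Z - (0 + i%:Z) = (k - i)%N%:Z by lia.
rewrite /= ?add0n subSS subKn // -mulr_natr bin_sub //.
have /(congr1 (fun x => x%:R : K)) := bin_fact ik; rewrite !natrM => <-.
have := factK_neq0 i; have := factK_neq0 (k - i)%N.
have : 'C(k, i)%:R != 0 :> K by rewrite ((pcharf0P K).1 charK) -lt0n bin_gt0.
by move=> ? ? ?; field; apply/and3P.
Qed.

Lemma sexp0 : sexp 0 = 1.
Proof.
apply: laurentP => -[[|k]|k] //=; first by rewrite expr0 divr1.
by rewrite exprS mul0r mul0r.
Qed.

Lemma sexp_neq0 a : sexp a != 0.
Proof.
apply/eqP => /(congr1 (fun f : laurent K => f 0)) /= /eqP.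
by rewrite expr0 divr1 oner_eq0.
Qed.

Lemma sexpMn a k : sexp a ^+ k = sexp (k%:R * a).
Proof.
by elim: k => [|k IH]; rewrite ?mul0r ?sexp0 // exprS IH -sexpD -natr1 mulrDl mul1r addrC.
Qed.

Lemma sexp_prod s (lam : 'I_s -> K) (e : 'X_{1..s}) :
  mmap1 (fun i => sexp (lam i)) e = sexp (\sum_i (e i)%:R * lam i).
Proof.
rewrite /mmap1; elim/big_rec2: _ => [|i a b _ ->]; first by rewrite sexp0.
by rewrite sexpMn sexpD.
Qed.

End ScalarExponential.

(** The combination is the velocity at [u = 0] of the curve [\sum_i exp (a_i u) M_i], which starts
    at 1. *)
Lemma sexp_lie s (a : 'I_s -> K) (M : 'I_s -> 'M[K]_n) : \sum_i M i = 1%:M ->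
  points G C (\sum_i sexp (a i) *: map_mx C (M i)) -> lie_algebra G (\sum_i a i *: M i).
Proof.
move=> M1; set W := \sum_i _ => pW.
have Wc v : mxcoef v W = \sum_i sexp (a i) v *: M i.
  apply/matrixP => j k; rewrite mxE !summxE lcoef_sum; apply: eq_bigr => i _.
  by rewrite !mxE mulrC lconst_mul mulrC.
have := tangent_points pW; rewrite !Wc.
have -> : \sum_i sexp (a i) 1 *: M i = \sum_i a i *: M i.
  by apply: eq_bigr => i _; rewrite /= expr1 divr1.
apply.
  by case=> // v _; rewrite Wc big1 // => i _; rewrite /= scale0r.
by rewrite -M1; apply: eq_bigr => i _; rewrite /= expr0 divr1 scale1r.
Qed.

Lemma exprZmx (a : K) (A : 'M[K]_n) k : (a *: A) ^+ k = a ^+ k *: A ^+ k.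
Proof.
elim: k => [|k IH]; first by rewrite !expr0 scale1r.
by rewrite !exprS IH -mulmxE -scalemxAl -scalemxAr scalerA.
Qed.

(** The coefficient of [u ^ v] in [exp (a u) exp (u N)]. As [sexp_coef] vanishes at negative
    indices, the range [j < r] does not depend on [v]. *)
Lemma exp_nilpotent (a : K) (N : 'M[K]_n) r (v : nat) : N ^+ r = 0 ->
  v`!%:R^-1 *: (a%:M + N) ^+ v = \sum_(j < r) (sexp_coef a (v%:Z - j%:Z) / j`!%:R) *: N ^+ j.
Proof.
move=> Nr; pose f j := (sexp_coef a (v%:Z - j%:Z) / j`!%:R) *: N ^+ j.
have f_r j : (r <= j)%N -> f j = 0.
  by move=> rj; rewrite /f -(subnKC rj) exprD Nr mul0r scaler0.
have f_v j : (v < j)%N -> f j = 0.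
  by move=> vj; rewrite /f (_ : _ - _ = Negz (j - v.+1)) ?mul0r ?scale0r //; lia.
rewrite (sum_ord_vanish f_r f_v) exprDn_comm; last by rewrite /GRing.comm -!mulmxE scalar_mxC.
rewrite scaler_sumr; apply: eq_bigr => j _; have jv : (j <= v)%N by rewrite -ltnS.
rewrite /f; have -> : v%:Z - j%:Z = (v - j)%N%:Z by lia.
have -> : (a%:M : 'M[K]_n) ^+ (v - j) = (a ^+ (v - j))%:M.
  by elim: (v - j)%N => [|m IH]; rewrite ?expr0 // !exprS IH -mulmxE -scalar_mxM.
rewrite -mulmxE mul_scalar_mx -scaler_nat !scalerA; congr (_ *: _) => /=.
have /(congr1 (fun x => x%:R : K)) := bin_fact jv; rewrite !natrM => <-.
have := factK_neq0 j; have := factK_neq0 (v - j)%N.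
have : 'C(v, j)%:R != 0 :> K by rewrite ((pcharf0P K).1 charK) -lt0n bin_gt0.
by move=> ? ? ?; field; apply/and3P.
Qed.

(* [exp (k u X)] is an exponential polynomial in [k] that lies in [G]; the     *)
(* closure lemma then puts [exp (u X_s)] in [G].                               *)
Lemma lie_semisimple X s (lam : 'I_s -> K) E N :
  jordan_decomposition X lam E N -> lie_algebra G X ->
  lie_algebra G (\sum_i lam i *: E i).
Proof.
move=> jX LX; have [r Nr] := jordan_nilp jX.
(* [M i] is [E i exp (x u N)] as a polynomial in [x]. At [x = k], with the factor
   [exp (lam_i u) ^ k], these add up to [exp (k u X)]; at [x = 0] only [E i] is left. *)
pose M i : 'M[{poly laurent K}]_n := \matrix_(a, b)
  \sum_(j < r) (lmonom ((E i *m N ^+ j) a b / j`!%:R) j)%:P * 'X^j.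
have ME i (x : K) : map_mx (horner_eval (C x)) (M i) = \matrix_(a, b)
    \sum_(j < r) lmonom ((E i *m N ^+ j) a b / j`!%:R * x ^+ j) j.
  apply/matrixP => a b; rewrite !mxE horner_evalE horner_sum; apply: eq_bigr => j _.
  rewrite !hornerE -rmorphXn; apply: laurentP => v; rewrite mulrC lconst_mul /=.
  by case: eqP => _; rewrite ?mulr0 // mulrC.
have XE v : X ^+ v = \sum_i E i *m ((lam i)%:M + N) ^+ v.
  rewrite -[LHS]mulmx1 -(jordan_sum jX) mulmx_sumr; apply: eq_bigr => i _.
  elim: v => [|v IH]; first by rewrite !expr0 mul1mx mulmx1.
  rewrite !exprS -mulmxE -mulmxA IH !mulmxA (jordan_mulE jX) (jordan_comm jX).
  by rewrite mulmxDr mul_mx_scalar.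
have pk k : points G C (\sum_i sexp (lam i) ^+ k *: map_mx (horner_eval k%:R) (M i)).
  have [W pW WE] := exp_points charK G1 GM (ltn0Sn 0) (lieZ k%:R LX).
  suff <- : W = \sum_i sexp (lam i) ^+ k *: map_mx (horner_eval k%:R) (M i) by [].
  apply: mxcoefP => v; rewrite WE.
  apply/matrixP => a b; rewrite [RHS]mxE summxE lcoef_sum.
  have Mk i : (sexp (lam i) ^+ k *: map_mx (horner_eval k%:R) (M i)) a b v =
      \sum_(j < r) (E i *m N ^+ j) a b / j`!%:R * k%:R ^+ j *
                   sexp_coef (k%:R * lam i) (v - j%:Z).
    rewrite -(rmorph_nat C) ME !mxE sexpMn mulr_sumr lcoef_sum; apply: eq_bigr => j _.
    by rewrite mulrC lmonom_mul.
  under [RHS]eq_bigr do rewrite Mk.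
  case: v Mk => [v|v] _; last first.
    rewrite mxE big1 // => i _; rewrite big1 // => j _.
    by rewrite (_ : _ - _ = Negz (v + j)) ?mulr0 //; lia.
  rewrite /exp_coef dvd1n divn1.
  have -> : (k%:R *: X) ^+ v = \sum_i E i *m ((k%:R * lam i)%:M + k%:R *: N) ^+ v.
    rewrite exprZmx XE scaler_sumr; apply: eq_bigr => i _.
    by rewrite -scale_scalar_mx -scalerDr exprZmx scalemxAr.
  rewrite scaler_sumr summxE; apply: eq_bigr => i _.
  rewrite scalemxAr (exp_nilpotent _ (r := r)) ?mulmx_sumr ?summxE; last first.
    by rewrite exprZmx Nr scaler0.
  apply: eq_bigr => j _; rewrite exprZmx -!scalemxAr !mxE; ring.
apply: sexp_lie (jordan_sum jX) _ => p vp.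
have -> : \sum_i sexp (lam i) *: map_mx C (E i) =
          \sum_i sexp (lam i) *: map_mx (horner_eval 0) (M i).
    apply: eq_bigr => i _; congr (_ *: _); rewrite -(rmorph0 C) ME.
    apply/matrixP => a b; rewrite !mxE; case: r Nr {M ME pk} => [|r'] Nr.
      rewrite big_ord0; have := mulmx1 (E i); rewrite -[1%:M](expr0 N) Nr mulmx0 => <-.
      by rewrite mxE rmorph0.
    rewrite big_ord_recl big1 ?addr0 /= => [|j _]; last first.
      by rewrite expr0n mulr0; apply: laurentP => v /=; case: eqP.
    by rewrite !expr0 mulmx1 mulr1 divr1.
  apply: (exponential_closure (Lam := fun i => sexp (lam i))) => [|i|e e' //|k].
  - exact: pchar_laurent.
  - exact: sexp_neq0.
  - exact: pk.
Qed.
End MatrixGroup.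

(** * Normal forms of irregular connections, and the invariants of the polar part *)

Section Normalisation.
Variables (K : closedFieldType) (n : nat) (G : set 'M[K]_n).
Hypothesis charK : [pchar K] =i pred0.
Hypotheses (G1 : G 1%:M) (GM : forall g h, G g -> G h -> G (g *m h)).
Hypothesis GV : forall g, G g -> G (invmx g).
Hypothesis Gunit : forall g, G g -> g \in unitmx.

Local Notation C := (@lconst K).

Lemma mxderivB (A B : 'M[laurent K]_n) :
  map_mx (@lderiv K) (A - B) = map_mx (@lderiv K) A - map_mx (@lderiv K) B.
Proof.
apply/matrixP => i j; rewrite [LHS]mxE [(A - B) i j]mxE [(- B) i j]mxE.
by rewrite lderiv_additive !mxE.
Qed.

Lemma mxderiv_const (X : 'M[K]_n) : map_mx (@lderiv K) (map_mx C X) = 0.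
Proof. by apply/matrixP => i j; rewrite !mxE lderiv_const. Qed.

Lemma mxord_const_mul (X : 'M[K]_n) m A : mxord m A -> mxord m (map_mx C X *m A).
Proof. by move=> Am; rewrite -[m]add0r; apply: mxord_mul => //; exact: mxord_const. Qed.

Lemma mxord_mul_const (X : 'M[K]_n) m A : mxord m A -> mxord m (A *m map_mx C X).
Proof. by move=> Am; rewrite -[m]addr0; apply: mxord_mul => //; exact: mxord_const. Qed.

Section Normalise.
Variables (s : nat) (lam : 'I_s -> K) (E : 'I_s -> 'M[K]_n) (N X : 'M[K]_n).
Hypothesis jX : jordan_decomposition X lam E N.
Let Xs := \sum_i lam i *: E i.

Definition normalised (d : int) (J : nat) (B : 'M[laurent K]_n) : Prop :=
  [/\ lie_points G C B, mxord (- d) B, mxcoef (- d) B = X &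
      forall j : nat, (j <= J)%N ->
        mxcoef (- d + j%:Z) B *m Xs = Xs *m mxcoef (- d + j%:Z) B].

Lemma normalise_step d J B : 1 < d -> normalised d J B ->
  exists g B', [/\ points G C g, mxord 0 g, mxcoef 0 g = 1%:M, gauge_rel g B B'
                 & normalised d J.+1 B'].
Proof.
move=> d1 [LB Bd BX Bc].
have /laurent_lieP LBi := LB; have LX : lie_algebra G X by rewrite -BX.
pose M := mxcoef (- d + J.+1%:Z) B.
pose T : {linear 'M[K]_n -> 'M[K]_n} := (mulmx X \- mulmxr X).
have [||Y [Z [m [LY LZ MYZ TZ]]]] := @fitting K n T (lie_algebra G) M _ _ (LBi _).
- by move=> a A A'; exact: lie_linear.
- by move=> A LA; apply: (lie_bracket charK G1 GM GV Gunit).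
have ZXs := iter_commutator_ss jX jX TZ.
have [g [pg g0 g1 W0 WY]] := exp_points_order charK G1 GM (ltn0Sn J) LY.
have [ug V0 V1] := inv_coef0 g0 g1.
pose B' := gauge g B; have rB : gauge_rel g B B' by apply/gaugeP.
have W'0 : mxord J%:Z (map_mx (@lderiv K) g).
  have -> : map_mx (@lderiv K) g = map_mx (@lderiv K) (g - 1%:M).
    by rewrite mxderivB -(map_mx1 C) mxderiv_const subr0.
  by rewrite (_ : J%:Z = J.+1%:Z - 1); [exact: mxord_deriv | lia].
have B'd : mxord (- d) B'.
  rewrite /B' /gauge; apply: mxordB.
    by have := mxord_mul (mxord_mul g0 Bd) V0; rewrite add0r addr0.
  by apply: mxordW (mxord_mul W'0 V0); lia.
have B'E : B' - B = (g - 1%:M) *m B - B' *m (g - 1%:M) - map_mx (@lderiv K) g.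
  rewrite rB mulmxBl mulmxBr mul1mx mulmx1; move: (g *m B) (B' *m g) => P Q.
  by apply/matrixP => i j; rewrite !mxE; ring.
have WB : mxord (J.+1%:Z - d) ((g - 1%:M) *m B) by exact: mxord_mul.
have BW : mxord (- d + J.+1%:Z) (B' *m (g - 1%:M)) by exact: mxord_mul.
have DJ : mxord (- d + J.+1%:Z) (B' - B).
  rewrite B'E; apply: mxordB; first apply: mxordB => //.
    by rewrite addrC.
  by apply: mxordW W'0; lia.
have B'c i : i < - d + J.+1%:Z -> mxcoef i B' = mxcoef i B.
  by move=> /DJ /eqP; rewrite mxcoefB subr_eq0 => /eqP.
have B'X : mxcoef (- d) B' = X by rewrite B'c //; lia.
exists g, B'; split=> //; split=> //.
  exact: (gauge_rel_lie G1 GM GV Gunit ug pg rB).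
move=> j; rewrite leq_eqVlt => /orP[/eqP ->|jJ]; last first.
  by rewrite B'c ?BX; [exact: Bc | lia].
suff -> : mxcoef (- d + J.+1%:Z) B' = Z by [].
have := congr1 (mxcoef (- d + J.+1%:Z)) B'E; rewrite !mxcoefB.
rewrite (mxcoef_mul B'd W0) [X in mxcoef X (_ *m B)]addrC (mxcoef_mul W0 Bd).
rewrite (W'0 (_ + _)); last by lia.
rewrite BX B'X WY subr0 -/M => /eqP; rewrite subr_eq => /eqP ->.
rewrite MYZ /T /=; move: (X *m Y) (Y *m X) => P Q.
by apply/matrixP => a b; rewrite !mxE; ring.
Qed.

Lemma normalise d J B : 1 < d -> lie_points G C B -> mxord (- d) B ->
  mxcoef (- d) B = X ->
  exists g B', [/\ points G C g, mxord 0 g, mxcoef 0 g = 1%:M, gauge_rel g B B'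
                 & normalised d J B'].
Proof.
move=> d1 LB Bd BX; elim: J => [|J [g [B' [pg g0 g1 rg nB']]]].
  exists 1%:M, B; split.
  - exact: points1.
  - by rewrite -(map_mx1 C); exact: mxord_const.
  - by rewrite -(map_mx1 C) mxcoef_const.
  - rewrite /gauge_rel mul1mx mulmx1 subrr -(map_mx1 C).
    by apply/matrixP => i j; rewrite !mxE lderiv_const.
  split=> // j; rewrite leqn0 => /eqP ->; rewrite addr0 BX.
  by rewrite (jordanE jX) mulmxDl mulmxDr (jordan_comm_ss jX).
have [h [B'' [ph h0 h1 rh nB'']]] := normalise_step d1 nB'.
exists (h *m g), B''; split=> //.
- exact: pointsM.
- by have := mxord_mul h0 g0; rewrite addr0.
- by have := mxcoef_mul h0 g0; rewrite addr0 h1 g1 mulmx1.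
- exact: gauge_rel_comp rg rh.
Qed.

End Normalise.

Section Intertwiner.
Variables (s s' : nat) (lam : 'I_s -> K) (lam' : 'I_s' -> K).
Variables (E : 'I_s -> 'M[K]_n) (E' : 'I_s' -> 'M[K]_n) (N N' X X' : 'M[K]_n).
Hypotheses (jX : jordan_decomposition X lam E N).
Hypotheses (jX' : jordan_decomposition X' lam' E' N').
Let Xs := \sum_i lam i *: E i.
Let Xs' := \sum_i lam' i *: E' i.

(* With [S M = Xs' M - M Xs], the leading coefficient of [S h] is [S M] for a  *)
(* coefficient [M] of [h]. The gauge relation gives [S (S M) = 0], and [S] is  *)
(* semisimple, so [S M = 0].                                                   *)
Lemma intertwiner_order d J B B' h m : 1 < d ->
  normalised lam E X d J B -> normalised lam' E' X' d J B' ->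
  gauge_rel h B B' -> mxord m h ->
  mxord (m + J.+1%:Z) (map_mx C Xs' *m h - h *m map_mx C Xs).
Proof.
move=> d1 [_ Bd BX Bc] [_ Bd' BX' Bc'] rh hm.
set Z := _ - _.
suff H (i : nat) : (i <= J.+1)%N -> mxord (m + i%:Z) Z by exact: H.
elim: i => [|i IH] iJ.
  by rewrite addr0; apply: mxordB; [exact: mxord_const_mul | exact: mxord_mul_const].
have {}IH := IH (ltnW iJ).
have -> : m + i.+1%:Z = m + i%:Z + 1 by lia.
apply: mxordS => //; set v := m + i%:Z in IH *.
have comm_ord (B0 : 'M[laurent K]_n) (S : 'M[K]_n) :
    (forall j : nat, (j <= J)%N -> mxcoef (- d + j%:Z) B0 *m S = S *m mxcoef (- d + j%:Z) B0) ->
    mxord (- d) B0 -> mxord (- d + J.+1%:Z) (B0 *m map_mx C S - map_mx C S *m B0).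
  move=> B0c B0d k kJ; rewrite mxcoefB mxcoefM_const mxcoef_constM.
  have [kd|dk] := ltP k (- d); first by rewrite B0d // mul0mx mulmx0 subrr.
  have -> : k = - d + (absz (k + d)%R)%:Z by lia.
  by rewrite B0c ?subrr //; lia.
(* The operator [Y |-> Y' + B' Y - Y B] kills [h]. Applied to [Z = S h], it leaves only commutators
   of [B] and [B'] with the semisimple parts, which have high order by normalisation. *)
have TZ : map_mx (@lderiv K) Z + B' *m Z - Z *m B =
    (B' *m map_mx C Xs' - map_mx C Xs' *m B') *m h -
    h *m (B *m map_mx C Xs - map_mx C Xs *m B).
  have -> : map_mx (@lderiv K) Z = map_mx C Xs' *m map_mx (@lderiv K) h -
                                  map_mx (@lderiv K) h *m map_mx C Xs.
    by rewrite mxderivB !mxderiv_mul !mxderiv_const mul0mx mulmx0 addr0 add0r.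
  rewrite rh /Z !(mulmxBl, mulmxBr) !mulmxA.
  move: (map_mx C Xs' *m h *m B) (map_mx C Xs' *m B' *m h) (h *m B *m map_mx C Xs)
    (B' *m h *m map_mx C Xs) (B' *m map_mx C Xs' *m h) (h *m map_mx C Xs *m B).
  by move=> a1 a2 a3 a4 a5 a6; apply/matrixP => a b; rewrite !mxE; ring.
have TZo : mxcoef (v - d) (map_mx (@lderiv K) Z + B' *m Z - Z *m B) = 0.
  have o1 := mxord_mul (comm_ord _ _ Bc' Bd') hm.
  have o2 := mxord_mul hm (comm_ord _ _ Bc Bd).
  by rewrite TZ mxcoefB o1 ?o2 ?subrr // /v; lia.
move: TZo; rewrite mxcoefB mxcoefD (mxord_deriv IH); last by lia.
rewrite (mxcoef_mul IH Bd) [in mxcoef _ (B' *m Z)]addrC (mxcoef_mul Bd' IH) BX BX' add0r.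
move=> XZ; have SZ := iter_commutator_ss (m := 1) jX jX' XZ.
have Zv : mxcoef v Z = Xs' *m mxcoef v h - mxcoef v h *m Xs.
  by rewrite mxcoefB mxcoef_constM mxcoefM_const.
have := iter_commutator_ss (m := 2) (jordan_semisimple jX) (jordan_semisimple jX').
move=> /(_ (mxcoef v h)) H; rewrite Zv H ?subrr //=.
by rewrite -Zv SZ subrr.
Qed.

End Intertwiner.

(** The invariance of [P], multiplied by a power of the determinant, is a polynomial equation on
    [G], hence holds at points over [K((u))]. *)
Lemma invariant_points (P : {mpoly K[n * n]}) X A : invariant_polynomial G P ->
  lie_algebra G X -> A \in unitmx -> points G C A ->
  mxev C P (A *m map_mx C X *m invmx A) = C (mx_meval P X).
Proof.
move=> invP LX uA pA.
pose w k : {mpoly K[n * n]} :=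
  mxvec (generic_mx *m map_mx (@mpolyC _ K) X *m \adj generic_mx) 0 k.
have [D [q qE]] := clear_det w P.
have wE (T : comUnitRingType) (th : {rmorphism K -> T}) B : B \in unitmx ->
    mxev th q B = \det B ^+ D * mxev th P (B *m map_mx th X *m invmx B).
  move=> uB; rewrite qE //; congr (_ * _); apply: eq_bigr => m _; congr (_ * _).
  apply: mmap1_eq => k; have [a b] := mxvec_indexP k.
  rewrite /w !mxvecE /invmx uB -scalemxAr [RHS]mxE mulrC; congr (_ * _).
  have -> : B *m map_mx th X *m \adj B = map_mx (mmap th (fun k => mxvec B 0 k))
      (generic_mx *m map_mx (@mpolyC _ K) X *m \adj generic_mx).
    by rewrite !map_mxM map_mx_adj map_generic_mx map_mpolyC_mx.
  by rewrite [RHS]mxE.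
pose q' := q - (mx_meval P X)%:MP * \det generic_mx ^+ D.
have vq' : vanishes G q'.
  move=> g Gg; rewrite mxevB mxevM mxevC mxevXn mxev_det wE ?Gunit //.
  rewrite map_mx_id // -[mxev _ P _]/(mx_meval P (g *m X *m invmx g)) invP //=.
  by rewrite mulrC subrr.
have := pA _ vq'; rewrite mxevB mxevM mxevC mxevXn mxev_det wE // => /eqP.
rewrite mulrC -mulrBl mulf_eq0 expf_eq0 subr_eq0 => /orP[/eqP //|/andP[_]].
by rewrite unitmxE unitfE in uA; rewrite (negPf uA).
Qed.

(** After normalisation of both connections, the transformation [k] between them satisfies
    [k Xs k^-1 = Xs'] modulo [u]. The invariant [P] is constant on the left side by
    [invariant_points], and reduction modulo [u] compares it with its value at [Xs']. *)
Lemma polar_invariant (P : {mpoly K[n * n]}) d B B' h X X' s s'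
    (lam : 'I_s -> K) (lam' : 'I_s' -> K) E E' N N' :
  invariant_polynomial G P -> 1 < d ->
  lie_points G C B -> mxord (- d) B -> mxcoef (- d) B = X ->
  lie_points G C B' -> mxord (- d) B' -> mxcoef (- d) B' = X' ->
  jordan_decomposition X lam E N -> jordan_decomposition X' lam' E' N' ->
  h \in unitmx -> points G C h -> gauge_rel h B B' ->
  mx_meval P (\sum_i lam i *: E i) = mx_meval P (\sum_i lam' i *: E' i).
Proof.
move=> invP d1 LB Bd BX LB' Bd' BX' jX jX' uh ph rh.
have LX : lie_algebra G X by rewrite -BX; have /laurent_lieP := LB; apply.
have LXs := lie_semisimple charK G1 GM GV Gunit jX LX.
set Xs := \sum_i _ in LXs *; set Xs' := \sum_i _.
have [m hm] := mxord_ex h; have [m' hm'] := mxord_ex (invmx h).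
(* The intertwining error has order at least [m + J + 1]; multiplied by [k^-1], of order at least
   [m'], it must still have order at least 1. *)
pose J := (absz m + absz m')%N.
have [g [B1 [pg g0 g1 rg nB]]] := normalise jX J d1 LB Bd BX.
have [g' [B1' [pg' g0' g1' rg' nB']]] := normalise jX' J d1 LB' Bd' BX'.
have [ug V0 _] := inv_coef0 g0 g1; have [ug' V0' _] := inv_coef0 g0' g1'.
pose k := g' *m h *m invmx g.
have rk : gauge_rel k B1 B1'.
  apply: gauge_rel_comp (gauge_rel_inv ug rg) _; exact: gauge_rel_comp rh rg'.
have km : mxord m k.
  by have := mxord_mul (mxord_mul g0' hm) V0; rewrite add0r addr0.
have uk : k \in unitmx by rewrite !unitmx_mul ug' uh unitmx_inv ug.
have pk : points G C k.
  by apply: pointsM (pointsV GV Gunit ug pg) => //; exact: pointsM.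
have km' : mxord m' (invmx k).
  have -> : invmx k = g *m invmx h *m invmx g'.
    have kk : g *m invmx h *m invmx g' *m k = 1%:M.
      rewrite /k -!mulmxA (mulmxA (invmx g') g') (mulVmx ug') mul1mx.
      by rewrite (mulmxA (invmx h) h) (mulVmx uh) mul1mx (mulmxV ug).
    by rewrite -[RHS](mulmxK uk) kk mul1mx.
  by have := mxord_mul (mxord_mul g0 hm') V0'; rewrite add0r addr0.
have := mxord_mul (intertwiner_order jX jX' d1 nB nB' rk km) km'.
rewrite -/Xs -/Xs' mulmxBl mulmxK //; set A := k *m _ *m _ => oA.
have oA1 : mxord 1 (map_mx C Xs' - A) by apply: mxordW oA; rewrite /J; lia.
have A0 : mxord 0 A.
  rewrite -[A](subKr (map_mx C Xs')); apply: mxordB; first exact: mxord_const.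
  exact: mxordW oA1.
have A1 : mxcoef 0 A = Xs'.
  have := oA1 0 isT; rewrite mxcoefB mxcoef_const eqxx => /eqP.
  by rewrite subr_eq0 => /eqP.
have [_] := mxev_ord0 P A0; rewrite A1 invariant_points //.
Qed.

End Normalisation.

(** * Roots of unity, homogeneous invariants and nilpotency *)

Lemma prim_root_exists (K : closedFieldType) n : [pchar K] =i pred0 -> (0 < n)%N ->
  exists z : K, n.-primitive_root z.
Proof.
move=> charK n0; pose p : {poly K} := 'X^n - 1.
have [r Dp] := closed_field_poly_normal p.
rewrite (monicP _) ?monicXnsubC // scale1r in Dp.
have rn1 : all n.-unity_root r by apply/allP=> z; rewrite -root_prod_XsubC -Dp.
have sz_r : (n < (size r).+1)%N.
  by rewrite -(size_prod_XsubC r id) -Dp size_XnsubC.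
have [|z] := hasP (has_prim_root n0 rn1 _ sz_r); last by exists z.
by rewrite -separable_prod_XsubC -Dp separable_Xn_sub_1 // ((pcharf0P K).1 charK) -lt0n.
Qed.

Lemma meval_dhomog (R : comNzRingType) k (p : {mpoly R[k]}) d c (x : 'I_k -> R) :
  p \is d.-homog -> p.@[fun i => c * x i] = c ^+ d * p.@[x].
Proof.
move/dhomogP => hp; rewrite /meval /mmap mulr_sumr big_seq [RHS]big_seq.
apply: eq_bigr => m /hp md; rewrite mulrCA; congr (_ * _); rewrite -md /= mdegE.
rewrite /mmap1 -prodrXr -big_split; apply: eq_bigr => i _ /=.
by rewrite exprMn.
Qed.

Section TracePolynomials.
Variables (K : comNzRingType) (n : nat).

Definition trace_pow k : {mpoly K[n * n]} := \tr (generic_mx ^+ k).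

Lemma map_mx_pow (S S' : pzSemiRingType) (f : {rmorphism S -> S'}) k (A : 'M[S]_n) :
  map_mx f (A ^+ k) = map_mx f A ^+ k.
Proof.
elim: k => [|k IH]; first by rewrite !expr0 map_mx1.
by rewrite !exprS -!mulmxE map_mxM IH.
Qed.

Lemma mxev_trace_pow (S : comNzRingType) (phi : {rmorphism K -> S}) k A :
  mxev phi (trace_pow k) A = \tr (A ^+ k).
Proof. by rewrite /mxev -trace_map_mx map_mx_pow map_generic_mx. Qed.

End TracePolynomials.

Lemma conj_pow (K : comUnitRingType) n (g X : 'M[K]_n) k : g \in unitmx ->
  (g *m X *m invmx g) ^+ k = g *m X ^+ k *m invmx g.
Proof.
move=> ug; elim: k => [|k IH]; first by rewrite !expr0 mulmx1 mulmxV.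
by rewrite !exprS IH -!mulmxE !mulmxA mulmxKV.
Qed.

Lemma meval_trace_pow (K : closedFieldType) n k (A : 'M[K]_n) :
  mx_meval (trace_pow K n k) A = \tr (A ^+ k).
Proof. exact: (mxev_trace_pow idfun). Qed.

Section Degrees.
Variables (K : closedFieldType) (n : nat) (G : set 'M[K]_n).
Hypothesis charK : [pchar K] =i pred0.
Hypothesis Gunit : forall g, G g -> g \in unitmx.

Lemma invariant_trace_pow k : invariant_polynomial G (trace_pow K n k).
Proof.
move=> g X Gg _; rewrite !meval_trace_pow.
by rewrite conj_pow ?Gunit // mxtrace_mulC mulmxA mulVmx ?Gunit // mul1mx.
Qed.

(* Otherwise all invariants, the traces of powers among them, agree at [X]     *)
(* and at [0].                                                                 *)
Lemma fundamental_invariant_neq0 ds X : fundamental_degrees G ds -> lie_algebra G X ->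
  (forall k, X ^+ k <> 0) ->
  exists d f, [/\ d \in ds, invariant_polynomial G f, f \is d.-homog & mx_meval f X != 0].
Proof.
case=> f [invf homf _ genf] LX Xnil.
have f0 i : mx_meval (f i) 0 = 0 ^+ nth 0%N ds i * mx_meval (f i) X.
  rewrite /mx_meval -(meval_dhomog _ _ (homf i)); apply: eq_bigr => m _.
  by congr (_ * _); apply: mmap1_eq => k; rewrite linear0 mxE mul0r.
have [/existsP[i fi]|/existsPn fi] := boolP [exists i, mx_meval (f i) X != mx_meval (f i) 0].
  exists (nth 0%N ds i), (f i); split=> //; first exact: mem_nth.
  move: fi; rewrite f0; case: (nth 0%N ds i) => [|d]; first by rewrite expr0 mul1r eqxx.
  by rewrite expr0n mul0r.
have [k Xk] : exists k, X ^+ k = 0.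
  apply: (trace_pow_nilpotent charK) => k k0.
  have [Q QE] := genf _ (invariant_trace_pow k).
  transitivity (mx_meval (trace_pow K n k) X); first by rewrite meval_trace_pow.
  rewrite QE //; transitivity (mx_meval (trace_pow K n k) 0).
    rewrite QE; last exact: lie0.
    apply: eq_bigr => m _; congr (_ * _); apply: mmap1_eq => i.
    by have /negPn/eqP := fi i.
  rewrite meval_trace_pow.
  by case: k k0 {Q QE} => // k _; rewrite exprS mul0r mxtrace0.
by case: (Xnil k).
Qed.

Lemma jordan_ss_nilpotent (X : 'M[K]_n) s (lam : 'I_s -> K) E N k :
  jordan_decomposition X lam E N -> (\sum_i lam i *: E i) ^+ k = 0 ->
  exists k, X ^+ k = 0.
Proof.
move=> jX Xk; have [l Nl] := jordan_nilp jX; exists l.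
suff X0 : \sum_i lam i *: E i = 0 by rewrite (jordanE jX) X0 add0r.
rewrite big1 // => i _.
have : (\sum_i lam i *: E i) ^+ k *m E i = lam i ^+ k *: E i.
  elim: (k) => [|m IH]; first by rewrite !expr0 mul1mx scale1r.
  by rewrite !exprSr -mulmxE -mulmxA (jordan_ssE jX) -scalemxAr IH scalerA mulrC.
rewrite Xk mul0mx => /esym/eqP; rewrite scaler_eq0 expf_eq0.
by case/orP => [/andP[_ /eqP->]|/eqP->]; rewrite ?scale0r ?scaler0.
Qed.

End Degrees.

(** * Galois action on ramified pullbacks *)

Section Ramification.
Variables (K : closedFieldType) (n : nat) (G : set 'M[K]_n).
Hypothesis charK : [pchar K] =i pred0.
Hypotheses (G1 : G 1%:M) (GM : forall g h, G g -> G h -> G (g *m h)).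
Hypothesis GV : forall g, G g -> G (invmx g).
Hypothesis Gunit : forall g, G g -> g \in unitmx.
Local Notation C := (@lconst K).

Section Twist.
Variables (z : K) (b : nat).
Hypotheses (z0 : z != 0) (b0 : (0 < b)%N) (zb : z ^+ b = 1).

Let rotA := GRing.isAdditive.Build (laurent K) (laurent K) (lrot z) (@lrot_additive K z).
Let rotM := GRing.isMultiplicative.Build (laurent K) (laurent K) (lrot z)
  (lrot_multiplicative z0).
Definition lrot_rmorphism : {rmorphism laurent K -> laurent K} := HB.pack (lrot z) rotA rotM.
Local Notation rho := lrot_rmorphism.

Lemma points_rot g : points G C g -> points G C (map_mx rho g).
Proof.
move=> pg p vp; have := points_map rho pg vp; apply: etrans; apply: eq_mxev => c.
by rewrite /= lrot_const.
Qed.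

(** The pullback of the connection along [u |-> z u]: the factor [z] comes from [d (z u) = z du]. *)
Definition twist (B : 'M[laurent K]_n) := C z *: map_mx rho B.

Lemma mxcoef_twist i B : mxcoef i (twist B) = (z ^ (i + 1)) *: mxcoef i B.
Proof.
rewrite mxcoef_constZ expfzDr // expr1z mulrC -scalerA; congr (_ *: _).
by apply/matrixP => a c; rewrite !mxE.
Qed.

(** The pullback depends on [u] only through [t = u ^ b], which [u |-> z u] fixes. *)
Lemma twist_pullback A : twist (pullback b A) = pullback b A.
Proof.
apply/matrixP => i j; rewrite !mxE rmorphM rmorphM rmorph_nat rmorphXn /= lrot_subst //.
have -> : lrot z (lvar K) = C z * lvar K.
  by apply: laurentP => k; rewrite lconst_mul /=; case: eqP => [->|]; rewrite ?expr1z ?mulr0.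
rewrite exprMn; have : C z * C z ^+ b.-1 = 1 by rewrite -exprS prednK // -rmorphXn zb rmorph1.
move: (C z) (C z ^+ b.-1) => x y xy.
transitivity ((x * y) * (b%:R * lvar K ^+ b.-1 * lsubst b (A i j))); first by ring.
by rewrite xy mul1r.
Qed.

Lemma gauge_rel_twist g A B : gauge_rel g A B -> gauge_rel (map_mx rho g) (twist A) (twist B).
Proof.
rewrite /gauge_rel /twist => dg; rewrite -scalemxAr -scalemxAl -scalerBr -!map_mxM -map_mxB -dg.
by apply/matrixP => i j; rewrite !mxE /= lrot_deriv.
Qed.

End Twist.

(** For a primitive [b]-th root of unity [z], the matrix [g (z u) g (u)^-1] relates [B] to its
    twist. Comparing a degree [d] invariant on the two polar parts gives [z ^ (-a d) = 1]. *)
Lemma reduced_pullback_degree ds A B a b :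
  fundamental_degrees G ds -> laurent_lie G A -> (0 < a)%N -> (0 < b)%N ->
  gauge_class G (pullback b A) B -> reduced_of_order G B a.+1 ->
  exists2 d, d \in ds & (b %| a * d)%N.
Proof.
move=> degG LA a0 b0 [g [ug pg] gB] [[X0 Bd] Xnil].
have LpA : laurent_lie G (pullback b A).
  apply/laurent_lieP; rewrite /pullback => p vp.
  have LsA : lie_points G C (map_mx (lsubst b) A).
    apply/laurent_lieP => i; have -> : mxcoef i (map_mx (lsubst b) A) =
        if (b%:Z %| i)%Z then mxcoef (i %/ b%:Z)%Z A else 0.
      by apply/matrixP => j k; rewrite !mxE /=; case: ifP; rewrite !mxE.
    by case: ifP => _; [exact: LA | exact: lie0].
  rewrite linearZ /=; set f := (_ * _).
  transitivity (f * \sum_k C (mxev idfun p^`M(k) 1%:M) * mxvec (map_mx (lsubst b) A) 0 k).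
    by rewrite mulr_sumr; apply: eq_bigr => k _; rewrite mxE mulrCA.
  by rewrite (LsA p vp) mulr0.
have rg : gauge_rel g (pullback b A) B by apply/gaugeP.
have pg' : points G C g by [].
have LB := gauge_rel_lie G1 GM GV Gunit ug pg' rg ((laurent_lieP _ _).2 LpA).
have [z zprim] := prim_root_exists charK b0.
have zb := prim_expr_order zprim.
have z0 : z != 0.
  apply: contraTneq zprim => ->; apply/negP => /prim_expr_order; rewrite expr0n.
  by case: b b0 {LpA rg gB zb} => // b _ /eqP; rewrite eq_sym oner_eq0.
pose B' := twist z0 B; set X := mxcoef _ B in X0 Xnil.
have rg' : gauge_rel (map_mx (lrot_rmorphism z0) g) (pullback b A) B'.
  by rewrite -(twist_pullback z0 b0 zb); exact: gauge_rel_twist.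
pose w := z ^ (- (a%:Z)).
have B'X : mxcoef (- a.+1%:Z) B' = w *: X.
  by rewrite mxcoef_twist; congr (z ^ _ *: _); lia.
have B'd : mxord (- a.+1%:Z) B' by move=> i /Bd Bi; rewrite mxcoef_twist Bi scaler0.
have LB' : lie_points G C B'.
  apply/laurent_lieP => i; rewrite mxcoef_twist; apply: lieZ; move: i.
  by apply/laurent_lieP.
have [s [lam [E [N [_ [jX _]]]]]] := jordan_exists X.
have jX' : jordan_decomposition (w *: X) (fun i => w * lam i) E (w *: N).
  case: (jX) => XE orth sumE comm [k Nk]; split=> //.
  - by rewrite {1}XE scalerDr scaler_sumr; congr (_ + _); apply: eq_bigr => i _; rewrite scalerA.
  - by move=> i; rewrite -scalemxAl -scalemxAr comm.
  - by exists k; rewrite exprZmx Nk scaler0.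
set Xs := \sum_i lam i *: E i.
have LX : lie_algebra G X by have /laurent_lieP := LB; apply.
have LXs : lie_algebra G Xs := lie_semisimple charK G1 GM GV Gunit jX LX.
(* If [Xs] were nilpotent, so would be [X], and then [ad X], against reducedness. *)
have [d [f [dds invf homf fX]]] : exists d f, [/\ d \in ds, invariant_polynomial G f,
    f \is d.-homog & mx_meval f Xs != 0].
  apply: (fundamental_invariant_neq0 charK Gunit degG LXs) => k Xsk.
  have [l Xl] := jordan_ss_nilpotent jX Xsk; apply: Xnil.
  by exists (l + l)%N => Y _; exact: nilpotent_iter_commutator.
exists d => //.
have ph : points G C (map_mx (lrot_rmorphism z0) g *m invmx g).
  by apply: (pointsM GM (points_rot z0 pg')); exact: (pointsV GV Gunit ug pg').
have uh : map_mx (lrot_rmorphism z0) g *m invmx g \in unitmx.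
  by rewrite unitmx_mul unitmx_inv ug map_unitmx ug.
have d1 : 1 < a.+1%:Z by lia.
have := polar_invariant charK G1 GM GV Gunit invf d1 LB Bd erefl LB' B'd B'X jX jX' uh ph
  (gauge_rel_comp (gauge_rel_inv ug rg) rg').
have -> : \sum_i (w * lam i) *: E i = w *: Xs.
  by rewrite scaler_sumr; apply: eq_bigr => i _; rewrite scalerA.
have -> : mx_meval f (w *: Xs) = w ^+ d * mx_meval f Xs.
  rewrite /mx_meval -(meval_dhomog _ _ homf); apply: eq_bigr => m _.
  by congr (_ * _); apply: mmap1_eq => k; rewrite linearZ mxE.
move=> /eqP; rewrite -subr_eq0 -{1}[mx_meval f _]mul1r -mulrBl mulf_eq0.
rewrite (negPf fX) orbF subr_eq0 => /eqP wd.
have za : z ^+ a = w^-1 by rewrite /w -exprnN invrK.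
by rewrite (prim_order_dvd zprim) exprM za exprVn -wd invr1.
Qed.
End Ramification.

(** * A semisimple element from a torus of positive rank *)

Section Cocharacter.
Variables (K : closedFieldType) (n : nat) (G : set 'M[K]_n).
Hypothesis charK : [pchar K] =i pred0.
Hypotheses (G1 : G 1%:M) (GM : forall g h, G g -> G h -> G (g *m h)).
Hypothesis GV : forall g, G g -> G (invmx g).
Hypothesis Gunit : forall g, G g -> g \in unitmx.
Local Notation C := (@lconst K).

Lemma poly_neq0_eq0 (q : {poly K}) : (forall y, y != 0 -> q.[y] = 0) -> q = 0.
Proof.
move=> q0; suff /eqP : q * 'X = 0 by rewrite mulf_eq0 polyX_eq0 orbF => /eqP.
apply: (poly_nat_eq0 charK) => k; rewrite !hornerE.
by have [->|/q0 ->] := eqVneq (k%:R : K) 0; rewrite ?mulr0 ?mul0r.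
Qed.

Lemma mxpoly_coef_eq D (A B : 'I_D -> 'M[K]_n) :
  (forall y : K, y != 0 -> \sum_(l < D) y ^+ l *: A l = \sum_(l < D) y ^+ l *: B l) -> A =1 B.
Proof.
move=> AB l; apply/matrixP => i j; apply/eqP; rewrite -subr_eq0.
pose q := \poly_(m < D) (if insub m is Some l then A l i j - B l i j else 0).
have q0 : q = 0.
  apply: poly_neq0_eq0 => y y0; rewrite horner_poly.
  have /matrixP/(_ i j)/eqP := AB y y0; rewrite -subr_eq0 !summxE -sumrB => /eqP e.
  rewrite -[RHS]e; apply: eq_bigr => m _; rewrite valK !mxE; ring.
by have := congr1 (fun p : {poly K} => p`_l) q0; rewrite coef_poly ltn_ord valK coef0 => ->.
Qed.

(** The first coordinate of the torus gives a cocharacter [y |-> y ^ (-k) \sum_l y ^ l M_l] whose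
    [M_l] are orthogonal idempotents, and the element sought is its derivative [\sum_l (l - k) M_l]
    at 1. Were it nilpotent, only [M_k] would survive and the cocharacter would be constant, against
    injectivity of [theta]. *)
Lemma diag_torus_lie r (Td : set 'M[K]_n) (theta : 'M[K]_r.+1 -> 'M[K]_n) :
  (forall g, Td g -> G g) -> algebraic_isomorphism (@diag_torus K r.+1) Td theta ->
  exists2 X, lie_algebra G X & forall k, X ^+ k <> 0.
Proof.
move=> TG [[thT thM [p [k pE]]] [th' [_ thK _]]].
pose dv (S : comNzRingType) (y : S) : 'M[S]_r.+1 := diag_mx (\row_i (if i == 0 then y else 1)).
have dvT y : y != 0 -> diag_torus (dv K y).
  move=> y0; exists (\row_i (if i == 0 then y else 1)) => [i|//]; rewrite mxE.
  by case: ifP; rewrite ?oner_neq0.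
have dvM (y z : K) : dv K y *m dv K z = dv K (y * z).
  by rewrite mulmx_diag; congr diag_mx; apply/rowP => i; rewrite !mxE; case: eqP; rewrite ?mulr1.
have dv1 : dv K 1 = 1%:M.
  by rewrite -diag_const_mx; congr diag_mx; apply/rowP => i; rewrite !mxE; case: eqP.
pose P : 'M[{poly K}]_n := \matrix_(i, j) mxev polyC (p i j) (dv {poly K} 'X).
have PE y : y != 0 -> theta (dv K y) = y ^- k *: map_mx (horner_eval y) P.
  move=> y0; apply/matrixP => i j; rewrite pE; last exact: dvT.
  rewrite !mxE mulrC; congr (_^-1 * _).
    rewrite det_diag (bigD1 0) //= mxE eqxx big1 ?mulr1 // => l l0.
    by rewrite mxE (negPf l0).
  rewrite mxev_morph; have -> : map_mx (horner_eval y) (dv {poly K} 'X) = dv K y.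
    apply/matrixP => a b; rewrite !mxE horner_evalE hornerMn; congr (_ *+ _).
    by case: eqP; rewrite !hornerE.
  by apply: eq_mxev => c; rewrite /= horner_evalE hornerC.
have [D PD] : exists D, forall i j, (size (P i j) <= D)%N.
  exists (\max_(ij : 'I_n * 'I_n) size (P ij.1 ij.2)) => i j.
  exact: (leq_bigmax (F := fun ij : 'I_n * 'I_n => size (P ij.1 ij.2)) (i, j)).
pose M (l : 'I_D) : 'M[K]_n := \matrix_(i, j) (P i j)`_l.
have PM y : map_mx (horner_eval y) P = \sum_(l < D) y ^+ l *: M l.
  apply/matrixP => i j; rewrite mxE summxE horner_evalE (horner_coef_wide _ (PD i j)).
  by apply: eq_bigr => l _; rewrite !mxE mulrC.
pose lamb y := \sum_(l < D) y ^+ l *: M l.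
have PP y z : y != 0 -> z != 0 -> lamb y *m lamb z = lamb (y * z).
  move=> y0 z0; have := thM _ _ (dvT y y0) (dvT z z0).
  rewrite dvM !PE ?mulf_neq0 // -scalemxAl -scalemxAr scalerA !PM -/(lamb _) exprMn invfM.
  by move/esym/scalerI; apply; rewrite mulf_neq0 // invr_eq0 expf_neq0.
have P1 : lamb 1 = 1%:M.
  have := PE 1 (oner_neq0 _); rewrite expr1n invr1 scale1r PM -/(lamb _) dv1 => <-.
  have T1 : diag_torus (1%:M : 'M[K]_r.+1) by rewrite -dv1; apply: dvT; exact: oner_neq0.
  have u1 : theta 1%:M \in unitmx by apply: Gunit; apply: TG; exact: thT.
  have := thM _ _ T1 T1; rewrite mul1mx => e.
  by rewrite -[LHS](mulKmx u1) -e mulVmx.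
have MP l z : z != 0 -> M l *m lamb z = z ^+ l *: M l.
  move=> z0; move: l; apply: mxpoly_coef_eq => y y0.
  transitivity (lamb y *m lamb z).
    by rewrite mulmx_suml; apply: eq_bigr => l _; rewrite scalemxAl.
  by rewrite PP //; apply: eq_bigr => l _; rewrite exprMn scalerA.
(* Coefficients of [y] and then of [z] are compared in [lamb y *m lamb z = lamb (y * z)]. *)
have MM l l' : M l *m M l' = if l' == l then M l else 0.
  move: l'; apply: mxpoly_coef_eq => z z0; transitivity (M l *m lamb z).
    by rewrite mulmx_sumr; apply: eq_bigr => l' _; rewrite scalemxAr.
  rewrite MP // (bigD1 l) //= eqxx big1 ?addr0 // => l' l'l.
  by rewrite (negPf l'l) scaler0.
have S1 : \sum_l M l = 1%:M.
  by rewrite -P1; apply: eq_bigr => l _; rewrite expr1n scale1r.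
pose al (l : 'I_D) : K := l%:R - k%:R.
exists (\sum_l al l *: M l); last first.
  move=> m Xm; have M0 (l : 'I_D) : (l : nat) != k -> M l = 0.
    move=> lk; have : (\sum_l al l *: M l) ^+ m *m M l = al l ^+ m *: M l.
      have SM : (\sum_l al l *: M l) *m M l = al l *: M l.
        rewrite mulmx_suml (bigD1 l) //= -scalemxAl MM eqxx big1 ?addr0 // => l' l'l.
        by rewrite -scalemxAl MM eq_sym (negPf l'l) scaler0.
      elim: (m) => [|j IH]; first by rewrite !expr0 mul1mx scale1r.
      by rewrite exprSr -mulmxE -mulmxA SM -scalemxAr IH scalerA exprS.
    rewrite Xm mul0mx => /esym/eqP; rewrite scaler_eq0 expf_eq0 => /orP[/andP[_]|/eqP //].
    by rewrite subr_eq0 => /eqP/(natr_inj_pchar0 charK) e; rewrite e eqxx in lk.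
  have two0 : 2%:R != 0 :> K by rewrite ((pcharf0P K).1 charK).
  have : theta (dv K 2%:R) = theta (dv K 1).
    rewrite !PE ?oner_neq0 // !PM !scaler_sumr; apply: eq_bigr => l _.
    have [lk|/M0 ->] := eqVneq (l : nat) k; last by rewrite !scaler0.
    by rewrite !scalerA lk mulVf ?expf_neq0 // expr1n invr1 mulr1.
  move/(congr1 th'); rewrite !thK; try by apply: dvT; rewrite ?oner_neq0.
  move/matrixP/(_ 0 0); rewrite !mxE eqxx !mulr1n => /eqP.
  by rewrite -subr_eq0 -[2%:R]/(1 + 1) addrK oner_eq0.
have two0 : 2%:R != 0 :> K by rewrite ((pcharf0P K).1 charK).
apply: (sexp_lie G1 GM GV Gunit) => // q vq.
(* [exponential_closure] is applied to the values of the cocharacter at powers of 2. Multiplicative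
   relations among the [2 ^ m l] are linear relations among the [m l], which the series
   [exp (m_l u)] satisfy too. *)
pose m (l : 'I_D) : int := l%:Z - k%:Z.
pose Lam l : laurent K := C (2%:R ^ m l).
pose PC l : 'M[{poly laurent K}]_n := map_mx polyC (map_mx C (M l)).
have PCE l c : map_mx (horner_eval c) (PC l) = map_mx C (M l).
  by apply/matrixP => i j; rewrite !mxE horner_evalE hornerC.
have mE l : al l = (m l)%:~R by rewrite /m intrB.
have LamE e : mmap1 Lam e = C (2%:R ^ (\sum_l (e l)%:Z * m l)).
  rewrite /mmap1; elim/big_rec2: _ => [|l x y _ ->]; first by rewrite expr0z rmorph1.
  by rewrite expfzDr // rmorphM; congr (_ * _); rewrite -rmorphXn exprnP exprz_exp [m l * _]mulrC.
have two_inj : injective (fun j : int => 2%:R ^ j : K).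
  move=> i j; wlog ij : i j / i <= j => [W|] eij.
    by case/orP: (le_total i j) => [/W|/W->] // ->.
  have [d dE] : exists d : nat, j = i + d%:Z by exists (absz (j - i)%R); lia.
  move: eij; rewrite dE expfzDr // -[LHS]mulr1 => /(mulfI (expfz_neq0 _ two0)) /esym.
  rewrite -exprnP -natrX => /(@natr_inj_pchar0 K charK _ 1%N)/eqP.
  by rewrite -{2}(expn0 2) eqn_exp2l // => /eqP ->; rewrite addr0.
have := @exponential_closure K (laurent K) C n q D Lam (fun l => sexp (al l)) PC
  (pchar_laurent charK).
under eq_bigr do rewrite PCE; apply=> [l|e e'|j].
- by rewrite fmorph_eq0 expfz_neq0.
- rewrite !LamE !sexp_prod //= => /fmorph_inj/two_inj e2; congr sexp.
  have ee (e0 : 'X_{1..D}) : \sum_l (e0 l)%:R * al l = (\sum_l (e0 l)%:Z * m l)%:~R.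
    by rewrite rmorph_sum; apply: eq_bigr => l _; rewrite mE rmorphM /= -pmulrn.
  by rewrite !ee e2.
have y0 : 2%:R ^+ j != 0 :> K by rewrite expf_neq0.
have -> : \sum_l Lam l ^+ j *: map_mx (horner_eval j%:R) (PC l) =
          map_mx C (theta (dv K (2%:R ^+ j))).
  rewrite PE // PM map_mxZ map_mx_sum scaler_sumr; apply: eq_bigr => l _.
  rewrite PCE map_mxZ scalerA /Lam -rmorphXn; congr (_ *: _).
  rewrite -rmorphM; congr C; rewrite /m expfzDr // -exprnP -exprnN exprMn mulrC.
  by rewrite -!exprM exprVn -exprM [(l * j)%N]mulnC [(k * j)%N]mulnC.
by rewrite mxev_map vq ?rmorph0 //; apply: TG; apply: thT; exact: dvT.
Qed.
End Cocharacter.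

(** * Tori from eigenvalues of infinite order *)

Lemma int_bezout s (c : 'I_s -> int) i0 : c i0 != 0 ->
  exists (g : int) (b c' : 'I_s -> int),
    [/\ g != 0, forall i, c i = g * c' i & \sum_i b i * c' i = 1].
Proof.
(* The least positive integral combination of the [c i] is their gcd, because remainders modulo it
   are again combinations. *)
move=> ci0; pose Q k := `[< (0 < k)%N /\ exists b : 'I_s -> int, \sum_i b i * c i = k%:Z >].
have exQ : exists k, Q k.
  exists (absz (c i0)); apply/asboolP; split; first by rewrite absz_gt0.
  exists (fun i => if i == i0 then sgz (c i0) else 0).
  rewrite (bigD1 i0) //= eqxx big1 ?addr0 => [|i /negPf->]; last by rewrite mul0r.
  by rewrite abszEsg.
have [g /asboolP[g0 [b bg]] ming] := ex_minnP exQ.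
have dv i : (g%:Z %| c i)%Z.
  apply/dvdz_mod0P/eqP; apply: contraT => r0.
  have r_ge0 : 0 <= (c i %% g%:Z)%Z by apply: modz_ge0; lia.
  have r_lt : (c i %% g%:Z)%Z < g%:Z by apply: ltz_pmod; lia.
  suff : Q (absz (c i %% g%:Z)%Z) by move/ming; lia.
  apply/asboolP; split; first by rewrite absz_gt0.
  exists (fun j => (j == i)%:R - (c i %/ g%:Z)%Z * b j).
  rewrite (eq_bigr (fun j => (j == i)%:R * c j - (c i %/ g%:Z)%Z * (b j * c j))); last first.
    by move=> j _; ring.
  rewrite sumrB -mulr_sumr bg (bigD1 i) //= eqxx mul1r.
  rewrite big1 ?addr0 => [|j /negPf->]; last by rewrite mul0r.
  by rewrite gez0_abs // /modz.
exists g%:Z, b, (fun i => (c i %/ g%:Z)%Z); split; first by lia.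
  by move=> i; rewrite mulrC divzK.
have : g%:Z * \sum_i b i * (c i %/ g%:Z)%Z = g%:Z * 1.
  by rewrite mulr1 -[RHS]bg mulr_sumr; apply: eq_bigr => i _; rewrite mulrCA [g%:Z * _]mulrC divzK.
by move/mulfI; apply; lia.
Qed.

Lemma prodr_exprz (F : fieldType) (I : finType) (x : I -> F) (k : int) :
  (\prod_i x i) ^ k = \prod_i x i ^ k.
Proof.
by elim/big_rec2: _ => [|i y z _ <-]; rewrite ?exp1rz // expfzMl.
Qed.

(* [c] is read off a maximal multiplicatively independent subset of [lam]. *)
Lemma cocharacter_exists (F : fieldType) s (lam : 'I_s -> F) i0 :
  (forall i, lam i != 0) -> (forall k, (0 < k)%N -> lam i0 ^+ k != 1) ->
  exists c b : 'I_s -> int, \sum_i b i * c i = 1 /\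
    forall a : 'I_s -> int, \prod_i lam i ^ a i = 1 -> \sum_i a i * c i = 0.
Proof.
move=> lam0 li0.
have prodX (a : 'I_s -> int) (k : int) : (\prod_i lam i ^ a i) ^ k = \prod_i lam i ^ (a i * k).
  by rewrite prodr_exprz; apply: eq_bigr => i _; rewrite exprz_exp.
have prodD (a a' : 'I_s -> int) : \prod_i lam i ^ (a i + a' i) =
    (\prod_i lam i ^ a i) * \prod_i lam i ^ a' i.
  by rewrite -big_split; apply: eq_bigr => i _; rewrite expfzDr.
pose indep (S : {set 'I_s}) := `[< forall a : 'I_s -> int,
  (forall i, i \notin S -> a i = 0) -> \prod_i lam i ^ a i = 1 -> forall i, a i = 0 >].
have ind1 : indep [set i0]%SET.
  apply/asboolP => a a0; rewrite (bigD1 i0) //= big1 ?mulr1 => [la i|i ii0]; last first.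
    by rewrite a0 ?expr0z // inE.
  have [->|ii0] := eqVneq i i0; last by rewrite a0 // inE.
  apply/eqP; apply: contraT => ai0.
  suff e : lam i0 ^+ absz (a i0) = 1.
    by have := li0 (absz (a i0)); rewrite absz_gt0 e eqxx => /(_ ai0).
  case: (a i0) la => k; first by [].
  by rewrite NegzE -exprnN => /eqP; rewrite invr_eq1 => /eqP.
have [S /maxsetP[/asboolP indS maxS] iS] := maxset_exists ind1.
have i0S : i0 \in S by apply: (fintype.subsetP iS); rewrite inE.
have rel j : exists (Nj : int) (m : 'I_s -> int), [/\ Nj != 0, forall i, i \notin S -> m i = 0,
    lam j ^ Nj = \prod_i lam i ^ m i & (j = i0 -> m i0 = 1)].
  have [jS|jS] := boolP (j \in S).
    exists 1, (fun i => (i == j)%:R); split=> //; last by move=> ->; rewrite eqxx.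
      by move=> i iS'; case: eqP iS' => // ->; rewrite jS.
    rewrite (bigD1 j) //= eqxx big1 ?mulr1 // => i /negPf->; exact: expr0z.
  have nind : ~~ indep (j |: S)%SET.
    apply: contra jS => /maxS <-; first by rewrite setU11.
    exact: finset.subsetUr.
  have [a aP] : exists a : 'I_s -> int, [/\ forall i, i \notin (j |: S)%SET -> a i = 0,
      \prod_i lam i ^ a i = 1 & exists i, a i != 0].
    move: nind; apply: contraNP => na; apply/asboolP => a a0 a1 i; apply/eqP.
    by apply: contraT => ai; case: na; exists a; split=> //; exists i.
  case: aP => a0 a1 [k ak].
  have aj : a j != 0.
    apply: contraNneq ak => aj; apply/eqP/(indS a) => // i iS'.
    have [->//|ij] := eqVneq i j; by rewrite a0 // !inE negb_or ij.
  exists (a j), (fun i => if i == j then 0 else - a i); split=> //.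
  - by move=> i iS'; case: eqP => // /eqP ij; rewrite a0 ?oppr0 // !inE negb_or ij.
  - rewrite [RHS](bigD1 j) //= eqxx expr0z mul1r.
    have : lam j ^ a j * \prod_(i | i != j) lam i ^ a i = 1 by move: a1; rewrite (bigD1 j).
    move=> /(congr1 (fun x => x / \prod_(i | i != j) lam i ^ a i)).
    rewrite mulfK ?mul1r; last by apply/prodf_neq0 => i _; rewrite expfz_neq0.
    move=> ->; rewrite -prodfV; apply: eq_bigr => i /negPf ->; exact: invr_expz.
  - by move=> ji; rewrite ji i0S in jS.
have [Nj Nj'] := choice rel; have [m mP] := choice Nj'.
pose Q j := \prod_(l | l != j) Nj l.
have NQ j : Nj j * Q j = \prod_l Nj l by rewrite [RHS](bigD1 j).
(* Up to the common factor [\prod_l Nj l], this is the [i0]-coordinate of [lam j] in terms of the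
   maximal independent set [S]. The independence of [S] makes it vanish on relations. *)
pose c j := m j i0 * Q j.
have ci0 : c i0 != 0.
  have [_ _ _ /(_ erefl) mi] := mP i0; rewrite /c mi mul1r.
  by apply/prodf_neq0 => j _; have [] := mP j.
have [g [b [c' [g0 cc' bc']]]] := int_bezout ci0.
exists c', b; split=> // a a1; apply: (mulfI g0); rewrite mulr0.
transitivity (\sum_j m j i0 * (Q j * a j)).
  by rewrite mulr_sumr; apply: eq_bigr => j _; rewrite mulrCA -cc' /c; ring.
apply: (indS (fun i => \sum_j m j i * (Q j * a j))) => [i iS'|].
  by rewrite big1 // => j _; have [_ m0 _ _] := mP j; rewrite m0 // mul0r.
transitivity (\prod_i \prod_j lam i ^ (m j i * (Q j * a j))).
  apply: eq_bigr => i _; elim/big_rec2: _ => [|j x y _ <-]; first by rewrite expr0z.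
  by rewrite expfzDr.
rewrite exchange_big /=; transitivity (\prod_j lam j ^ (a j * \prod_l Nj l)).
  apply: eq_bigr => j _; rewrite -prodX; have [_ _ <- _] := mP j.
  by rewrite exprz_exp mulrA NQ mulrC.
by rewrite -prodX a1 exp1rz.
Qed.

Lemma prod_exprz (F : fieldType) (I : finType) (y : F) (a : I -> int) : y != 0 ->
  \prod_i y ^ a i = y ^ (\sum_i a i).
Proof.
move=> y0; elim/big_rec2: _ => [|i x z _ ->]; first by rewrite expr0z.
by rewrite expfzDr.
Qed.

Lemma mxsubE (V : zmodType) m n (A B : 'M[V]_(m, n)) i j : (A - B) i j = A i j - B i j.
Proof. by rewrite mxE [X in _ + X]mxE. Qed.

Lemma mx_mevalB (K : closedFieldType) n (p q : {mpoly K[n * n]}) A :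
  mx_meval (p - q) A = mx_meval p A - mx_meval q A.
Proof. exact: rmorphB. Qed.

Lemma mx_mevalM (K : closedFieldType) n (p q : {mpoly K[n * n]}) A :
  mx_meval (p * q) A = mx_meval p A * mx_meval q A.
Proof. exact: rmorphM. Qed.

Lemma mx_mevalXn (K : closedFieldType) n (p : {mpoly K[n * n]}) k A :
  mx_meval (p ^+ k) A = mx_meval p A ^+ k.
Proof. exact: rmorphXn. Qed.

Lemma mx_meval_prod (K : closedFieldType) n (I : finType) (p : I -> {mpoly K[n * n]}) A :
  mx_meval (\prod_i p i) A = \prod_i mx_meval (p i) A.
Proof. exact: rmorph_prod. Qed.

Definition int_pos (k : int) : nat := if k is Posz m then m else 0%N.
Definition int_neg (k : int) : nat := if k is Negz m then m.+1 else 0%N.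

Lemma int_posneg k : k = (int_pos k)%:Z - (int_neg k)%:Z.
Proof. by case: k => m /=; rewrite ?subr0 // NegzE sub0r. Qed.

Lemma exprz_posneg (F : fieldType) (y : F) (k : int) :
  y != 0 -> y ^ k * y ^+ int_neg k = y ^+ int_pos k.
Proof.
by move=> y0; rewrite {1}(int_posneg k) expfzDr // -exprnN -exprnP mulfVK ?expf_neq0.
Qed.

Section IdempotentTorus.
Variables (K : closedFieldType) (n s : nat) (E : 'I_s -> 'M[K]_n) (c b : 'I_s -> int).
Hypothesis orthE : forall i j, E i *m E j = if i == j then E i else 0.
Hypothesis sumE : \sum_i E i = 1%:M.
Hypothesis E0 : forall i, E i <> 0.
Hypothesis bc1 : \sum_i b i * c i = 1.

Definition idem_comb (w : 'I_s -> K) : 'M[K]_n := \sum_i w i *: E i.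
Definition idem_cochar (y : K) : 'M[K]_n := idem_comb (fun i => y ^ c i).

Lemma idem_comb_mulE w i : E i *m idem_comb w = w i *: E i.
Proof.
rewrite mulmx_sumr (bigD1 i) //= -scalemxAr orthE eqxx big1 ?addr0 // => j ji.
by rewrite -scalemxAr orthE eq_sym (negPf ji) scaler0.
Qed.

Lemma idem_combM w w' : idem_comb w *m idem_comb w' = idem_comb (fun i => w i * w' i).
Proof.
rewrite {1}/idem_comb mulmx_suml; apply: eq_bigr => i _.
by rewrite -scalemxAl idem_comb_mulE scalerA.
Qed.

Lemma idem_cocharM y z : idem_cochar y *m idem_cochar z = idem_cochar (y * z).
Proof. by rewrite idem_combM; apply: eq_bigr => i _; rewrite expfzMl. Qed.

Lemma idem_cochar1 : idem_cochar 1 = 1%:M.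
Proof. by rewrite -sumE; apply: eq_bigr => i _; rewrite exp1rz scale1r. Qed.

Lemma idem_cocharV y : y != 0 ->
  idem_cochar y \in unitmx /\ invmx (idem_cochar y) = idem_cochar y^-1.
Proof.
move=> y0; have yV : idem_cochar y *m idem_cochar y^-1 = 1%:M.
  by rewrite idem_cocharM mulfV // idem_cochar1.
have [uy _] := mulmx1_unit yV; split=> //.
by rewrite -[RHS](mulKmx uy) yV mulmx1.
Qed.

Let pos_ex : exists pq : 'I_s -> 'I_n * 'I_n, forall i, E i (pq i).1 (pq i).2 != 0.
Proof.
suff /choice [f fP] : forall i, exists pq : 'I_n * 'I_n, E i pq.1 pq.2 != 0 by exists f.
move=> i; apply: contrapT => H; apply: (E0 (i := i)).
apply/matrixP => a d; rewrite mxE; apply/eqP; apply: contraT => Ead.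
by case: H; exists (a, d).
Qed.

(** The curve is cut out in [GL_n] by two kinds of equations: [A] lies in the span of the [E i], and
    its coefficients satisfy all monomial relations orthogonal to [c]. As [\sum_i b i * c i = 1],
    the parameter is recovered as the product of the [w i A ^ b i], which gives a regular
    inverse. *)
Lemma idempotent_torus : torus [set idem_cochar y | y in [set y | y != 0]]%classic.
Proof.
have [pq Epq] := pos_ex.
pose w i (A : 'M[K]_n) := (E i *m A) (pq i).1 (pq i).2 / E i (pq i).1 (pq i).2.
pose wp i (A : 'M[{mpoly K[n * n]}]_n) : {mpoly K[n * n]} :=
  (map_mx (@mpolyC _ K) (E i) *m A) (pq i).1 (pq i).2 * ((E i (pq i).1 (pq i).2)^-1)%:MP.
have wpE i Phi A : mx_meval (wp i Phi) A = w i (map_mx (mmap idfun (fun k => mxvec A 0 k)) Phi).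
  rewrite [LHS]mxevM mxevC /w; congr (_ * _).
  transitivity ((map_mx (mmap idfun (fun k => mxvec A 0 k))
      (map_mx (@mpolyC _ K) (E i) *m Phi)) (pq i).1 (pq i).2); first by rewrite [RHS]mxE.
  by rewrite map_mxM map_mpolyC_mx map_mx_id.
have [wg wgE] : exists f, forall i A, mx_meval (f i) A = w i A.
  by exists (fun i => wp i generic_mx) => i A; rewrite wpE map_generic_mx.
(* [wa] reads coefficients off the adjugate, to express the negative powers in the inverse map. *)
have [wa waE] : exists f, forall i A, mx_meval (f i) A = w i (\adj A).
  by exists (fun i => wp i (\adj generic_mx)) => i A; rewrite wpE map_mx_adj map_generic_mx.
have w_comb i v : w i (idem_comb v) = v i.
  by rewrite /w idem_comb_mulE mxE mulfK.
have wZ i a A : w i (a *: A) = a * w i A by rewrite /w -scalemxAr mxE mulrA.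
pose rel (p : {mpoly K[n * n]}) :=
  (exists k l, p = (generic_mx - \sum_i wg i *: map_mx (@mpolyC _ K) (E i)) k l) \/
  (exists2 a : 'I_s -> int, \sum_i a i * c i = 0 &
     p = \prod_i wg i ^+ int_pos (a i) - \prod_i wg i ^+ int_neg (a i)).
have relE1 A k l : mx_meval ((generic_mx - \sum_i wg i *: map_mx (@mpolyC _ K) (E i)) k l) A
    = (A - idem_comb (fun i => w i A)) k l.
  rewrite !mxsubE mx_mevalB; congr (_ - _).
    by rewrite -[in RHS](map_generic_mx idfun A) [RHS]mxE.
  rewrite /idem_comb !summxE [LHS]rmorph_sum; apply: eq_bigr => i _.
  by rewrite !mxE rmorphM /= -[_.@[_]]/(mx_meval _ _) wgE mevalC.
have relE2 A (f : int -> nat) (a : 'I_s -> int) :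
    mx_meval (\prod_i wg i ^+ f (a i)) A = \prod_i w i A ^+ f (a i).
  by rewrite mx_meval_prod; apply: eq_bigr => i _; rewrite mx_mevalXn wgE.
pose T' : set 'M[K]_n := [set idem_cochar y | y in [set y | y != 0]]%classic.
have TE : T' = ([set g | g \in unitmx] `&` [set A | forall p, rel p -> mx_meval p A = 0])%classic.
  apply/seteqP; split=> [_ [y y0 <-]|A [uA ZA]].
    have [uy _] := idem_cocharV y0; split=> // p [[k [l ->]]|[a ac ->]].
      rewrite relE1; have -> : idem_comb (fun i => w i (idem_cochar y)) = idem_cochar y.
        by apply: eq_bigr => i _; rewrite w_comb.
      by rewrite subrr mxE.
    rewrite mx_mevalB !relE2; apply/eqP; rewrite subr_eq0; apply/eqP.
    transitivity (\prod_i (y ^ c i) ^ a i * \prod_i w i (idem_cochar y) ^+ int_neg (a i)).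
      rewrite -big_split; apply: eq_bigr => i _ /=.
      by rewrite w_comb exprz_posneg // expfz_neq0.
    rewrite [X in X * _](_ : _ = 1) ?mul1r // -[RHS](expr0z y) -ac -prod_exprz //.
    by apply: eq_bigr => i _; rewrite exprz_exp mulrC.
  have AE : A = idem_comb (fun i => w i A).
    apply/eqP; rewrite -subr_eq0; apply/eqP/matrixP => k l.
    by rewrite -relE1 [RHS]mxE; apply: ZA; left; exists k, l.
  have w0 i : w i A != 0.
    apply/eqP => wi0; apply: (E0 (i := i)); rewrite -[LHS](mulmxK uA) AE idem_comb_mulE.
    by rewrite wi0 scale0r mul0mx.
  have wrel (a : 'I_s -> int) : \sum_i a i * c i = 0 -> \prod_i w i A ^ a i = 1.
    move=> ac; have pneg0 : \prod_i w i A ^+ int_neg (a i) != 0.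
      by apply/prodf_neq0 => i _; rewrite expf_neq0.
    apply: (mulIf pneg0); rewrite mul1r -big_split.
    have /eqP : mx_meval (\prod_i wg i ^+ int_pos (a i) -
       \prod_i wg i ^+ int_neg (a i)) A = 0 by apply: ZA; right; exists a.
    rewrite mx_mevalB !relE2 subr_eq0 => /eqP <-; apply: eq_bigr => i _ /=.
    exact: exprz_posneg.
  pose y := \prod_i w i A ^ b i.
  have y0 : y != 0 by apply/prodf_neq0 => i _; rewrite expfz_neq0.
  exists y => //; rewrite [RHS]AE; apply: eq_bigr => j _; congr (_ *: _).
  (* This exponent vector is orthogonal to [c] because [\sum_i b i * c i = 1]; its relation reads
     [w j A = y ^ c j]. *)
  have := wrel (fun i => (i == j)%:R - b i * c j).
  have -> : \prod_i w i A ^ ((i == j)%:R - b i * c j) = w j A * (y ^ c j)^-1.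
    transitivity (\prod_i (w i A ^ (i == j)%:R * (w i A ^ (b i)) ^ (- c j))).
      by apply: eq_bigr => i _; rewrite expfzDr // exprz_exp mulrN.
    rewrite big_split /=; congr (_ * _).
      by rewrite (bigD1 j) //= eqxx big1 ?mulr1 // => i /negPf->; exact: expr0z.
    by rewrite invr_expz prodr_exprz.
  move=> H; have /H : \sum_i ((i == j)%:R - b i * c j) * c i = 0.
    rewrite (eq_bigr (fun i => (i == j)%:R * c i - c j * (b i * c i))); last by move=> i _; ring.
    rewrite sumrB -mulr_sumr bc1 (bigD1 j) //= eqxx.
    rewrite big1 ?addr0 => [|i /negPf->]; last by rewrite mul0r.
    by rewrite mul1r mulr1 subrr.
  move/(congr1 (fun x => x * y ^ c j)); rewrite mulfVK ?mul1r //; exact: expfz_neq0.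
have algT : algebraic_group T'.
  split.
  - exists [set A | forall p, rel p -> mx_meval p A = 0]%classic => //.
    by exists rel.
  - by exists 1; rewrite ?idem_cochar1 //= oner_neq0.
  - move=> _ _ [y y0 <-] [z z0 <-]; exists (y * z); rewrite ?idem_cocharM //.
    exact: mulf_neq0.
  - move=> _ [y y0 <-]; exists y^-1; first by rewrite /= invr_eq0.
    by have [_ ->] := idem_cocharV y0.
have diag1 (A : 'M[K]_1) : diag_torus A <-> A 0 0 != 0.
  split=> [[z z0 <-]|A0]; first by rewrite mxE eqxx; exact: z0.
  exists (\row_i A 0 0) => [i|]; first by rewrite mxE.
  by apply/matrixP => i j; rewrite !ord1 !mxE eqxx.
split=> //; exists 1%N, (fun A => idem_cochar (A 0 0)); split.
  split=> [A /diag1 A0|A A' _ _|]; first by exists (A 0 0).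
    by rewrite idem_cocharM !mxE big_ord1.
  pose k := (\sum_i absz (c i))%N.
  have ck i : (absz (c i) <= k)%N by rewrite /k (bigD1 i) //= leq_addr.
  exists (fun a d => \sum_i generic_mx 0 0 ^+ (absz (c i + k%:Z)) * (E i a d)%:MP), k.
  move=> A /diag1 A0 a d; rewrite det_mx11 summxE [mx_meval _ _]rmorph_sum mulr_suml.
  apply: eq_bigr => i _; rewrite [LHS]mxE.
  transitivity (A 0 0 ^+ absz (c i + k%:Z) * E i a d / A 0 0 ^+ k).
    rewrite mulrAC; congr (_ * _); rewrite exprnP exprnN -expfzDr //; congr (_ ^ _).
    by have := ck i; lia.
  congr (_ / _); rewrite [RHS](mxevM idfun) (mxevXn idfun) (mxevC idfun); congr (_ ^+ _ * _).
  by rewrite -[in LHS](map_generic_mx idfun A) [LHS]mxE.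
pose k := (\sum_i int_neg (b i))%N.
pose P := \prod_i (wg i ^+ int_pos (b i) * wa i ^+ int_neg (b i)).
pose chi A := mx_meval P A * \det A ^- k.
have chiE y : y != 0 -> chi (idem_cochar y) = y.
  move=> y0; have [uy yV] := idem_cocharV y0; set A := idem_cochar y in uy yV *.
  have dA : \det A != 0 by rewrite -unitfE -unitmxE.
  have adjA : \adj A = \det A *: idem_cochar y^-1.
    by rewrite -yV /invmx uy scalerA mulfV // scale1r.
  suff PE : mx_meval P A = y * \det A ^+ k by rewrite /chi PE mulfK // expf_neq0.
  transitivity (\prod_i (y ^ (b i * c i) * \det A ^+ int_neg (b i))).
    rewrite mx_meval_prod; apply: eq_bigr => i _; rewrite mx_mevalM !mx_mevalXn wgE waE.
    rewrite adjA wZ !w_comb exprMn mulrCA mulrC; congr (_ * _).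
    case: (b i) => m /=; rewrite !expr0 ?mulr1 ?mul1r exprnP ?exprz_inv exprz_exp; congr (_ ^ _).
      by rewrite mulrC.
    by rewrite NegzE !mulNr mulrC.
  by rewrite big_split /= prod_exprz // bc1 expr1z -prodrXr.
exists (fun A => (chi A)%:M); split.
- split=> [_ [y y0 <-]|_ _ [y y0 <-] [z z0 <-]|].
  + by apply/diag1; rewrite mxE eqxx chiE.
  + by rewrite idem_cocharM !chiE ?mulf_neq0 // scalar_mxM.
  by exists (fun _ _ => P), k => A _ i j; rewrite !ord1 mxE eqxx.
- move=> A /diag1 A0; rewrite chiE //; apply/matrixP => i j.
  by rewrite !ord1 mxE eqxx.
- by move=> _ [y y0 <-]; rewrite mxE eqxx mulr1n chiE.
Qed.

Lemma idem_cochar_inj1 y : y != 0 -> idem_cochar y = 1%:M -> y = 1.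
Proof.
move=> y0 y1; have yc i : y ^ c i = 1.
  apply/eqP; rewrite -subr_eq0; apply/eqP; have := idem_comb_mulE (fun i => y ^ c i) i.
  rewrite -/(idem_cochar y) y1 mulmx1 => /eqP; rewrite -{1}[E i]scale1r -subr_eq0 -scalerBl.
  rewrite scaler_eq0 => /orP[/eqP e|/eqP /E0 //].
  by rewrite -opprB e oppr0.
rewrite -[LHS]expr1z -bc1 -prod_exprz // big1 // => i _.
by rewrite mulrC -exprz_exp yc exp1rz.
Qed.

End IdempotentTorus.

(** The binomial coefficient as a polynomial in its upper argument, so that powers [g ^ k] become
    exponential polynomials in [k]. *)
Definition bin_poly (F : fieldType) j : {poly F} :=
  (j`!%:R)^-1 *: \prod_(i < j) ('X - i%:R%:P).

Lemma bin_polyE (F : fieldType) j k : [pchar F] =i pred0 ->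
  (bin_poly F j).[k%:R] = 'C(k, j)%:R.
Proof.
move=> charF; rewrite /bin_poly hornerZ horner_prod.
have fj : j`!%:R != 0 :> F by rewrite ((pcharf0P F).1 charF) -lt0n fact_gt0.
apply: (mulfI fj); rewrite mulrA mulfV // mul1r -natrM mulnC bin_ffact.
rewrite (eq_bigr (fun i : 'I_j => k%:R - i%:R)) => [|i _]; last by rewrite !hornerE.
elim: j {fj} => [|j IH]; first by rewrite big_ord0.
rewrite big_ord_recr /= IH ffactnSr natrM.
have [jk|kj] := leqP j k; first by rewrite natrB.
by rewrite ffact_small // !mul0r.
Qed.

(** * The closure of a cyclic group *)

Section TorusInGroup.
Variables (K : closedFieldType) (n : nat) (G : set 'M[K]_n).
Hypothesis charK : [pchar K] =i pred0.
Hypothesis algG : algebraic_group G.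

Lemma algebraic_groupP A : G A <-> A \in unitmx /\ points G idfun A.
Proof.
have [[Z [S ZE] GE] _ _ _] := algG; split=> [GA|[uA pA]].
  by split=> [|p vp]; [move: GA; rewrite GE => -[] | exact: vp].
rewrite GE; split=> //; rewrite ZE => p Sp; apply: (pA p) => g.
by rewrite GE => -[_]; rewrite ZE; apply.
Qed.

Lemma pow_group g k : G g -> G (g ^+ k).
Proof.
have [_ G1 GM _] := algG; move=> Gg; elim: k => [|k IH]; first by rewrite expr0.
by rewrite exprS -mulmxE; exact: GM.
Qed.

(** By the binomial formula [g ^ k = \sum_i lam_i ^ k M_i(k)] with [M_i] polynomial and
    [M_i(0) = E i]. With [c] from [cocharacter_exists], the [y ^ c i] satisfy every multiplicative
    relation of the [lam i], so [exponential_closure] puts [\sum_i y ^ c i E i] in [G]. *)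
Lemma torus_of_eigenvalue g a : G g -> eigenvalue g a ->
  (forall k, (0 < k)%N -> a ^+ k != 1) ->
  exists2 T, torus T & (forall h, T h -> G h) /\ exists2 h, T h & h <> 1%:M.
Proof.
move=> Gg /eigenvalueP[v vg v0] a1.
have [ug _] := (algebraic_groupP g).1 Gg.
have [s [lam [E [N [lam_inj [jg E0]]]]]] := jordan_exists g.
have [r Nr] := jordan_nilp jg.
have gE k i : g ^+ k *m E i = E i *m ((lam i)%:M + N) ^+ k.
  elim: k => [|k IH]; first by rewrite !expr0 mul1mx mulmx1.
  rewrite !exprS -mulmxE -mulmxA IH !mulmxA (jordan_mulE jg) (jordan_comm jg).
  by rewrite mulmxDr mul_mx_scalar.
have lam0 i : lam i != 0.
  apply/eqP => li; apply: (E0 i).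
  have ugr : g ^+ r \in unitmx by have [] := (algebraic_groupP _).1 (pow_group r Gg).
  by rewrite -[LHS](mulKmx ugr) gE li -scalemx1 scale0r add0r Nr mulmx0 mulmx0.
have [i0 ai0] : exists i, a = lam i.
  apply: contrapT => na; case/eqP: v0.
  rewrite -[v]mulmx1 -(jordan_sum jg) mulmx_sumr big1 // => i _.
  have ai : a - lam i != 0 by rewrite subr_eq0; apply/eqP => e; apply: na; exists i.
  have step : (a - lam i) *: (v *m E i) = v *m E i *m N.
    have e1 : v *m g *m E i = a *: (v *m E i) by rewrite vg scalemxAl.
    have : v *m g *m E i = lam i *: (v *m E i) + v *m E i *m N.
      rewrite -mulmxA (jordan_mulE jg) (jordan_comm jg) mulmxDr mulmxA.
      by rewrite -scalemxAr.
    by rewrite e1 scalerBl => ->; rewrite addrC addKr.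
  have steps k : (a - lam i) ^+ k *: (v *m E i) = v *m E i *m N ^+ k.
    elim: k => [|k IH]; first by rewrite !expr0 scale1r mulmx1.
    rewrite exprS -scalerA IH scalemxAl step exprS -mulmxE; by rewrite !mulmxA.
  have := steps r; rewrite Nr mulmx0 => /eqP; rewrite scaler_eq0 expf_eq0 (negPf ai) andbF.
  by move/eqP.
have a1' k : (0 < k)%N -> lam i0 ^+ k != 1 by rewrite -ai0; exact: a1.
have [c [b [bc1 crel]]] := cocharacter_exists lam0 a1'.
have orthE := jordan_orth jg; have sumE := jordan_sum jg.
have two0 : 2%:R != 0 :> K by rewrite ((pcharf0P K).1 charK).
exists ([set idem_cochar E c y | y in [set y | y != 0]])%classic.
  exact: idempotent_torus orthE sumE E0 bc1.
split=> [_ [y y0 <-]|]; last first.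
  exists (idem_cochar E c 2%:R); first by exists 2%:R.
  move/(idem_cochar_inj1 orthE E0 bc1 two0)/eqP.
  by rewrite -subr_eq0 -[2%:R]/(1 + 1) addrK oner_eq0.
apply/algebraic_groupP; split; first by have [] := idem_cocharV c orthE sumE y0.
move=> p vp.
pose M i : 'M[{poly K}]_n :=
  \sum_(j < r) bin_poly K j *: map_mx polyC ((lam i) ^- j *: (E i *m N ^+ j)).
have ME i x : map_mx (horner_eval x) (M i) =
    \sum_(j < r) (bin_poly K j).[x] *: ((lam i) ^- j *: (E i *m N ^+ j)).
  rewrite map_mx_sum; apply: eq_bigr => j _; rewrite map_mxZ; congr (_ *: _).
  by apply/matrixP => k l; rewrite !mxE; exact: hornerC.
have -> : idem_cochar E c y = \sum_i y ^ c i *: map_mx (horner_eval 0) (M i).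
  apply: eq_bigr => i _; congr (_ *: _); rewrite ME.
  have bin0E j : (bin_poly K j).[0] = 'C(0, j)%:R := bin_polyE j 0 charK.
  case: (r) Nr => [|r'] Nr0.
    by rewrite big_ord0 -[LHS]mulmx1 -[1%:M](expr0 N) Nr0 mulmx0.
  rewrite big_ord_recl big1 ?addr0 => [|j _]; last by rewrite bin0E bin0n scale0r.
  by rewrite bin0E bin0 scale1r !expr0 invr1 scale1r mulmx1.
apply: (exponential_closure (Lam := lam)) => // [e e'|k].
  have mE (e0 : 'X_{1..s}) : mmap1 (fun i => y ^ c i) e0 = y ^ (\sum_i (e0 i)%:Z * c i).
    by rewrite -prod_exprz //; apply: eq_bigr => i _; rewrite exprnP exprz_exp mulrC.
  move=> ee; rewrite !mE; congr (y ^ _); apply/eqP; rewrite -subr_eq0 -sumrB; apply/eqP.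
  rewrite -[RHS](crel (fun i => (e i)%:Z - (e' i)%:Z)).
    by apply: eq_bigr => i _; rewrite mulrBl.
  transitivity (mmap1 lam e / mmap1 lam e'); last first.
    by rewrite ee mulfV //; apply/prodf_neq0 => i _; rewrite expf_neq0.
  rewrite /mmap1 -prodfV -big_split; apply: eq_bigr => i _ /=.
  by rewrite expfzDr // exprnN.
have -> : \sum_i lam i ^+ k *: map_mx (horner_eval k%:R) (M i) = g ^+ k.
  rewrite -[RHS]mulmx1 -sumE mulmx_sumr; apply: eq_bigr => i _; rewrite gE ME.
  pose f j := ('C(k, j)%:R * (lam i ^+ k / lam i ^+ j)) *: N ^+ j.
  have f_r j : (r <= j)%N -> f j = 0.
    by move=> rj; rewrite /f (_ : N ^+ j = 0) ?scaler0 // -(subnKC rj) exprD Nr mul0r.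
  have f_k j : (k < j)%N -> f j = 0 by move=> kj; rewrite /f bin_small // mul0r scale0r.
  transitivity (E i *m \sum_(j < r) f j).
    rewrite scaler_sumr mulmx_sumr; apply: eq_bigr => j _.
    by rewrite /f bin_polyE // -scalemxAr !scalerA; congr (_ *: _); ring.
  congr (_ *m _); rewrite (sum_ord_vanish f_r f_k) exprDn_comm; last first.
    by rewrite /GRing.comm -!mulmxE scalar_mxC.
  apply: eq_bigr => j _; have jk : (j <= k)%N by rewrite -ltnS.
  have -> : ((lam i)%:M : 'M[K]_n) ^+ (k - j) = (lam i ^+ (k - j))%:M.
    by elim: (k - j)%N => [|l IH]; rewrite ?expr0 // !exprS IH -mulmxE -scalar_mxM.
  rewrite /f -mulmxE mul_scalar_mx -scaler_nat scalerA; congr (_ *: (_ : 'M_n)).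
  have -> : lam i ^+ k = lam i ^+ (k - j) * lam i ^+ j by rewrite -exprD subnK.
  by rewrite mulfK ?expf_neq0.
by have [_] := (algebraic_groupP _).1 (pow_group k Gg); apply.
Qed.

End TorusInGroup.

(** * The Nullstellensatz over an uncountable field *)

Lemma uncountable_fiber (T : choiceType) (U : set T) (f : T -> nat) : ~ countable U ->
  exists v, forall n, exists c : 'I_n -> T, injective c /\ forall i, U (c i) /\ f (c i) = v.
Proof.
move=> ncU; pose A v := (U `&` [set c | f c = v])%classic.
have [v Av] : exists v, ~ finite_set (A v).
  apply: contrapT => /forallNP H; apply: ncU.
  have -> : U = (\bigcup_v A v)%classic.
    by apply/seteqP; split=> [c Uc|c [v _ []] //]; exists (f c).
  by apply: bigcup_countable => // v _; apply: finite_set_countable; apply: contrapT; exact: H.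
exists v => n; have [B BA nB] := infinite_set_fset n Av.
have sB : (n <= size (finmap.enum_fset B))%N by [].
have [c0 _] := infinite_setN0 Av.
pose c (i : 'I_n) := nth c0 (finmap.enum_fset B) i.
exists c; split=> [i j /eqP|i].
  rewrite nth_uniq ?finmap.fset_uniq ?(leq_trans _ sB) //; first by move/eqP/val_inj.
have : A v (c i) by apply: BA; apply: mem_nth; exact: leq_trans sB.
by [].
Qed.

Section Nullstellensatz.
Variables (K : closedFieldType) (N : nat).
Local Notation A := {mpoly K[N]}.
Implicit Types (I J : set A) (p q s : A).

Definition ideal I := [/\ I 0, forall p q, I p -> I q -> I (p + q) & forall p q, I q -> I (p * q)].

Definition mpeval (Q : {poly K}) p : A := (map_poly (@mpolyC N K) Q).[p].

Lemma mpeval_prod (r : seq K) p :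
  mpeval (\prod_(c <- r) ('X - c%:P)) p = \prod_(c <- r) (p - c%:MP).
Proof.
rewrite /mpeval rmorph_prod horner_prod; apply: eq_bigr => c _.
by rewrite rmorphB /= map_polyX map_polyC !hornerE.
Qed.

Lemma mpevalZ c Q p : mpeval (c *: Q) p = c%:MP * mpeval Q p.
Proof. by rewrite /mpeval map_polyZ hornerZ. Qed.

Lemma ideal_sub I p q : ideal I -> I p -> I q -> I (p - q).
Proof. by case=> _ ID IM Ip Iq; apply: ID => //; rewrite -mulN1r; exact: IM. Qed.

Lemma ideal_sum I (T : finType) (f : T -> A) : ideal I -> (forall i, I (f i)) -> I (\sum_i f i).
Proof. by case=> I0 ID _ If; elim/big_rec: _ => // i x _; exact: ID. Qed.

(* The functions [1 / (p - c)] are uncountably many in a space of countable    *)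
(* dimension, and a linear relation among them is an equation satisfied by [p]. *)
Lemma uncountable_inverse_algebraic I (U : set K) s p : ideal I -> ~ countable U ->
  (forall c, U c -> exists q k, I (q * (p - c%:MP) - s ^+ k)) ->
  exists Q k, Q != 0 /\ I (s ^+ k * mpeval Q p).
Proof.
move=> idI ncU H; have [I0 ID IM] := idI.
have [qf /choice[k qk]] : exists qf : K -> A, forall c, exists k,
    U c -> I (qf c * (p - c%:MP) - s ^+ k).
  suff /choice[qf qP] : forall c, exists q k, U c -> I (q * (p - c%:MP) - s ^+ k) by exists qf.
  move=> c; have [/H[q [k qk]]|nU] := pselect (U c); first by exists q, k.
  by exists 0, 0%N.
(* Arbitrarily many [c] share the same degree bound for [qf c] and the same exponent [k c], so that
   their [qf c] lie in one finite-dimensional space. *)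
have [v fib] := uncountable_fiber (fun c => pickle (msize (qf c), k c)) ncU.
have [c1 [_ /(_ 0)[_ vE]]] := fib 1%N; set c0 := c1 0 in vE.
pose D := msize (qf c0); pose d := #|{: 'X_{1..N < D}}|.
have [c [cI cP]] := fib d.+1.
have cU j : U (c j) by have [] := cP j.
have [qD kc] : (forall j, msize (qf (c j)) = D) /\ (forall j, k (c j) = k c0).
  by split=> j; have [_] := cP j; rewrite -vE => /(pcan_inj pickleK) [].
pose M : 'M[K]_(d.+1, d) := \matrix_(j, l) (qf (c j))@_(enum_val l : 'X_{1..N < D}).
have : kermx M != 0.
  by rewrite kermx_eq0 /row_free neq_ltn (leq_ltn_trans (rank_leq_col M)).
case/rowV0Pn => a /sub_kermxP aM a0.
have rel : \sum_j (a 0 j)%:MP * qf (c j) = 0.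
  apply/mpolyP => m; rewrite mcoeff0 raddf_sum /=.
  have [mD|mD] := ltnP (mdeg m) D; last first.
    rewrite big1 // => j _; rewrite mcoeffCM [X in _ * X]memN_msupp_eq0 ?mulr0 //.
    by apply: contraTN mD => /msize_mdeg_lt; rewrite qD -ltnNge.
  have /rowP/(_ (enum_rank (BMultinom mD))) := aM; rewrite !mxE => e; rewrite -[RHS]e.
  by apply: eq_bigr => j _; rewrite mcoeffCM mxE enum_rankK.
have [j0 aj0] : exists j, a 0 j != 0.
  apply/existsP; apply: contraNT a0; rewrite negb_exists => /forallP a0.
  by apply/eqP/rowP => j; have /negPn/eqP := a0 j; rewrite mxE.
pose W j : seq K := [seq c l | l <- enum 'I_d.+1 & l != j].
(* The numerator of [\sum_j a_j / (X - c_j)]. At [c j0] only the term [j0] survives, so [Q] is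
   nonzero. *)
pose Q := \sum_j a 0 j *: \prod_(x <- W j) ('X - x%:P).
exists Q, (k c0); split.
  apply/eqP => Q0; have : Q.[c j0] = 0 by rewrite Q0 horner0.
  rewrite horner_sum (bigD1 j0) //= [X in _ + X]big1 ?addr0 => [|j jj0]; last first.
    apply/eqP; rewrite hornerZ mulf_eq0; apply/orP; right.
    have : c j0 \in W j.
      by apply: map_f; rewrite mem_filter mem_enum eq_sym jj0.
    by rewrite -root_prod_XsubC => /rootP ->.
  move/eqP; rewrite hornerZ mulf_eq0 (negPf aj0) /=; apply/negP.
  rewrite -[_ == 0]/(root _ _) root_prod_XsubC; apply/negP => /mapP[l].
  by rewrite mem_filter => /andP[lj _] /cI/esym/eqP; rewrite (negPf lj).
have QE : mpeval Q p = \sum_j (a 0 j)%:MP * \prod_(x <- W j) (p - x%:MP).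
  rewrite /mpeval rmorph_sum horner_sum; apply: eq_bigr => j _.
  by rewrite -[LHS]/(mpeval _ p) mpevalZ mpeval_prod.
pose P := \prod_j (p - (c j)%:MP).
have PW j : P = (p - (c j)%:MP) * \prod_(x <- W j) (p - x%:MP).
  rewrite /P (bigD1 j) //=; congr (_ * _); rewrite big_map big_filter.
  by rewrite big_enum_cond.
have -> : s ^+ k c0 * mpeval Q p =
    - \sum_j ((a 0 j)%:MP * \prod_(x <- W j) (p - x%:MP)) *
        (qf (c j) * (p - (c j)%:MP) - s ^+ k (c j)).
  have : \sum_j (a 0 j)%:MP * qf (c j) * P = 0 by rewrite -mulr_suml rel mul0r.
  move/eqP; rewrite -subr_eq0 => /eqP e; apply/eqP; rewrite -subr_eq0; apply/eqP.
  rewrite -[RHS]e QE mulr_sumr subr0 opprK -big_split; apply: eq_bigr => j _ /=.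
  rewrite (PW j) kc; ring.
rewrite -mulN1r; apply: (IM); apply: ideal_sum => // j; apply: IM; exact: qk.
Qed.

(** An ideal [M] containing [J], maximal among those avoiding the powers of [s], is prime. Each [p]
    is congruent modulo [M] to a constant: otherwise [uncountable_inverse_algebraic] gives an
    equation for [p], which splits into factors [p - c]. So [M] is the ideal of a zero of [J], where
    [s] vanishes, and [s] would be in [M]. *)
Lemma nullstellensatz J s : ~ countable [set: K] -> ideal J ->
  (forall x : 'I_N -> K, (forall p, J p -> p.@[x] = 0) -> s.@[x] = 0) ->
  exists k, J (s ^+ k).
Proof.
move=> ncK idJ sJ; apply: contrapT => /forallNP Js.
pose good I := [/\ ideal I, (J `<=` I)%classic & forall k, ~ I (s ^+ k)].
have [|M [PM maxM]] := @Zorn_bigcup _ [set I | I = set0 \/ good I]%classic.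
  move=> F FP tF; have [[I0 FI0 gI0]|nF] := pselect (exists2 I, F I & good I); last first.
    left; apply/seteqP; split=> // p [I FI Ip].
    case: (FP I FI) => [I0|gI]; first by rewrite I0 in Ip.
    by case: nF; exists I.
  have gF I p : F I -> I p -> good I.
    by move=> FI Ip; case: (FP I FI) => // I1; rewrite I1 in Ip.
  right; split.
  - split=> [|p q [I FI Ip] [I' FI' Iq]|p q [I FI Iq]].
    + by exists I0 => //; have [[]] := gI0.
    + case: (tF _ _ FI FI') => sI.
        exists I' => //; have [[_ ID _] _ _] := gF _ _ FI' Iq; apply: ID => //; exact: sI.
      exists I => //; have [[_ ID _] _ _] := gF _ _ FI Ip; apply: ID => //; exact: sI.
    + by exists I => //; have [[_ _ IM] _ _] := gF _ _ FI Iq; exact: IM.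
  - by move=> p Jp; exists I0 => //; have [_ JI _] := gI0; exact: JI.
  - by move=> k [I FI Ik]; have [_ _ nI] := gF _ _ FI Ik; exact: (nI k).
have gJ : good J by split.
have [idM JM Ms] : good M.
  case: PM => // M0; case: (maxM J); last by right.
  rewrite M0; split=> // sub; have [J0 _ _] := idJ; exact: (sub _ J0).
have [M0 MD MM] := idM.
have ext x : ~ M x -> exists q k, M (q * x - s ^+ k).
  move=> Mx; pose I : set A := [set p | exists2 m, M m & exists q, p = m + q * x]%classic.
  have MI : (M `<=` I)%classic by move=> m Mm; exists m => //; exists 0; rewrite mul0r addr0.
  have idI : ideal I.
    split; first exact: MI.
      move=> _ _ [m Mm [q ->]] [m' Mm' [q' ->]]; exists (m + m'); first exact: MD.
      by exists (q + q'); ring.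
    by move=> p _ [m Mm [q ->]]; exists (p * m); [exact: MM | exists (p * q); ring].
  have : ~ good I.
    move=> gI; apply: (maxM I); last by right.
    split=> // IM; apply: Mx; apply: IM; exists 0 => //; exists 1; by rewrite mul1r add0r.
  move=> nI; apply: contrapT => H; apply: nI; split=> // [p Jp|k [m Mm [q sE]]].
    by apply: MI; exact: JM.
  apply: H; exists q, k; rewrite sE opprD addrCA subrr addr0 -mulN1r; exact: MM.
have primeM x y : M (x * y) -> M x \/ M y.
  move=> Mxy; apply: contrapT => /not_orP[/ext[q [k qk]] /ext[q' [k' qk']]].
  apply: (Ms (k + k')%N); rewrite exprD.
  have -> : s ^+ k * s ^+ k' = (q * q') * (x * y) -
      (q' * y * (q * x - s ^+ k) + s ^+ k * (q' * y - s ^+ k')) by ring.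
  by apply: ideal_sub => //; [exact: MM | apply: MD; exact: MM].
have nM1 : ~ M 1 by have := Ms 0%N; rewrite expr0.
have unitM c : M c%:MP -> c = 0.
  move=> Mc; apply/eqP; apply: contrapT => /negP c0; apply: nM1.
  have -> : 1 = (c^-1)%:MP * c%:MP :> A by rewrite -mpolyCM mulVf // mpolyC1.
  exact: MM.
have valM p : exists c, M (p - c%:MP).
  apply: contrapT => /forallNP np.
  have [Q [k [Q0 sQ]]] := @uncountable_inverse_algebraic M [set: K]%classic s p idM ncK
    (fun c _ => ext _ (np c)).
  case: (primeM _ _ sQ) => [/Ms //|].
  have [r QE] := closed_field_poly_normal Q; rewrite QE mpevalZ mpeval_prod.
  case/primeM => [/unitM/eqP|]; first by rewrite lead_coef_eq0 (negPf Q0).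
  elim: (r) => [|c r' IH]; first by rewrite big_nil.
  by rewrite big_cons => /primeM[/np|].
have [x xP] := choice (fun i : 'I_N => valM 'X_i).
have ev p : M (p - (p.@[x])%:MP).
  elim/mpoly_ring_ind: p => [c|i|p q Mp Mq|p q Mp Mq].
  - by rewrite mevalC subrr.
  - by rewrite mevalXU; exact: xP.
  - by rewrite mevalD mpolyCD opprD addrACA; exact: MD.
  - rewrite mevalM mpolyCM.
    have -> : p * q - (p.@[x])%:MP * (q.@[x])%:MP =
      q * (p - (p.@[x])%:MP) + (p.@[x])%:MP * (q - (q.@[x])%:MP) by ring.
    by apply: MD; exact: MM.
have sx : s.@[x] = 0.
  apply: sJ => p /JM Mp; apply: unitM; rewrite -[_%:MP](subKr p); exact: ideal_sub.
by apply: (Ms 1%N); rewrite expr1 -[s]subr0 -(mpolyC0 N K) -sx.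
Qed.
End Nullstellensatz.

(** Nested intervals: the interval of index [n + 1] excludes the [n]-th term of a supposed
    enumeration, while the supremum of the left ends lies in all of them. *)
Lemma real_ray_uncountable (R : realType) (m : R) : ~ countable [set x | m < x]%classic.
Proof.
move=> cm.
have [f fP] : exists f : nat -> R, forall x, m < x -> exists n, f n = x.
  have /countable_injP[h hI] := cm.
  exists (fun n => xget 0 [set x | m < x /\ h x = n]%classic) => x mx.
  exists (h x); case: xgetP => [y _ [my hy]|/(_ x)[]//].
  by apply: hI => //; rewrite inE.
pose mid (I : R * R) := (I.1 + I.2) / 2.
pose step (I : R * R) (x : R) := if x <= mid I then ((mid I + I.2) / 2, I.2) else (I.1, mid I).
pose I := fix I n := if n is n'.+1 then step (I n') (f n') else (m + 1, m + 2).
have Ilt n : (I n).1 < (I n).2.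
  elim: n => [|n IH] /=; first by lra.
  by rewrite /step /mid; case: ifP => _ /=; lra.
have Istep n : (I n).1 <= (I n.+1).1 /\ (I n.+1).2 <= (I n).2.
  by have := Ilt n; rewrite /= /step /mid; case: ifP => _ /= ; lra.
have If n : f n < (I n.+1).1 \/ (I n.+1).2 < f n.
  have := Ilt n; rewrite /= /step; case: (leP (f n) (mid (I n))) => /= fm lt; last by right.
  by left; rewrite /mid in fm *; lra.
have Imono n k : (I n).1 <= (I (n + k)%N).1 /\ (I (n + k)%N).2 <= (I n).2.
  elim: k => [|k [IH1 IH2]]; first by rewrite addn0.
  by rewrite addnS; have [] := Istep (n + k)%N; split; lra.
have cross n k : (I n).1 <= (I k).2.
  have [nk|kn] := leqP n k.
    have [+ _] := Imono n (k - n)%N; rewrite subnKC // => ?; have := Ilt k; lra.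
  have [_ +] := Imono k (n - k)%N; rewrite subnKC ?(ltnW kn) // => ?; have := Ilt n; lra.
pose L : set R := [set (I n).1 | n in [set: nat]]%classic.
have L0 : (L !=set0)%classic by exists (I 0%N).1; exists 0%N.
have Lub k : ubound L (I k).2 by move=> _ [n _ <-]; exact: cross.
have ub : has_ubound L by exists (I 0%N).2; exact: Lub.
have lo n : (I n).1 <= sup L by apply: ub_le_sup => //; exists n.
have hi n : sup L <= (I n).2 by apply: ge_sup.
have [|n fn] := fP (sup L); first by have := lo 0%N; rewrite /=; lra.
by have := If n; rewrite fn; have := lo n.+1; have := hi n.+1; move=> ? ? [] ?; lra.
Qed.

(** * Functions on connected groups that avoid uncountably many values *)

Section ConnectedGroup.
Variables (K : closedFieldType) (n : nat) (G : set 'M[K]_n).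
Hypothesis algG : algebraic_group G.

(** For [c] in [U], a zero of [f - c] and of the equations of [G] cannot be invertible. The
    Nullstellensatz then makes a power of the determinant a multiple of [f - c] on [G], and
    [uncountable_inverse_algebraic] applies. *)
Lemma avoiding_algebraic (f : {mpoly K[n * n]}) (U : set K) :
  ~ countable [set: K] -> ~ countable U -> (forall g, G g -> ~ U (mx_meval f g)) ->
  exists2 Q : {poly K}, Q != 0 & forall g, G g -> Q.[mx_meval f g] = 0.
Proof.
move=> ncK ncU fU.
have meval_mpeval Q A : mx_meval (mpeval Q f) A = Q.[mx_meval f A].
  rewrite /mpeval /mx_meval -horner_map -map_poly_comp map_poly_id // => c _.
  exact: mevalC.
have idV : ideal [set p | vanishes G p]%classic.
  split=> [g Gg|p q vp vq g Gg|p q vq g Gg] /=.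
  - by rewrite /mxev rmorph0.
  - by rewrite mxevD vp // vq // addr0.
  - by rewrite mxevM vq // mulr0.
have [|Q [k [Q0 vQ]]] := @uncountable_inverse_algebraic _ _ _ U (\det generic_mx) f idV ncU.
  move=> c Uc.
  pose J : set {mpoly K[n * n]} := [set p | exists q, vanishes G (p - q * (f - c%:MP))]%classic.
  have idJ : ideal J.
    have [V0 VD VM] := idV; split.
    - by exists 0; rewrite mul0r subr0.
    - move=> p p' [q vq] [q' vq']; exists (q + q').
      by rewrite mulrDl opprD addrACA; exact: VD.
    - by move=> p p' [q vq]; exists (p * q); rewrite -mulrA -mulrBr; exact: VM.
  have [x xJ|k [q vq]] := nullstellensatz (s := \det generic_mx) ncK idJ.
    pose A : 'M[K]_n := vec_mx (\row_k x k).
    have xA p : p.@[x] = mx_meval p A.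
      by apply: eq_bigr => m _; congr (_ * _); apply: mmap1_eq => k; rewrite vec_mxK mxE.
    have dE : mx_meval (\det generic_mx) A = \det A by exact: (mxev_det idfun).
    rewrite xA dE; apply/eqP; apply: contraT => dA; exfalso.
    have GA : G A.
      apply/(algebraic_groupP algG); split; first by rewrite unitmxE unitfE.
      move=> p vp; rewrite -[LHS]/(mx_meval p A) -xA; apply: xJ; exists 0.
      by rewrite mul0r subr0.
    apply: (fU A GA); have : (f - c%:MP).@[x] = 0.
      apply: xJ; exists 1; rewrite mul1r subrr => g Gg; by rewrite /mxev rmorph0.
    by rewrite xA mx_mevalB [mx_meval c%:MP _]mevalC => /eqP; rewrite subr_eq0 => /eqP ->.
  exists q, k => g Gg; have := vq g Gg; rewrite !mxevB => /eqP.
  by rewrite subr_eq0 => /eqP ->; rewrite subrr.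
exists Q => // g Gg; have := vQ g Gg; rewrite mxevM mxevXn mxev_det => /eqP.
have [ug _] := (algebraic_groupP algG g).1 Gg.
rewrite mulf_eq0 expf_eq0 => /orP[/andP[_]|/eqP]; last by rewrite -meval_mpeval.
by move: ug; rewrite unitmxE unitfE => /negPf ->.
Qed.

(** On [G] the values of [f] are among the finitely many roots of [Q], and connectedness separates
    the value at 1 from the others. *)
Lemma avoiding_constant (f : {mpoly K[n * n]}) (U : set K) : zariski_connected G ->
  ~ countable [set: K] -> ~ countable U -> (forall g, G g -> ~ U (mx_meval f g)) ->
  forall g, G g -> mx_meval f g = mx_meval f 1%:M.
Proof.
move=> conn ncK ncU fU; have [Q Q0 Qf] := avoiding_algebraic ncK ncU fU.
have [_ G1 _ _] := algG; have [r QE] := closed_field_poly_normal Q.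
have fr g : G g -> mx_meval f g \in r.
  move=> /Qf/eqP; rewrite QE hornerZ mulf_eq0 lead_coef_eq0 (negPf Q0) /=.
  by rewrite -[_ == 0]/(root _ _) root_prod_XsubC.
pose c := mx_meval f 1%:M; pose r' := [seq x <- r | x != c].
have closedV (p : {mpoly K[n * n]}) : zariski_closed [set A | mx_meval p A = 0]%classic.
  by exists [set p]%classic; apply/seteqP; split=> [A Ap q ->|A Ap] //; exact: Ap.
pose p1 := f - c%:MP; pose p2 := \prod_(x <- r') (f - x%:MP).
have p1E A : mx_meval p1 A = mx_meval f A - c by rewrite mx_mevalB [mx_meval c%:MP _]mevalC.
have p2E A : mx_meval p2 A = \prod_(x <- r') (mx_meval f A - x).
  rewrite [LHS]rmorph_prod; apply: eq_bigr => x _.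
  by rewrite -[LHS]/(mx_meval _ A) mx_mevalB [mx_meval x%:MP _]mevalC.
have [||s|s] := conn _ _ (closedV p1) (closedV p2).
- move=> g Gg /=; rewrite p1E p2E.
  have [->|fc] := eqVneq (mx_meval f g) c; [left|right]; first by rewrite subrr.
  apply/eqP; rewrite prodf_seq_eq0; apply/hasP; exists (mx_meval f g); last by rewrite /= subrr.
  by rewrite mem_filter fc fr.
- apply/seteqP; split=> // g [[Gg /=]]; rewrite p1E p2E => /eqP; rewrite subr_eq0 => /eqP ->.
  move/eqP; rewrite prodf_seq_eq0 => /hasP[x]; rewrite mem_filter => /andP[xc _] /=.
  by rewrite subr_eq0 eq_sym (negPf xc).
- by move=> g /s /=; rewrite p1E => /eqP; rewrite subr_eq0 => /eqP.
- have := s _ G1; rewrite /= p2E => /eqP; rewrite prodf_seq_eq0 => /hasP[x].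
  by rewrite mem_filter => /andP[xc _] /=; rewrite subr_eq0 eq_sym (negPf xc).
Qed.

End ConnectedGroup.

(** * Complex groups and the theorem *)

Section ComplexGroups.
Variable R : realType.
Local Notation K := R[i].

Lemma complex_pchar0 : [pchar K] =i pred0.
Proof. exact: pchar_num. Qed.

Definition complex_ray (m : R) : set K := [set (x%:C)%C | x in [set x | m < x]]%classic.

Lemma complex_ray_uncountable m : ~ countable (complex_ray m).
Proof.
move=> /countable_injP[h hI]; apply: (@real_ray_uncountable R m); apply/countable_injP.
exists (fun x => h (x%:C)%C) => x y; rewrite !inE => mx my hxy.
have ray z : m < z -> (z%:C)%C \in complex_ray m by move=> mz; rewrite inE; exists z.
by have [] := hI _ _ (ray _ mx) (ray _ my) hxy.
Qed.

Lemma complex_uncountable : ~ countable [set: K].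
Proof.
move=> cK; apply: (@complex_ray_uncountable 0).
exact: sub_countable (subset_card_le (@subsetT _ _)) cK.
Qed.

Lemma trace_le n (g : 'M[K]_n) :
  (forall a, eigenvalue g a -> exists2 k, (0 < k)%N & a ^+ k = 1) -> `|\tr g| <= n%:R.
Proof.
case: n g => [|n] g eig; first by rewrite /mxtrace big_ord0 normr0.
have [r gE] := closed_field_poly_normal (char_poly g).
rewrite (monicP (char_poly_monic g)) scale1r in gE.
have sr : size r = n.+1.
  by have := size_char_poly g; rewrite gE size_prod_XsubC => -[].
have : \tr g = \sum_(z <- r) z.
  have := char_poly_trace g (ltn0Sn n); rewrite gE -{1}sr coefPn_prod_XsubC ?sr //.
  by move/oppr_inj.
move=> ->; apply: le_trans (ler_norm_sum _ _ _) _.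
rewrite -sr -sum1_size natr_sum big_seq [X in _ <= X]big_seq; apply: ler_sum => z zr.
have [|k k0 zk] := eig z; first by rewrite eigenvalue_root_char gE root_prod_XsubC.
suff -> : `|z| = 1 by [].
by apply/eqP; rewrite -(pexpr_eq1 k0) // -normrX zk normr1.
Qed.

(** The eigenvalues have modulus 1, so traces avoid the real ray beyond [n] and are constant, equal
    to [n]. Applied to the powers of [h], this gives [\tr ((h - 1) ^ k) = n (1 - 1) ^ k = 0]. *)
Lemma unipotent_of_eigenvalues n (G : set 'M[K]_n) : algebraic_group G -> zariski_connected G ->
  (forall g a, G g -> eigenvalue g a -> exists2 k, (0 < k)%N & a ^+ k = 1) ->
  unipotent_group G.
Proof.
move=> algG conn eig.
have trG g : G g -> \tr g = n%:R.
  move=> Gg; have tE (h : 'M[K]_n) : mx_meval (trace_pow K n 1) h = \tr h.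
    by rewrite meval_trace_pow expr1.
  rewrite -tE (avoiding_constant (U := complex_ray n%:R) algG conn) //.
  - by rewrite tE mxtrace1.
  - exact: complex_uncountable.
  - exact: complex_ray_uncountable.
  move=> h Gh [x nx]; rewrite tE => hx; have := trace_le (eig h ^~ Gh).
  have x0 : 0 <= x by apply: ltW; exact: le_lt_trans (ler0n _ _) nx.
  rewrite -hx ger0_norm ?ler0c // -(rmorph_nat (@real_complex R)) lecR.
  by rewrite leNgt (nx : n%:R < x).
move=> h Gh; apply: (trace_pow_nilpotent complex_pchar0) => k k0.
have comm1 : GRing.comm h (- 1%:M) by rewrite /GRing.comm -!mulmxE mulmxN mulNmx mulmx1 mul1mx.
rewrite (exprDn_comm _ comm1) raddf_sum /=.
transitivity (n%:R * (1 - 1) ^+ k : K); last by rewrite subrr expr0n gtn_eqF // mulr0.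
rewrite exprDn mulr_sumr; apply: eq_bigr => i _.
rewrite raddfMn expr1n mul1r mulrnAr /=; congr (_ *+ _).
have -> : (- 1%:M : 'M[K]_n) ^+ i = ((-1) ^+ i)%:M.
  elim: (nat_of_ord i) => [|j IH]; first by rewrite !expr0.
  by rewrite !exprS IH -mulmxE mulNmx mul1mx mulN1r raddfN.
have trk : \tr (h ^+ (k - i)) = n%:R by apply: trG; exact: pow_group.
by rewrite -mulmxE mul_mx_scalar mxtraceZ trk mulrC.
Qed.

(** [G] and [Gd] have maximal tori of the same rank. In positive rank the torus of [Gd] provides the
    element. In rank 0, [G] contains no nontrivial torus, so its eigenvalues are roots of unity and
    it is unipotent; being reductive it is trivial, yet it is not commutative. *)
Lemma dual_lie_not_nilpotent m n (G : set 'M[K]_m) (Gd : set 'M[K]_n) :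
  simple_group G -> langlands_dual G Gd ->
  exists2 X, lie_algebra Gd X & forall k, X ^+ k <> 0.
Proof.
move=> [algG conn [g [h [Gg Gh ngh]]] _] [[_ _ redG] [[algGd _ _]]].
move=> [[|r] [T [Td [th [thd [[torT TG maxT] isoT [_ TdGd _] isoTd _]]]]]]; last first.
  have [_ Gd1 GdM GdV] := algGd.
  apply: (diag_torus_lie complex_pchar0 Gd1 GdM GdV _ TdGd isoTd) => k Gdk.
  by have [] := (algebraic_groupP algGd k).1 Gdk.
exfalso; have [_ [f' [_ _ thK]]] := isoT.
have T1 : T 1%:M by have [[]] := torT.
have Teq1 k : T k -> k = 1%:M.
  by move=> Tk; rewrite -(thK _ Tk) -(thK _ T1); congr th; rewrite [f' k]flatmx0 [RHS]flatmx0.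
have eig k a : G k -> eigenvalue k a -> exists2 j, (0 < j)%N & a ^+ j = 1.
  move=> Gk ka; apply: contrapT => na.
  have [|T' torT' [T'G [x T'x]]] := torus_of_eigenvalue complex_pchar0 algG Gk ka.
    by move=> j j0; apply/eqP => aj; apply: na; exists j.
  have T'T : T' = T by apply: maxT => // y /Teq1 ->; have [[]] := torT'.
  by rewrite T'T in T'x; move=> /(_ (Teq1 x T'x)).
have uG := unipotent_of_eigenvalues algG conn eig.
have GE : G = [set 1%:M]%classic.
  apply: redG => //; split=> // x y Gx Gy; have [_ _ GM GV] := algG.
  by apply: (GM) => //; [exact: GM | exact: GV].
by apply: ngh; move: Gg Gh; rewrite GE => -> ->.
Qed.

End ComplexGroups.

Lemma denq_dvd (s : rat) (d : nat) (z : int) : s * d%:R = z%:~R -> (denq s %| d%:Z)%Z.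
Proof.
move=> sd; have dn : coprimez (denq s) (numq s).
  by rewrite coprimezE coprime_sym; exact: coprime_num_den.
rewrite -(Gauss_dvdzr _ dn); apply/dvdzP; exists z; apply: (intr_inj (R := rat)).
rewrite !rmorphM /= -sd -{2}[s]divq_num_den pmulrn; field.
by rewrite intr_eq0 denq_neq0.
Qed.

Theorem corollary1 (R : realType)
    (m : nat) (G : set 'M[R[i]]_m)
    (n : nat) (Gd : set 'M[R[i]]_n)
    (simpleG : simple_group G) (adjointG : adjoint_type G)
    (dualG : langlands_dual G Gd)
    (degrees : seq nat) (degreesP : fundamental_degrees Gd degrees)
    (sigma : set 'M[laurent R[i]]_n) (sigmaP : Loc Gd sigma)
    (s : rat) (slopeP : slope Gd sigma s) :
  exists2 d, d \in degrees & (denq s %| d%:Z)%Z.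
Proof.
have [X LX Xnil] := dual_lie_not_nilpotent simpleG dualG.
have [_ [[algGd _ _] _]] := dualG.
have [_ G1 GM GV] := algGd; have charK := complex_pchar0 R.
have Gunit g : Gd g -> g \in unitmx by move=> /(algebraic_groupP algGd)[].
have [d0 [_ [d0ds _ _ _]]] := fundamental_invariant_neq0 charK Gunit degreesP LX Xnil.
case: slopeP => [[_ ->]|[_ [A [a [b [sA b0 -> [B BA Bred]]]]]]].
  by exists d0; rewrite // dvd1z.
(* The comparison of polar parts requires a pole of order at least 2; [a = 0] is slope 0 again. *)
have [-> |a0] := posnP a; first by exists d0; rewrite // mul0r dvd1z.
have LA : laurent_lie Gd A.
  case: sigmaP => A0 LA0 sE; move: sA; rewrite -sE => -[g [ug pg] gA].
  apply/laurent_lieP; apply: (gauge_rel_lie G1 GM GV Gunit ug pg).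
    by apply/gaugeP; eassumption.
  exact/laurent_lieP.
have [d dds /dvdnP[q adq]] :=
  reduced_pullback_degree charK G1 GM GV Gunit degreesP LA a0 b0 BA Bred.
exists d => //; apply: (@denq_dvd _ _ q).
have b0' : b%:Q != 0 by rewrite intr_eq0; lia.
apply: (mulIf b0'); rewrite mulrAC mulfVK // -!pmulrn -!natrM adq.
by [].
Qed.
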